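(* Let $V^h$, $A$ and $Q$ be the finite element space and the discrete operators defined in the context, and consider the implicit Lax-Wendroff scheme with step $\tau>0$ $$\Bigl(I-\frac{1}{12}\tau^2Q\Bigr)\frac{y^{n+1}-y^n}{\tau}+A\,\frac{y^{n+1}+y^n}{2}=0,\qquad n=0,1,\dots,N-1,\qquad y^0=u^0\in V^h.$$ If $$\tau<\frac{2\cdot 3^{1/2}}{\|Q\|^{1/2}},$$ then the scheme provides a time-reversible computational algorithm and is stable, and its solution satisfies $$\|y^{n+1}\|_E=\|y^n\|_E,\qquad E=I-\frac{1}{12}\tau^2Q,\qquad n=0,1,\dots,N-1.$$
   Context: Let $\Omega\subset\mathbb{R}^2$ be a bounded domain with sufficiently regular (e.g. Lipschitz) boundary and outer normal $\boldsymbol\nu$, and let $\boldsymbol v(\boldsymbol x)$ be a sufficiently regular (e.g. Lipschitz) time-independent velocity field on $\Omega$ with $\boldsymbol v\cdot\boldsymbol\nu=0$ on $\partial\Omega$. Let $V^h\subset H^1(\Omega)$ be a finite-dimensional (finite element) subspace, with inner product $(w,u)=\int_\Omega w\,u\,d\boldsymbol x$ and norm $\|w\|=(w,w)^{1/2}$; $\|Q\|$ denotes the induced operator norm and $I$ is the identity. Put $\mathcal{A}w=\frac12\mathrm{div}(\boldsymbol v\,w)+\frac12\boldsymbol v\cdot\mathrm{grad}\,w$. The operators $A,Q:V^h\to V^h$ are defined by $$(Aw,u)=a(w,u)=\int_\Omega(\mathcal{A}w)\,u\,d\boldsymbol x,\qquad (Qw,u)=q(w,u)=\int_\Omega(\mathcal{A}w)(\mathcal{A}u)\,d\boldsymbol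 x,\qquad\forall\, w,u\in V^h.$$ By the boundary condition on $\boldsymbol v$, $A=-A^*$ on $V^h$; also $Q=Q^*\ge0$. (If $Q=0$ the restriction on $\tau$ is void.) For a positive self-adjoint operator $E$ on $V^h$, the space $H_E$ has scalar product $(u,v)_E=(Eu,v)$ and norm $\|u\|_E=(u,u)_E^{1/2}$; under the stated restriction on $\tau$ the operator $E=I-\frac1{12}\tau^2Q$ is positive, and stability is understood in the norm $\|\cdot\|_E$: $\|y^{n+1}\|_E\le\|y^n\|_E$. The algorithm is time-reversible if, whenever $y^{n+1}$ is computed from $y^n$ by one step of the scheme and then $\boldsymbol v$ is replaced by $-\boldsymbol v$ (so that $A$ is replaced by $-A$ and $Q$ is unchanged), the next step of the scheme, started from $y^{n+1}$, yields a solution that coincides with $y^n$. Here it is understood that each step determines $y^{n+1}$ uniquely from $y^n$. *)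

(* Defs.v *)
From HB Require Import structures.
From mathcomp Require Import all_boot all_order all_algebra.
From mathcomp Require Import all_classical all_reals all_analysis.

Set Implicit Arguments.
Unset Strict Implicit.
Unset Printing Implicit Defensive.

Import Order.TTheory GRing.Theory Num.Theory.
Import numFieldNormedType.Exports.

Local Open Scope classical_set_scope.
Local Open Scope ring_scope.

Notation leb2 := (lebesgue_measure \x lebesgue_measure)%E.

Section Plane.
Variable R : realType.
Implicit Types (Omega : set (R * R)) (f w c d phi : R * R -> R)
  (F g v : R * R -> R * R) (x p nu e : R * R).

(* The library norm on [R * R] is the max norm.  It only enters below through
   notions (Lipschitz, bounded, o(|x - p|)) that do not depend on the choice of
   the norm; lengths of unit vectors are Euclidean, via [dot]. *)
Definition dot x y : R := x.1 * y.1 + x.2 * y.2.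

Definition is_unit e : Prop := dot e e = 1.

Definition rot90 e : R * R := (- e.2, e.1).

Definition boundary Omega : set (R * R) := closure Omega `\` interior Omega.

(* Near each boundary point, in the orthonormal frame (rot90 e, e) centred at
   that point, Omega is the strict epigraph of a Lipschitz function [gam]; the
   boundary is then locally the graph of [gam]. *)
Definition lipschitz_boundary Omega : Prop :=
  forall p, boundary Omega p ->
  exists (e : R * R) (r h : R) (gam : R -> R),
    [/\ is_unit e, 0 < r, 0 < h, lipschitz gam &
      forall x, `|dot (x - p) (rot90 e)| < r -> `|dot (x - p) e| < h ->
        (Omega x <-> gam (dot (x - p) (rot90 e)) < dot (x - p) e)].

Definition bounded_lipschitz_domain Omega : Prop :=
  [/\ Omega !=set0, open Omega, connected Omega, bounded_set Omega &
      lipschitz_boundary Omega].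

(* [nu] is the outer unit normal at [p]: the boundary of Omega has at [p] a
   tangent line orthogonal to [nu], with Omega on the side of [- nu].  For a
   Lipschitz domain these are the points where the local graph function is
   differentiable, hence almost all boundary points. *)
Definition outer_normal Omega p nu : Prop :=
  [/\ boundary Omega p, is_unit nu &
    forall eps : R, 0 < eps -> \forall x \near p,
      (dot (x - p) nu < - (eps * `|x - p|) -> Omega x) /\
      (eps * `|x - p| < dot (x - p) nu -> ~ Omega x)].

Definition tangential Omega v : Prop :=
  forall p nu, outer_normal Omega p nu -> dot (v p) nu = 0.

(* A Lipschitz field on Omega extends uniquely to the closure; its boundary
   values are those of that extension. *)
Definition lipschitz_field Omega v : Prop :=
  [lipschitz v x | x in closure Omega].

Definition square_integrable Omega f : Prop :=
  measurable_fun Omega f /\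
  leb2.-integrable Omega (fun x => (f x ^+ 2)%:E).

Definition grad phi x : R * R :=
  ('D_((1, 0) : R * R) phi x, 'D_((0, 1) : R * R) phi x).

(* Test functions for weak derivatives: C^1 with compact support in Omega. *)
Definition test_function Omega phi : Prop :=
  [/\ forall x, differentiable phi x, continuous (grad phi) &
      exists K : set (R * R),
        [/\ compact K, K `<=` Omega & forall x, ~ K x -> phi x = 0]].

Definition weak_grad Omega w g : Prop :=
  [/\ square_integrable Omega (fun x => (g x).1),
      square_integrable Omega (fun x => (g x).2) &
    forall phi, test_function Omega phi ->
      (\int[leb2]_(x in Omega) (w x * (grad phi x).1)) =
        - (\int[leb2]_(x in Omega) ((g x).1 * phi x)) /\
      (\int[leb2]_(x in Omega) (w x * (grad phi x).2)) =
        - (\int[leb2]_(x in Omega) ((g x).2 * phi x))].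

Definition weak_div Omega F d : Prop :=
  square_integrable Omega d /\
  forall phi, test_function Omega phi ->
    (\int[leb2]_(x in Omega) dot (F x) (grad phi x)) =
      - (\int[leb2]_(x in Omega) (d x * phi x)).

Definition H1 Omega w : Prop :=
  square_integrable Omega w /\ exists g, weak_grad Omega w g.

(* [c] represents 1/2 div (v w) + 1/2 v . grad w; such a [c] is unique up to
   almost everywhere equality in Omega. *)
Definition convection Omega v w c : Prop :=
  exists d g,
    [/\ weak_div Omega (fun x => w x *: v x) d, weak_grad Omega w g &
        forall x, Omega x -> c x = 2^-1 * d x + 2^-1 * dot (v x) (g x)].

End Plane.

Section Scheme.
Variables (R : realType) (Omega : set (R * R)) (V : vectType R).
(* [rep w] is a representative function of the element [w] of the finite
   element space. *)
Variable rep : V -> R * R -> R.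
Implicit Types (v : R * R -> R * R) (A Q E : 'End(V)) (tau : R).

(* V is, through [rep], a finite-dimensional subspace of H^1(Omega). *)
Definition H1_subspace : Prop :=
  [/\ linear rep, forall w, H1 Omega (rep w) &
      forall w, {ae leb2, forall x, Omega x -> rep w x = 0} -> w = 0].

Definition ip (w u : V) : R := \int[leb2]_(x in Omega) (rep w x * rep u x).

Definition nrm (w : V) : R := Num.sqrt (ip w w).

Definition opnorm Q : R := sup [set nrm (Q w) | w in [set w | nrm w <= 1]].

Definition discrete_operators v A Q : Prop :=
  exists cA : V -> R * R -> R,
    (forall w, convection Omega v (rep w) (cA w)) /\
    forall w u,
      ip (A w) u = (\int[leb2]_(x in Omega) (cA w x * rep u x)) /\
      ip (Q w) u = (\int[leb2]_(x in Omega) (cA w x * cA u x)).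

Definition Eop tau Q : 'End(V) := \1%VF - (12^-1 * tau ^+ 2) *: Q.

Definition positive_selfadjoint E : Prop :=
  (forall w u, ip (E w) u = ip w (E u)) /\ (forall w, w != 0 -> 0 < ip (E w) w).

Definition nrmE E (u : V) : R := Num.sqrt (ip (E u) u).

Definition LW_step tau A Q (y z : V) : Prop :=
  Eop tau Q (tau^-1 *: (z - y)) + A (2^-1 *: (z + y)) = 0.

Definition LW_solution tau A Q (N : nat) (u0 : V) (y : nat -> V) : Prop :=
  y 0%N = u0 /\ forall n, (n < N)%N -> LW_step tau A Q (y n) (y n.+1).

Definition uniquely_solvable tau A Q : Prop :=
  forall y, exists! z, LW_step tau A Q y z.

(* [A'] and [Q'] are the discrete operators of the reversed velocity. *)
Definition time_reversible v tau A Q : Prop :=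
  forall A' Q', discrete_operators (fun x => - v x) A' Q' ->
  forall y z, LW_step tau A Q y z ->
    LW_step tau A' Q' z y /\ (forall z', LW_step tau A' Q' z z' -> z' = y).

Definition stable tau A Q : Prop :=
  positive_selfadjoint (Eop tau Q) /\
  forall (N : nat) (u0 : V) (y : nat -> V), LW_solution tau A Q N u0 y ->
  forall n, (n < N)%N ->
    nrmE (Eop tau Q) (y n.+1) <= nrmE (Eop tau Q) (y n).

End Scheme.

(* Main.v *)
(* Everything rests on the skew-symmetry of A. Given it, testing the scheme with
   y^{n+1} + y^n yields the conservation of the E-norm, and E / tau + A / 2 is
   injective, hence bijective, since E > 0: indeed (Q w, w) <= |Q| |w|^2 by
   Cauchy-Schwarz, and tau^2 |Q| < 12. Weak derivatives being unique almost
   everywhere, replacing v by - v turns A into - A and keeps Q, so that the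
   reversed scheme is the same equation with y^n and y^{n+1} exchanged.

   Skew-symmetry is Green's formula int (div (w v) u + w v . grad u) = 0, for
   functions which have only weak derivatives, without any trace theory.

   Inside Omega: pairing the weak derivatives of both factors with a kernel
   k((x - y) / e), in x for one factor and in y for the other, and letting e
   vanish gives, with m = div (w v) u + w v . grad u and rho = w u,
   int (m psi + rho v . grad psi) = 0 for all test functions psi. The limit exists
   because the mean square oscillation of a square integrable function at scale e
   vanishes with e.

   Up to the boundary: near a boundary point let psi = theta chi_k, where chi_k is
   0 near the boundary and 1 at distance of order 1 / k from it, built from an
   average at scale 1 / k of the function whose graph is the boundary. Although
   grad chi_k is of order k, v . grad chi_k stays bounded because v is Lipschitz
   and tangential at almost every boundary point. By dominated convergence,
   int (m theta + rho v . grad theta) = 0, and a finite cover of the closure of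
   Omega leads to theta = 1. *)
Require Import Defs.
From HB Require Import structures.
From mathcomp Require Import all_boot all_order all_algebra.
From mathcomp Require Import all_classical all_reals all_analysis.
From mathcomp Require Import measurable_realfun.
From mathcomp Require Import ring lra.

Set Implicit Arguments.
Unset Strict Implicit.
Unset Printing Implicit Defensive.

Import Order.TTheory GRing.Theory Num.Theory.
Import numFieldNormedType.Exports.

Local Open Scope classical_set_scope.
Local Open Scope ring_scope.

(** * C^1 functions on the plane *)

(** No smooth approximations of the factors are constructed. The derivatives of the kernel in x and
    in y are opposite, so once the two weak identities are paired through it the terms of order 1 /
    e cancel exactly, before any limit; only products of square integrable functions remain, and
    vanishing oscillation suffices for these. The same pairing, applied to f and f psi, yields the
    almost everywhere uniqueness of weak derivatives.

    At the boundary, normals exist only almost everywhere, whereas a test function must be C^1. The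
    average of the graph function over an interval of length [del] is C^1, and its derivative is a
    difference quotient, that is, the mean over this interval of the almost everywhere derivative.
    The tangency of v, known at almost every point of the piece of graph over that interval, can be
    averaged in the same way. This is why a Lipschitz function has to be the integral of its
    derivative. With [del] of order 1 / k these points lie at distance of order 1 / k from x, which
    balances the factor k of the gradient.

    As test functions are merely C^1, every kernel, cutoff and bump is built from the square of the
    positive part. *)

Section SquaredPositivePart.
Variable R : realType.
Implicit Types s t : R.

Definition sqpos s : R := (Num.max 0 s) ^+ 2.

Lemma sqpos_le0 s : s <= 0 -> sqpos s = 0.
Proof. by move=> s0; rewrite /sqpos max_l // expr0n. Qed.

Lemma sqpos_ge0 s : 0 <= s -> sqpos s = s ^+ 2.
Proof. by move=> s0; rewrite /sqpos max_r. Qed.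

Lemma sqpos_nneg s : 0 <= sqpos s. Proof. exact: sqr_ge0. Qed.

(** Covers the breakpoints of a piecewise quadratic function: the remainder is bounded by h^2 on
    either side, so no one-sided derivatives have to be glued. *)
Lemma is_derive_of_quadratic (f : R -> R) x d :
  (forall h, `|f (h + x) - f x - d * h| <= h ^+ 2) -> is_derive x 1 f d.
Proof.
move=> H.
have lim : (fun h => h^-1 *: (f (h *: (1 : R) + x) - f x)) @ 0^' --> (d : R^o).
  apply/cvgrPdist_le => e e0.
  near=> h.
  have h0 : h != 0 by near: h; exact: nbhs_dnbhs_neq.
  have -> : d - h^-1 *: (f (h *: (1 : R) + x) - f x) =
      - (h^-1 * (f (h + x) - f x - d * h)).
    rewrite /GRing.scale /= mulr1; field; exact: h0.
  rewrite normrN normrM normfV ler_pdivrMl ?normr_gt0 //.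
  apply: (le_trans (H h)).
  rewrite -real_normK ?num_real // expr2 ler_wpM2l //.
  near: h; apply: nbhs_dnbhs.
  exists e => //= y /=; rewrite sub0r normrN => /ltW //.
by split; [apply/cvg_ex; exists d|apply: cvg_lim].
Unshelve. all: by end_near. Qed.

Lemma is_derive_sqpos s : is_derive s 1 sqpos (2 * Num.max 0 s).
Proof.
apply: is_derive_of_quadratic => h; rewrite /sqpos.
case: (leP 0 (h + s)) => hs; case: (leP 0 s) => s0; rewrite ler_norml;
  apply/andP; split; nra.
Qed.

Lemma continuous_maxr0 : continuous (fun s : R => 2 * Num.max 0 s).
Proof.
move=> s; apply: cvgM; first exact: cvg_cst.
by apply: continuous_max; [exact: cvg_cst|exact: cvg_id].
Qed.

(* A C^1 step: equal to 2 s^2 on [0, 1/2] and to 1 - 2 (1 - s)^2 on [1/2, 1]. *)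
Definition step s : R := 2 * sqpos s - 4 * sqpos (s - 2^-1) + 2 * sqpos (s - 1).

Definition dstep s : R :=
  2 * (2 * Num.max 0 s) - 4 * (2 * Num.max 0 (s - 2^-1)) +
  2 * (2 * Num.max 0 (s - 1)).

Lemma step_le0 s : s <= 0 -> step s = 0.
Proof. by move=> s0; rewrite /step !sqpos_le0; lra. Qed.

Lemma step_ge1 s : 1 <= s -> step s = 1.
Proof. by move=> s0; rewrite /step !sqpos_ge0; lra. Qed.

Lemma step_itv s : 0 <= step s <= 1.
Proof.
rewrite /step /sqpos.
by case: (leP 0 s) => ?; case: (leP 0 (s - 2^-1)) => ?; case: (leP 0 (s - 1)) => ?;
  apply/andP; split; nra.
Qed.

Lemma dstep_le0 s : s <= 0 -> dstep s = 0.
Proof. by move=> s0; rewrite /dstep !max_l; lra. Qed.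

Lemma dstep_ge1 s : 1 <= s -> dstep s = 0.
Proof. by move=> s0; rewrite /dstep !max_r; lra. Qed.

Lemma dstep_itv s : 0 <= dstep s <= 2.
Proof.
rewrite /dstep.
by case: (leP 0 s) => ?; case: (leP 0 (s - 2^-1)) => ?; case: (leP 0 (s - 1)) => ?;
  apply/andP; split; lra.
Qed.

Lemma is_derive_sqpos_affine (a b : R) s :
  is_derive s 1 (fun t => sqpos (a * t + b)) (a * (2 * Num.max 0 (a * s + b))).
Proof.
have D1 : is_derive s 1 (fun t : R => a * t + b) a.
  have -> : (fun t : R => a * t + b) = a \*: (@id R) + cst b by [].
  by apply: is_derive_eq; rewrite addr0 /GRing.scale /= mulr1.
have := @is_derive1_comp _ sqpos (fun t : R => a * t + b) s _ _
   (is_derive_sqpos (a * s + b)) D1.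
by rewrite mulrC.
Qed.

Lemma is_derive_step s : is_derive s 1 step (dstep s).
Proof.
have sqposB c : is_derive s 1 (fun t => sqpos (t - c)) (2 * Num.max 0 (s - c)).
  have := is_derive_sqpos_affine 1 (- c) s.
  by under eq_fun do rewrite mul1r; rewrite !mul1r.
have -> : step = 2 \*: sqpos - 4 \*: (fun t => sqpos (t - 2^-1)) +
  2 \*: (fun t => sqpos (t - 1)) by [].
have := is_derive_sqpos s.
move=> sqposE.
exact: (is_deriveD (is_deriveB (is_deriveZ 2 sqposE) (is_deriveZ 4 (sqposB 2^-1)))
  (is_deriveZ 2 (sqposB 1))).
Qed.

Lemma continuous_dstep : continuous dstep.
Proof.
have H (c : R) : continuous (fun s : R => 2 * Num.max 0 (s - c)).
  move=> s; apply: (@continuous_comp _ _ _ (fun s => s - c) (fun s : R => 2 * Num.max 0 s)).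
    by apply: cvgB; [exact: cvg_id|exact: cvg_cst].
  exact: continuous_maxr0.
move=> s; rewrite /dstep; apply: cvgD; first apply: cvgB.
- by apply: cvgM; [exact: cvg_cst|exact: continuous_maxr0].
- by apply: cvgM; [exact: cvg_cst|exact: H].
- by apply: cvgM; [exact: cvg_cst|exact: H].
Qed.

End SquaredPositivePart.

(** * Gradients and their calculus *)

Section Gradients.
Variable R : realType.
Implicit Types (f phi : R * R -> R) (g : R * R -> R * R) (x e p : R * R).

Lemma dotDr x e p : dot x (e + p) = dot x e + dot x p.
Proof. by rewrite /dot mulrDr mulrDr addrACA. Qed.

Lemma dotNr x e : dot x (- e) = - dot x e.
Proof. by rewrite /dot mulrN mulrN opprD. Qed.

Lemma dotZr (a : R) x e : dot x (a *: e) = a * dot x e.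
Proof. by rewrite /dot mulrDr !mulrA ![a * _]mulrC -!mulrA. Qed.

Lemma dotC x e : dot x e = dot e x.
Proof. by rewrite /dot mulrC [x.2 * _]mulrC. Qed.

Lemma dotDl x e p : dot (e + p) x = dot e x + dot p x.
Proof. by rewrite dotC dotDr !(dotC x). Qed.

Lemma dotNl x e : dot (- e) x = - dot e x.
Proof. by rewrite dotC dotNr dotC. Qed.

Lemma dotZl (a : R) x e : dot (a *: e) x = a * dot e x.
Proof. by rewrite dotC dotZr dotC. Qed.

(** [grad] consists of directional derivatives, which obey no chain rule by themselves. The rules
    are proved for differentials represented by a vector and read back through [is_gradE]. *)
Definition is_grad f g := forall x, is_diff x f (fun h => dot h (g x)).

Definition C1 f := (forall x, differentiable f x) /\ continuous (grad f).

Lemma is_grad_differentiable f g : is_grad f g -> forall x, differentiable f x.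
Proof. by move=> fg x; have [] := fg x. Qed.

Lemma is_gradE f g : is_grad f g -> grad f = g.
Proof.
move=> fg; apply/funext => x; have dfg := fg x.
rewrite /grad !deriveE ?diff_val; [|exact: is_grad_differentiable fg _..].
by rewrite /dot /= !mul1r !mul0r addr0 add0r -surjective_pairing.
Qed.

Lemma differentiable_is_grad f : (forall x, differentiable f x) ->
  is_grad f (grad f).
Proof.
move=> df x; have := df x => /differentiableP dfx; apply: is_diff_eq.
apply/funext => -[h1 h2].
rewrite /grad !deriveE // /dot /=.
have -> : (h1, h2) = h1 *: ((1, 0) : R * R) + h2 *: ((0, 1) : R * R).
  transitivity (h1 * 1 + h2 * 0, h1 * 0 + h2 * 1); last by [].
  by rewrite !mulr1 !mulr0 addr0 add0r.
by rewrite linearD !linearZ.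
Qed.

Lemma C1_grad f g : is_grad f g -> continuous g -> C1 f.
Proof.
move=> fg cg; split; first exact: is_grad_differentiable fg.
by rewrite (is_gradE fg).
Qed.

Lemma is_grad_cst (a : R) : is_grad (cst a) (cst 0).
Proof.
move=> x; apply: is_diff_eq; apply/funext => h.
by rewrite /dot !mulr0 addr0.
Qed.

Lemma is_gradD f f' g g' : is_grad f g -> is_grad f' g' ->
  is_grad (f \+ f') (g \+ g').
Proof.
move=> fg fg' x; have d1 := fg x; have d2 := fg' x.
apply: (is_diff_eq (is_diffD d1 d2)); apply/funext => h.
by rewrite !fctE dotDr.
Qed.

Lemma is_gradN f g : is_grad f g -> is_grad (\- f) (\- g).
Proof.
move=> fg x; have d1 := fg x.
apply: (is_diff_eq (is_diffN d1)); apply/funext => h.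
by rewrite !fctE dotNr.
Qed.

Lemma is_gradM f f' g g' : is_grad f g -> is_grad f' g' ->
  is_grad (f \* f') (fun x => f x *: g' x + f' x *: g x).
Proof.
move=> fg fg' x; have d1 := fg x; have d2 := fg' x.
apply: (is_diff_eq (is_diffM d1 d2)); apply/funext => h.
by rewrite !fctE dotDr !dotZr.
Qed.

Lemma is_grad_comp (h dh : R -> R) f g : (forall s : R, is_derive s 1 h (dh s)) ->
  is_grad f g -> is_grad (h \o f) (fun x => dh (f x) *: g x).
Proof.
move=> hdh fg x; have d1 := fg x.
have d2 : is_diff (f x) h (fun t => t *: dh (f x)).
  have [dx dE] := hdh (f x).
  apply: DiffDef; first exact/derivable1_diffP.
  by rewrite deriv1E // derive1E dE.
apply: (is_diff_eq (is_diff_comp d1 d2)); apply/funext => k.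
by rewrite !fctE dotZr /GRing.scale /= mulrC.
Qed.

Lemma is_grad_dot e p : is_grad (fun x => dot (x - p) e) (cst e).
Proof.
move=> x.
have lin_dot : linear (fun h => dot h e) by move=> a u v; rewrite dotDl dotZl.
pose dote : {linear (R * R)%type -> R} :=
  HB.pack (fun h => dot h e) (GRing.isLinear.Build _ _ _ _ _ lin_dot).
have cdot : continuous dote.
  move=> y; apply: cvgD; apply: cvgM; first [exact: cvg_cst | exact: cvg_fst | exact: cvg_snd].
have d1 : is_diff x dote (fun h => dot h e).
  by apply: DiffDef; [exact: linear_differentiable|rewrite diff_lin].
have -> : (fun x => dot (x - p) e) = (dote : R * R -> R) - cst (dot p e).
  by apply/funext => y; rewrite dotDl dotNl.
apply: (is_diff_eq (is_diffB d1 (is_diff_cst _ _))); apply/funext => h.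
by rewrite !fctE subr0.
Qed.

Lemma C1_continuous f : C1 f -> continuous f.
Proof. by move=> [df _] x; exact/differentiable_continuous. Qed.

Lemma C1_cst (a : R) : C1 (cst a).
Proof. by apply: (C1_grad (is_grad_cst a)); exact: cst_continuous. Qed.

Lemma C1D f f' : C1 f -> C1 f' -> C1 (f \+ f').
Proof.
move=> [df cf] [df' cf']; apply: C1_grad.
  by apply: is_gradD; exact: differentiable_is_grad.
by move=> x; apply: cvgD; [exact: cf|exact: cf'].
Qed.

Lemma C1N f : C1 f -> C1 (\- f).
Proof.
move=> [df cf]; apply: C1_grad.
  by apply: is_gradN; exact: differentiable_is_grad.
by move=> x; apply: cvgN; exact: cf.
Qed.

Lemma C1M f f' : C1 f -> C1 f' -> C1 (f \* f').
Proof.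
move=> Cf Cf'; have [df cf] := Cf; have [df' cf'] := Cf'; apply: C1_grad.
  by apply: is_gradM; exact: differentiable_is_grad.
move=> x; apply: cvgD.
  by apply: cvgZ; [exact: C1_continuous|exact: cf'].
by apply: cvgZ; [exact: C1_continuous|exact: cf].
Qed.

Lemma gradM f f' : C1 f -> C1 f' ->
  grad (f \* f') = (fun x => f x *: grad f' x + f' x *: grad f x).
Proof.
by move=> [df _] [df' _]; apply/is_gradE/is_gradM; exact: differentiable_is_grad.
Qed.

Lemma C1_comp (h dh : R -> R) f : (forall s : R, is_derive s 1 h (dh s)) ->
  continuous dh -> C1 f -> C1 (h \o f).
Proof.
move=> hdh cdh Cf; have [df cf] := Cf; apply: C1_grad.
  by apply: is_grad_comp hdh _; exact: differentiable_is_grad.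
move=> x; apply: cvgZ; last exact: cf.
exact: (continuous_comp (C1_continuous Cf (x := x)) (cdh _)).
Qed.

Lemma C1_dot e p : C1 (fun x => dot (x - p) e).
Proof. by apply: (C1_grad (is_grad_dot e p)); exact: cst_continuous. Qed.

End Gradients.

(** * Lebesgue measure on the plane *)

Section PlaneMeasurability.
Variable R : realType.
Local Notation T := (measurableTypeR R * measurableTypeR R)%type.

(** Rational boxes are countable, which serves both for measurability and for null sets. The doubled
    radius leaves room for a test function that is positive on the inner ball. *)
Lemma rat_box (O : set (R * R)) x : open O -> O x ->
  exists q : rat * rat * rat, let c : R * R := (ratr q.1.1, ratr q.1.2) in
    [/\ 0 < ratr q.2 :> R, ball c (ratr q.2 + ratr q.2 : R) `<=` O & ball c (ratr q.2 : R) x].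
Proof.
move=> oO Ox; have /nbhs_ballP[e /= e0 xeO] := open_nbhs_nbhs (conj oO Ox).
(* The centre is within [r] of [x] and the doubled ball reaches [2 r] further, hence the third of
   [e]. *)
have [r /itvP rE] := @rat_in_itvoo R 0 (e / 3) (divr_gt0 e0 (ltr0n _ 3)).
have r0 : 0 < ratr r :> R by rewrite rE.
have [q1 /itvP q1E] := @rat_in_itvoo R (x.1 - ratr r) (x.1 + ratr r) ltac:(lra).
have [q2 /itvP q2E] := @rat_in_itvoo R (x.2 - ratr r) (x.2 + ratr r) ltac:(lra).
have xq : ball ((ratr q1 : R), (ratr q2 : R)) (ratr r : R) x.
  by split; rewrite /= /ball /= ltr_distlC;
    apply/andP; split; rewrite ?ltrBlDr ?q1E ?q2E// -ltrBlDr ?q1E ?q2E.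
exists (q1, q2, r); split => //= y qy; apply: xeO.
have re : ratr r + (ratr r + ratr r) <= e :> R.
  have : ratr r < e / 3 :> R by rewrite rE.
  by lra.
apply: le_ball re _ _; apply: ball_triangle qy; exact: ball_sym.
Qed.

Lemma open_bigcup_rat_box (O : set (R * R)) : open O ->
  O = \bigcup_(q in [set q : rat * rat * rat |
    ball ((ratr q.1.1, ratr q.1.2) : R * R) (ratr q.2 : R) `<=` O])
    ball ((ratr q.1.1, ratr q.1.2) : R * R) (ratr q.2 : R).
Proof.
move=> oO; apply/seteqP; split => [x Ox|x [q qO]]; last exact: qO.
have [q [q0 qO qx]] := rat_box oO Ox; exists q => // y yq.
by apply: qO; apply: le_ball yq; rewrite lerDl ltW.
Qed.

Lemma ball_prodE (c : R * R) (r : R) : ball c r = ball c.1 r `*` ball c.2 r.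
Proof. by []. Qed.

Lemma open_measurable_plane (O : set (R * R)) :
  open O -> measurable (O : set T).
Proof.
move=> oO; rewrite (open_bigcup_rat_box oO) bigcup_mkcond.
apply: countable_bigcupT_measurable => // q.
case: ifPn => // _; rewrite ball_prodE.
by apply: measurableX; exact: measurable_ball.
Qed.

Local Notation TO := (g_sigma_algebraType (open : set (set (R * R)))).

(** The product sigma-algebra is the Borel one. Open sets are stable under intersection, so Dynkin
    induction can start from them. *)
Lemma plane_measurableE :
  @measurable _ T = <<s (open : set (set (R * R))) >>.
Proof.
apply/seteqP; split; last first.
  apply: smallest_sub; first exact: sigma_algebra_measurable.
  exact: open_measurable_plane.
rewrite measurable_prod_measurableType; apply: smallest_sub.
  exact: smallest_sigma_algebra.
have mproj (p : R * R -> R) : continuous p ->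
    measurable_fun [set: TO] (p : TO -> measurableTypeR R).
  move=> cp; apply: (measurability _ (RGenOInfty.measurableE R)) => _ [_ [x ->] <-].
  rewrite setTI; apply: sub_sigma_algebra.
  by apply: open_comp; [move=> ? _; exact: cp|exact: interval_open].
have mfst := mproj fst (fun=> cvg_fst); have msnd := mproj snd (fun=> cvg_snd).
move=> _ [A mA [B mB <-]].
have -> : A `*` B = (fst @^-1` A) `&` (snd @^-1` B) :> set TO by [].
rewrite -(setTI (fst @^-1` A)) -(setTI (snd @^-1` B)).
by apply: (@measurableI _ TO); [exact: mfst|exact: msnd].
Qed.

Lemma continuous_measurable_plane (f : R * R -> R) :
  continuous f -> measurable_fun [set: T] (f : T -> R).
Proof.
move=> cf; apply: (measurability _ (RGenOInfty.measurableE R)) => _ [_ [x ->] <-].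
rewrite setTI; apply: open_measurable_plane.
by apply: open_comp; [move=> ? _; exact: cf|exact: interval_open].
Qed.

Lemma continuous_in_measurable_plane (O : set (R * R)) (f : R * R -> R) :
  open O -> {in O, continuous f} -> measurable_fun (O : set T) (f : T -> R).
Proof.
move=> oO cf; apply: (measurability _ (RGenOInfty.measurableE R)) => _ [_ [x ->] <-].
apply: open_measurable_plane; apply/interior_id/seteqP; split.
  exact: interior_subset.
move=> y [Oy /= fy]; apply: filterI; first exact: open_nbhs_nbhs.
move: fy; rewrite /= in_itv/= andbT => fy.
have oI : open (`]x, +oo[%classic : set R) by exact: interval_open.
have fyI : `]x, +oo[%classic (f y) by rewrite /= in_itv/= andbT.
exact: cf y (mem_set Oy) _ (open_nbhs_nbhs (conj oI fyI)).
Qed.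

End PlaneMeasurability.

Section PlaneMeasure.
Variable R : realType.
Local Notation T := (measurableTypeR R * measurableTypeR R)%type.

(* The library registers a product of measures as sigma-finite only when the
   factors are subprobabilities, hence this copy of [leb2]. *)
Definition lebesgue2 : set T -> \bar R :=
  (@lebesgue_measure R \x @lebesgue_measure R)%E.

HB.instance Definition _ := Measure.on lebesgue2.

Lemma sigma_finite_lebesgue2 : sigma_finite setT lebesgue2.
Proof.
have /sigma_finiteP[F [TF ndF Foo]] := sigma_finiteT (@lebesgue_measure R).
exists (fun n => F n `*` F n).
  rewrite -setXTT TF; apply/seteqP; split => [[x y] /= [[n _ Fx] [k _ Fy]]|].
    exists (maxn n k) => //; split => /=.
    - by move: x Fx; exact/subsetPset/ndF/leq_maxl.
    - by move: y Fy; exact/subsetPset/ndF/leq_maxr.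
  by move=> [x y] [n _ [/= Fx Fy]]; split; exists n.
move=> n; have [mF Fn] := Foo n; split; first exact: measurableX.
by rewrite /lebesgue2 product_measure1E// lte_mul_pinfty// ge0_fin_numE.
Qed.

HB.instance Definition _ :=
  Measure_isSigmaFinite.Build _ _ _ lebesgue2 sigma_finite_lebesgue2.

End PlaneMeasure.

Lemma is_derive1_ext (R : realType) (f g : R -> R) (x d d' : R) :
  is_derive x 1 f d -> f =1 g -> d = d' -> is_derive x 1 g d'.
Proof. by move=> fd /funext <- <-. Qed.

(** * A C^1 kernel with compact support *)

Section Kernel.
Variable R : realType.
Local Notation T := (measurableTypeR R * measurableTypeR R)%type.
Local Notation mu1 := (@lebesgue_measure R).
Implicit Types (e s t : R).

(** The biweight kernel: C^1, supported in [[- e, e]], with a polynomial primitive on its support.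
    It is left unnormalised, so that its values stay in [0, 1]; its integral appears as an explicit
    factor instead. *)
Definition kap e t : R := sqpos (1 - (t / e) ^+ 2).

Lemma kap_ge0 e t : 0 <= kap e t. Proof. exact: sqpos_nneg. Qed.

Lemma kap_le1 e t : kap e t <= 1.
Proof.
rewrite /kap /sqpos; set u := (t / e) ^+ 2; have u0 : 0 <= u by exact: sqr_ge0.
by case: (leP 0 (1 - u)) => ?; nra.
Qed.

Lemma kapN e t : kap e (- t) = kap e t.
Proof. by rewrite /kap mulNr sqrrN. Qed.

Lemma kap_eq0 e t : 0 < e -> e <= `|t| -> kap e t = 0.
Proof.
move=> e0 et; apply: sqpos_le0; rewrite subr_le0 -(real_normK (num_real (t / e))).
rewrite expr_ge1 // normrM normfV (gtr0_norm e0).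
by rewrite ler_pdivlMr // mul1r.
Qed.

Definition dkap e t : R := - 2 * t / e ^+ 2 * (2 * Num.max 0 (1 - (t / e) ^+ 2)).

Lemma is_derive_kap e t : is_derive t 1 (kap e) (dkap e t).
Proof.
have D1 : is_derive t 1 (fun t : R => 1 - (t / e) ^+ 2) (- 2 * t / e ^+ 2).
  apply: (is_derive1_ext (is_deriveB (is_derive_cst (1 : R) t (1 : R))
    (is_deriveX 2 (is_deriveZ e^-1 (is_derive_id t (1 : R)))))).
    by move=> u; rewrite [u / e]mulrC.
  change (0 - 2 * (e^-1 * t) ^+ 1 * (e^-1 * 1) = - 2 * t / e ^+ 2).
  by rewrite -exprVn; ring.
have D2 := @is_derive1_comp _ _ (fun t => 1 - (t / e) ^+ 2) _ _ _
  (is_derive_sqpos (1 - (t / e) ^+ 2)) D1.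
by apply: (is_derive1_ext D2) => //; rewrite mulrC.
Qed.

Lemma continuous_kap e : continuous (kap e).
Proof.
by move=> t; apply/differentiable_continuous/derivable1_diffP; have [] := is_derive_kap e t.
Qed.

Lemma continuous_dkap e : continuous (dkap e).
Proof.
move=> t; apply: cvgM.
  by apply: cvgM; [apply: cvgM; [exact: cvg_cst|exact: cvg_id]|exact: cvg_cst].
apply: (@continuous_comp _ _ _ (fun s => 1 - (s / e) ^+ 2) (fun s : R => 2 * Num.max 0 s)).
  apply: cvgB; first exact: cvg_cst.
  by rewrite expr2; apply: cvgM; apply: cvgM; (exact: cvg_id || exact: cvg_cst).
exact: continuous_maxr0.
Qed.

Lemma dkap_eq0 e t : 0 < e -> e <= `|t| -> dkap e t = 0.
Proof.
move=> e0 et; rewrite /dkap max_l ?mulr0//.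
rewrite subr_le0 -(real_normK (num_real (t / e))).
by rewrite expr_ge1 // normrM normfV (gtr0_norm e0) ler_pdivlMr // mul1r.
Qed.

Lemma dkapN e t : dkap e (- t) = - dkap e t.
Proof.
rewrite /dkap (_ : (- t / e) ^+ 2 = (t / e) ^+ 2); first ring.
by rewrite mulNr sqrrN.
Qed.

Lemma dkap_bound e : 0 < e -> exists C, forall t, `|dkap e t| <= C.
Proof.
(* On the support |2 t / e^2| is at most 2 / e, and the remaining factor at most 2. *)
move=> e0; exists (4 / e) => t.
have [et|te] := leP e `|t|; first by rewrite dkap_eq0// normr0 divr_ge0// ltW.
rewrite /dkap !normrM normrN normfV (gtr0_norm (x := 2))// (gtr0_norm (x := e ^+ 2)) ?exprn_gt0//.
have -> : 4 / e = 2 * e / e ^+ 2 * (2 * 1) by field; rewrite gt_eqF.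
apply: ler_pM => //.
- by apply: divr_ge0; [exact: mulr_ge0|exact: sqr_ge0].
- by rewrite ler_pM2r ?invr_gt0 ?exprn_gt0// ler_pM2l// ltW.
- rewrite ler_pM2l// ger0_norm ?le_max ?lexx// ge_max ler01/= gerBl.
  exact: sqr_ge0.
Qed.

Lemma integral_kap e s : 0 < e ->
  (\int[mu1]_t (kap e (s - t))%:E = (16 / 15 * e)%:E)%E.
Proof.
move=> e0.
have -> : (\int[mu1]_t (kap e (s - t))%:E =
    \int[mu1]_(t in `[(s - e)%R, (s + e)%R]) (kap e (s - t))%:E)%E.
  rewrite [RHS]integral_mkcond; apply: eq_integral => t _.
  rewrite patchE; case: ifPn => //; rewrite notin_setE/= in_itv/= => /negP tI.
  rewrite kap_eq0 // leNgt; apply: contra tI; rewrite ltr_norml => /andP[? ?].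
  by apply/andP; split; lra.
(* The primitive of (1 - u^2)^2; its increment from -1 to 1 is 16 / 15. *)
pose p (u : R) := u - 2 / 3 * u ^+ 3 + 5^-1 * u ^+ 5.
pose q (t : R) := e * p ((t - s) / e).
have dp (u : R) : is_derive u 1 p (1 - 2 * u ^+ 2 + u ^+ 4).
  have di := is_derive_id u (1 : R).
  apply: (is_derive1_ext (is_deriveD (is_deriveB di (is_deriveZ (2 / 3) (is_deriveX 3 di)))
    (is_deriveZ 5^-1 (is_deriveX 5 di)))) => //.
  change (1 - 2 / 3 * (3 * u ^+ 2 * 1) + 5^-1 * (5 * u ^+ 4 * 1) =
    1 - 2 * u ^+ 2 + u ^+ 4).
  by field.
have dq (t : R) : is_derive t 1 q ((1 - ((t - s) / e) ^+ 2) ^+ 2).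
  have D1 : is_derive t 1 (fun t : R => (t - s) / e) e^-1.
    apply: (is_derive1_ext (is_deriveZ e^-1 (is_deriveB (is_derive_id t (1 : R)) (is_derive_cst s t (1 : R))))).
      by move=> u; rewrite [RHS]mulrC.
    by rewrite subr0; exact: mulr1.
  have D2 := @is_derive1_comp _ _ (fun t => (t - s) / e) _ _ _ (dp _) D1.
  apply: (is_derive1_ext (is_deriveZ e D2)) => //.
  set u := (t - s) / e.
  change (e * ((1 - 2 * u ^+ 2 + u ^+ 4) * e^-1) = (1 - u ^+ 2) ^+ 2).
  rewrite [_ / e]mulrC mulVKf ?gt_eqF//; ring.
rewrite (@continuous_FTC2 R (fun t => kap e (s - t)) q).
- rewrite -EFinB /q /p; congr EFin; field; exact: lt0r_neq0.
- lra.
- apply: continuous_subspaceT => t.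
  apply: (@continuous_comp _ _ _ (fun t => s - t) (kap e)); last exact: continuous_kap.
  by apply: cvgB; [exact: cvg_cst|exact: cvg_id].
- have cq : continuous q.
    by move=> t; apply/differentiable_continuous/derivable1_diffP; have [] := dq t.
  split; first by move=> t _; have [] := dq t.
  + by apply: cvg_at_right_filter; exact: cq.
  + by apply: cvg_at_left_filter; exact: cq.
- move=> t /[!in_itv]/= /andP[t1 t2]; rewrite derive1E (@derive_val _ _ _ _ _ _ _ (dq t)).
  have tse : (t - s) / e = - ((s - t) / e) by rewrite -mulNr opprB.
  rewrite /kap tse sqrrN sqpos_ge0// subr_ge0 -(real_normK (num_real ((s - t) / e))).
  rewrite exprn_ile1// normrM normfV (gtr0_norm e0) ler_pdivrMr// mul1r.
  by rewrite ler_norml; apply/andP; split; lra.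
Qed.

End Kernel.

(** * Lipschitz functions of one variable *)

Lemma integrable_fin_cst d (T : measurableType d) (R : realType)
    (mu : {measure set T -> \bar R}) (D : set T) (c : R) :
  measurable D -> (mu D < +oo)%E -> mu.-integrable D (EFin \o cst c).
Proof.
by move=> mD muD; apply: measurable_bounded_integrable => //; exact: bounded_cst.
Qed.

Section LipschitzDerivative.
Variable R : realType.
Notation mu := (@lebesgue_measure R).
Implicit Types f G : R -> R.

Lemma Rintegral_cst_oo (c a b : R) : a < b ->
  \int[mu]_(x in `]a, b[) cst c x = c * (b - a).
Proof.
move=> ab; rewrite Rintegral_cst//; congr (_ * _).
by have := lebesgue_measure_itv `]a, b[; rewrite /= lte_fin ab -EFinB => ->.
Qed.

Section NondecreasingContraction.
Variable G : R -> R.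
Hypothesis G_contr : forall x y, x <= y -> 0 <= G y - G x <= y - x.

Let G_nd : {homo G : x y / x <= y}.
Proof. by move=> x y /G_contr/andP[]; rewrite subr_ge0. Qed.

Lemma contr_continuous : continuous G.
Proof.
move=> x; apply/cvgrPdist_le => e e0; near=> t.
have tx : `|x - t| <= e by near: t; exact: cvgr_dist_le.
apply: le_trans tx; have [xt|/ltW tx] := leP x t.
- rewrite distrC (distrC x) !ger0_norm ?subr_ge0//; last exact: G_nd.
  by have /andP[] := G_contr xt.
- rewrite !ger0_norm ?subr_ge0//; last exact: G_nd.
  by have /andP[] := G_contr tx.
Unshelve. all: by end_near. Qed.

Let G_rc : right_continuous G.
Proof. exact/right_continuousW/contr_continuous. Qed.

HB.instance Definition _ := isCumulative.Build R _ R G G_nd G_rc.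

Let H x := x - G x.

Let H_nd : {homo H : x y / x <= y}.
Proof. by move=> x y /G_contr/andP[_]; rewrite /H; lra. Qed.

Let H_rc : right_continuous H.
Proof.
apply/right_continuousW => x; apply: cvgB; first exact: cvg_id.
exact: contr_continuous.
Qed.

HB.instance Definition _ := isCumulative.Build R _ R H H_nd H_rc.

Let lsE (F : cumulative R R) a b : (a <= b)%R ->
  lebesgue_stieltjes_measure F `]a, b]%classic = (F b - F a)%:E.
Proof.
move=> ab; rewrite /lebesgue_stieltjes_measure/= /measure_extension/=.
rewrite measurable_mu_extE/=; last exact: is_ocitv.
by rewrite wlength_itv_bnd.
Qed.

(** The increments of [G] and [H] add up to the length on half-open intervals, and these determine
    the measure. *)
Let ls_add A : measurable A ->
  mu A = (lebesgue_stieltjes_measure G A + lebesgue_stieltjes_measure H A)%E.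
Proof.
move=> mA; rewrite -measure_addE.
apply: lebesgue_stieltjes_measure_unique => // X /ocitvP[->|[[a b] /= ab ->]].
  by rewrite !measure0.
apply: (eq_trans _ (esym (measure_addE _ _ _))).
rewrite (lsE idfun (ltW ab)); apply: esym.
apply: (eq_trans (congr2 _ (lsE G (ltW ab)) (lsE H (ltW ab)))).
rewrite -EFinD; congr EFin.
by change (G b - G a + (b - G b - (a - G a)) = b - a); ring.
Qed.

(* The Stieltjes measure of [G] is dominated by the Lebesgue measure, as its sum
   with that of [x - G x] is the Lebesgue measure; hence it has a density, and
   Lebesgue's differentiation theorem applies. *)
Lemma contr_integral (a b : R) : a < b ->
  exists g : R -> R, [/\ mu.-integrable setT (EFin \o g),
    G b - G a = \int[mu]_(x in `]a, b[) g x &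
    {ae mu, forall x, a < x < b -> is_derive x (1 : R) G (g x)}].
Proof.
move=> ab.
have mD : measurable (`]a, b]%classic : set (measurableTypeR R)) by [].
have fD : (lebesgue_stieltjes_measure G `]a, b]%classic < +oo)%E.
  by rewrite lsE ?ltW// ltry.
(* Restricted to []a, b]] the Stieltjes measure is finite, as the Radon-Nikodym theorem wants it. *)
pose nu := mfrestr mD fD.
have nuE x : a <= x <= b -> nu `]a, x]%classic = (G x - G a)%:E.
  move=> /andP[ax xb].
  rewrite /nu /mfrestr /mrestr/= setIidl ?lsE//.
  by apply: subset_itvl; rewrite bnd_simp.
have numu : nu `<< mu.
  apply/null_content_dominatesP => A mA A0.
  have muA0 : (lebesgue_stieltjes_measure G A + lebesgue_stieltjes_measure H A = 0)%E.
    by rewrite -ls_add.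
  apply/eqP; rewrite eq_le measure_ge0 andbT -muA0.
  apply: (@le_trans _ _ (lebesgue_stieltjes_measure G A)).
    by apply: le_measure; rewrite ?inE//; exact: measurableI.
  by rewrite leeDl.
have [h [h0 hfin ih hE]] := @radon_nikodym_sigma_finite _ _ _ mu nu numu.
pose g := fine \o h.
have hg : h = EFin \o g by apply/funext => x /=; rewrite fineK.
rewrite hg in ih hE.
have FE x : a <= x <= b -> \int[mu]_(t in `]a, x]) g t = G x - G a.
  move=> /nuE nuaxE.
  have := hE `]a, x]%classic (measurable_itv _).
  by move/(eq_trans (esym nuaxE)) => intE; rewrite /Rintegral -intE.
have igS D : measurable D -> mu.-integrable D (EFin \o g).
  by move=> mS; exact: integrableS ih.
exists g; split => //.
  by rewrite Rintegral_itv_bndo_bndc ?FE ?lexx ?ltW//; exact: igS.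
have := @FTC1 R g (BRight a) (fun y => igS _ (measurable_itv _))
  (open_integrable_locally openT ih).
apply: filterS; first exact: (ae_filter_ringOfSetsType mu).
move=> x Hx /andP[ax xb].
have [dF dE] := Hx ax.
have eqF : {near x, (fun y => \int[mu]_(t in `]a, y]) g t) =1 (G - cst (G a))}.
  near=> y; rewrite FE//; apply/andP; split; apply: ltW; near: y.
    exact: lt_nbhsr.
  exact: lt_nbhsl.
have dG : is_derive x 1 (G - cst (G a)) (g x).
  have D1 : is_derive x 1 (fun y => \int[mu]_(t in `]a, y]) g t) (g x).
    by split; [exact: dF|exact: (eq_trans (esym (derive1E _ _)) dE)].
  by apply: near_eq_is_derive D1 => //; exact: oner_neq0.
have -> : G = (G - cst (G a)) + cst (G a).
  by apply/funext => y; rewrite !fctE subrK.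
by apply: is_derive_eq; rewrite addr0.
Unshelve. all: by end_near. Qed.

End NondecreasingContraction.

(** Adding L x and dividing by 2 L turns [f] into a nondecreasing contraction; the density and the
    derivative are carried back through this affine change. *)
Lemma lipschitz_integral f (L a b : R) : 0 < L ->
  (forall x y, `|f x - f y| <= L * `|x - y|) -> a < b ->
  exists g : R -> R, [/\ mu.-integrable `]a, b[ (EFin \o g),
    f b - f a = \int[mu]_(x in `]a, b[) g x &
    {ae mu, forall x, a < x < b -> is_derive x (1 : R) f (g x)}].
Proof.
move=> L0 fL ab; pose G x := (2 * L)^-1 * (f x + L * x).
have L2 : 0 < 2 * L by rewrite mulr_gt0.
have G_contr x y : x <= y -> 0 <= G y - G x <= y - x.
  move=> xy; have := fL y x; rewrite ler_norml (ger0_norm (x := y - x)) ?subr_ge0//.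
  move=> /andP[H1 H2]; rewrite /G -mulrBr.
  apply/andP; split; first by rewrite ler_pM2l ?invr_gt0//; lra.
  by rewrite ler_pdivrMl//; lra.
have [h [ih hE dh]] := contr_integral G_contr ab.
have mab : measurable (`]a, b[%classic : set (measurableTypeR R)) by [].
have ihab : mu.-integrable `]a, b[ (EFin \o h) by exact: integrableS ih.
have fab : (mu `]a, b[ < +oo)%E by rewrite lebesgue_measure_itv/= lte_fin ab -EFinB ltry.
have icst c : mu.-integrable `]a, b[ (EFin \o cst c).
  exact: integrable_fin_cst.
exists (fun x => 2 * L * h x - L); split.
- exact: (@integrableB _ _ _ _ _ mab _ _ (integrableZl mab (2 * L) ihab) (icst L)).
- have -> : \int[mu]_(x in `]a, b[) (2 * L * h x - L) =
      2 * L * (G b - G a) - L * (b - a).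
    apply: (eq_trans (RintegralB mab (integrableZl mab (2 * L) ihab) (icst L))).
    congr (_ - _); last exact: Rintegral_cst_oo.
    by rewrite hE; apply: RintegralZl.
  by rewrite /G -mulrBr mulVKf ?gt_eqF//; ring.
- apply: filterS dh; first exact: (ae_filter_ringOfSetsType mu).
  move=> x /[apply] dG.
  have -> : f = (2 * L) \*: G - L \*: (@id R).
    apply/funext => y.
    change (f y = 2 * L * ((2 * L)^-1 * (f y + L * y)) - L * y).
    by rewrite mulVKf ?gt_eqF// addrK.
  have := is_deriveB (is_deriveZ (2 * L) dG) (is_deriveZ L (is_derive_id x (1 : R))).
  by rewrite /GRing.scale /= mulr1.
Qed.

(* A Lipschitz function is the integral of its almost everywhere derivative, so
   that bounds at the points of differentiability suffice. *)
Lemma lipschitz_increment_le f (L al be M a b : R) : 0 < L ->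
  (forall x y, `|f x - f y| <= L * `|x - y|) -> a < b ->
  (forall s d : R, a < s < b -> is_derive s (1 : R) f d -> `|al + be * d| <= M) ->
  0 <= M -> `|al * (b - a) + be * (f b - f a)| <= M * (b - a).
Proof.
move=> L0 fL ab fM M0; have [g [ig gE dg]] := lipschitz_integral L0 fL ab.
have mab : measurable (`]a, b[%classic : set (measurableTypeR R)) by [].
have fab : (mu `]a, b[ < +oo)%E by rewrite lebesgue_measure_itv/= lte_fin ab -EFinB ltry.
have icst c : mu.-integrable `]a, b[ (EFin \o cst c).
  exact: integrable_fin_cst.
have ibg : mu.-integrable `]a, b[ (EFin \o (fun x => be * g x)).
  exact: (integrableZl mab be ig).
have ialg : mu.-integrable `]a, b[ (EFin \o (fun x => al + be * g x)).
  exact: (@integrableD _ _ _ _ _ mab _ _ (icst al) ibg).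
have -> : al * (b - a) + be * (f b - f a) = \int[mu]_(x in `]a, b[) (al + be * g x).
  apply: esym; apply: (eq_trans (RintegralD mab (icst al) ibg)).
  congr (_ + _); first exact: Rintegral_cst_oo.
  by rewrite gE; apply: RintegralZl.
apply: le_trans (le_normr_Rintegral mab ialg) _.
rewrite -(Rintegral_cst_oo M ab) /Rintegral.
apply: fine_le.
- exact/integrable_fin_num/(@integrable_abse _ _ _ _ _ _ ialg).
- exact/integrable_fin_num/icst.
apply: ae_ge0_le_integral => //.
- apply/measurable_EFinP/measurableT_comp => //.
  by have /integrableP[/measurable_EFinP] := ialg.
- by apply/measurable_EFinP; exact: measurable_cst.
- apply: filterS dg; first exact: (ae_filter_ringOfSetsType mu).
  by move=> x dx /= /[!in_itv]/= axb; rewrite lee_fin; exact: fM axb (dx axb).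
Qed.

End LipschitzDerivative.

(** * Mean square oscillation *)

Section L2Continuity.
Variable R : realType.
Local Notation T := (measurableTypeR R * measurableTypeR R)%type.
Local Notation mu1 := (@lebesgue_measure R).
Local Notation mu := (@lebesgue2 R).
Implicit Types (e s t : R) (f g h : T -> R).

Lemma tonelli12 (F : T * T -> \bar R) : measurable_fun setT F ->
  (forall z, 0 <= F z)%E ->
  (\int[mu \x mu]_z F z = \int[mu]_x \int[mu]_y F (x, y))%E.
Proof. by move=> mF F0; exact: fubini_tonelli1. Qed.

Lemma tonelli21 (F : T * T -> \bar R) : measurable_fun setT F ->
  (forall z, 0 <= F z)%E ->
  (\int[mu \x mu]_z F z = \int[mu]_y \int[mu]_x F (x, y))%E.
Proof. by move=> mF F0; exact: fubini_tonelli2. Qed.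

Definition ker2 e (z : T * T) : R := kap e (z.1.1 - z.2.1) * kap e (z.1.2 - z.2.2).

Definition mass e : R := (16 / 15 * e) ^+ 2.

Lemma mass_gt0 e : 0 < e -> 0 < mass e.
Proof. by move=> e0; rewrite exprn_gt0// mulr_gt0// divr_gt0. Qed.

Lemma ker2_ge0 e z : 0 <= ker2 e z.
Proof. by rewrite mulr_ge0// kap_ge0. Qed.

Lemma ker2_le1 e z : ker2 e z <= 1.
Proof. by rewrite mulr_ile1 ?kap_ge0 ?kap_le1. Qed.

Lemma ker2C e x y : ker2 e (x, y) = ker2 e (y, x).
Proof. by rewrite /ker2/= -kapN opprB -(kapN _ (x.2 - _)) opprB. Qed.

Lemma measurable_kap e : measurable_fun [set: measurableTypeR R] (kap e).
Proof. by apply: continuous_measurable_fun; exact: continuous_kap. Qed.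

Lemma measurable_ker2 e : measurable_fun [set: T * T] (ker2 e).
Proof.
have m (p : T -> measurableTypeR R) : measurable_fun setT p ->
    measurable_fun [set: T * T] (fun z => kap e (p z.1 - p z.2)).
  move=> mp; apply: (measurableT_comp (measurable_kap e)).
  by apply: measurable_funB; apply: (measurableT_comp mp); [exact: measurable_fst|exact: measurable_snd].
by apply: measurable_funM; [exact: (m fst measurable_fst)|exact: (m snd measurable_snd)].
Qed.

Lemma integral_ker2 e (x : T) : 0 < e ->
  (\int[mu]_y (ker2 e (x, y))%:E = (mass e)%:E)%E.
Proof.
move=> e0.
have mk p : measurable_fun [set: measurableTypeR R] (fun t => kap e (p - t)).
  by apply: (measurableT_comp (measurable_kap e)); exact: measurable_funB.
rewrite /lebesgue2 fubini_tonelli1//=; last first.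
- by move=> y; rewrite lee_fin ker2_ge0.
- apply/measurable_EFinP; apply: (measurableT_comp (measurable_ker2 e)).
  exact: pair1_measurable.
rewrite /fubini_F/=.
under eq_integral => y1 _.
  rewrite /ker2/=.
  under eq_integral do rewrite EFinM.
  rewrite ge0_integralZl//; [|exact/measurable_EFinP|by move=> *; rewrite lee_fin kap_ge0|by rewrite lee_fin kap_ge0].
  rewrite integral_kap// muleC.
  over.
rewrite ge0_integralZl//; [|exact/measurable_EFinP|by move=> *; rewrite lee_fin kap_ge0|].
  by rewrite integral_kap// -EFinM -expr2.
by rewrite lee_fin mulr_ge0 ?ltW// divr_gt0.
Qed.

Lemma integral_ker2_fst e f : 0 < e -> measurable_fun setT f -> (forall x, 0 <= f x) ->
  (\int[mu \x mu]_z (ker2 e z * f z.1)%:E = (mass e)%:E * \int[mu]_x (f x)%:E)%E.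
Proof.
move=> e0 mf f0; rewrite tonelli12//; last first.
- by move=> z; rewrite lee_fin mulr_ge0// ker2_ge0.
- apply/measurable_EFinP; apply: measurable_funM; first exact: measurable_ker2.
  exact: (measurableT_comp mf measurable_fst).
under eq_integral => x _.
  under eq_integral do rewrite mulrC EFinM/=.
  rewrite ge0_integralZl//; last 3 first.
  - by apply/measurable_EFinP; apply: (measurableT_comp (measurable_ker2 e)); exact: pair1_measurable.
  - by move=> *; rewrite lee_fin ker2_ge0.
  - by rewrite lee_fin.
  rewrite integral_ker2// muleC.
  over.
rewrite ge0_integralZl//.
- exact/measurable_EFinP.
- by move=> x _; rewrite lee_fin.
- by rewrite lee_fin ltW// mass_gt0.
Qed.

Lemma integral_ker2_snd e f : 0 < e -> measurable_fun setT f -> (forall x, 0 <= f x) ->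
  (\int[mu \x mu]_z (ker2 e z * f z.2)%:E = (mass e)%:E * \int[mu]_x (f x)%:E)%E.
Proof.
move=> e0 mf f0; rewrite tonelli21//; last first.
- by move=> z; rewrite lee_fin mulr_ge0// ker2_ge0.
- apply/measurable_EFinP; apply: measurable_funM; first exact: measurable_ker2.
  exact: (measurableT_comp mf measurable_snd).
under eq_integral => x _.
  under eq_integral do rewrite ker2C mulrC EFinM/=.
  rewrite ge0_integralZl//; last 3 first.
  - by apply/measurable_EFinP; apply: (measurableT_comp (measurable_ker2 e)); exact: pair1_measurable.
  - by move=> *; rewrite lee_fin ker2_ge0.
  - by rewrite lee_fin.
  rewrite integral_ker2// muleC.
  over.
rewrite ge0_integralZl//.
- exact/measurable_EFinP.
- by move=> x _; rewrite lee_fin.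
- by rewrite lee_fin ltW// mass_gt0.
Qed.

(** The mean square oscillation at scale [e], before division by [mass e]. Extended values spare any
    integrability assumption. *)
Definition osc e f : \bar R :=
  (\int[mu \x mu]_z (ker2 e z * (f z.1 - f z.2) ^+ 2)%:E)%E.

Lemma measurable_osc e f : measurable_fun setT f ->
  measurable_fun [set: T * T] (fun z => (ker2 e z * (f z.1 - f z.2) ^+ 2)%:E).
Proof.
move=> mf; apply/measurable_EFinP; apply: measurable_funM; first exact: measurable_ker2.
apply: measurable_funX; apply: measurable_funB.
  exact: (measurableT_comp mf measurable_fst).
exact: (measurableT_comp mf measurable_snd).
Qed.

Lemma osc_integrand_ge0 e f z : (0 <= (ker2 e z * (f z.1 - f z.2) ^+ 2)%:E)%E.
Proof. by rewrite lee_fin mulr_ge0 ?ker2_ge0 ?sqr_ge0. Qed.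

Lemma oscD e f g : measurable_fun setT f -> measurable_fun setT g ->
  (osc e (fun x => f x + g x)%R <= 2%:E * osc e f + 2%:E * osc e g)%E.
Proof.
move=> mf mg; rewrite /osc.
rewrite -!ge0_integralZl// ?lee_fin//; try exact: measurable_osc;
  try by move=> z _; exact: osc_integrand_ge0.
rewrite -ge0_integralD//; last 4 first.
- by move=> z _; apply: mule_ge0; [rewrite lee_fin|exact: osc_integrand_ge0].
- by apply: measurable_funeM; exact: measurable_osc.
- by move=> z _; apply: mule_ge0; [rewrite lee_fin|exact: osc_integrand_ge0].
- by apply: measurable_funeM; exact: measurable_osc.
apply: ge0_le_integral => //.
- by move=> z _; exact: (osc_integrand_ge0 e (fun x => f x + g x)).
- exact: (measurable_osc e (measurable_funD mf mg)).
- by apply: emeasurable_funD; apply: measurable_funeM; exact: measurable_osc.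
move=> z _; rewrite -!EFinM -EFinD lee_fin /=.
have := ker2_ge0 e z; set k := ker2 e z => k0.
rewrite -subr_ge0.
have -> : 2 * (k * (f z.1 - f z.2) ^+ 2) + 2 * (k * (g z.1 - g z.2) ^+ 2) -
  k * (f z.1 + g z.1 - (f z.2 + g z.2)) ^+ 2 =
  k * ((f z.1 - f z.2) - (g z.1 - g z.2)) ^+ 2 by ring.
by rewrite mulr_ge0// sqr_ge0.
Qed.

Lemma oscZ e (a : R) f : measurable_fun setT f ->
  (osc e (fun x => (a * f x)%R) = (a ^+ 2)%:E * osc e f)%E.
Proof.
move=> mf; rewrite /osc -ge0_integralZl//; last 3 first.
- exact: measurable_osc.
- by move=> z _; exact: osc_integrand_ge0.
- by rewrite lee_fin sqr_ge0.
by apply: eq_integral => z _; rewrite -EFinM; congr EFin; ring.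
Qed.

(** After division by the mass the bound does not depend on [e]: a perturbation small in mean square
    has small oscillation at all scales. The 4 comes from (a - b)^2 <= 2 a^2 + 2 b^2, each square
    contributing one mass. *)
Lemma osc_le e f : 0 < e -> measurable_fun setT f ->
  (osc e f <= (4 * mass e)%:E * \int[mu]_x ((f x) ^+ 2)%:E)%E.
Proof.
move=> e0 mf.
have mf2 : measurable_fun setT (fun x => f x ^+ 2) by exact: measurable_funX.
have E1 := integral_ker2_fst e0 mf2 (fun x => sqr_ge0 (f x)).
have E2 := integral_ker2_snd e0 mf2 (fun x => sqr_ge0 (f x)).
have m1 : measurable_fun [set: T * T] (fun z => (ker2 e z * f z.1 ^+ 2)%:E).
  apply/measurable_EFinP; apply: measurable_funM; first exact: measurable_ker2.
  exact: (measurableT_comp mf2 measurable_fst).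
have m2 : measurable_fun [set: T * T] (fun z => (ker2 e z * f z.2 ^+ 2)%:E).
  apply/measurable_EFinP; apply: measurable_funM; first exact: measurable_ker2.
  exact: (measurableT_comp mf2 measurable_snd).
have p1 (z : T * T) : (0 <= (ker2 e z * f z.1 ^+ 2)%:E)%E by rewrite lee_fin mulr_ge0 ?ker2_ge0 ?sqr_ge0.
have p2 (z : T * T) : (0 <= (ker2 e z * f z.2 ^+ 2)%:E)%E by rewrite lee_fin mulr_ge0 ?ker2_ge0 ?sqr_ge0.
have -> : ((4 * mass e)%:E * \int[mu]_x (f x ^+ 2)%:E =
    \int[mu \x mu]_z (2%:E * (ker2 e z * f z.1 ^+ 2)%:E + 2%:E * (ker2 e z * f z.2 ^+ 2)%:E))%E.
  rewrite ge0_integralD//; last 4 first.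
  - by move=> z _; rewrite mule_ge0// lee_fin.
  - exact: measurable_funeM.
  - by move=> z _; rewrite mule_ge0// lee_fin.
  - exact: measurable_funeM.
  rewrite !ge0_integralZl// ?lee_fin// E1 E2 !muleA -!EFinM -ge0_muleDl.
  - by rewrite -EFinD; congr (_%:E * _)%E; ring.
  - by rewrite lee_fin mulr_ge0// ltW// mass_gt0.
  - by rewrite lee_fin mulr_ge0// ltW// mass_gt0.
apply: ge0_le_integral => //.
- by move=> z _; exact: osc_integrand_ge0.
- exact: measurable_osc.
- by apply: emeasurable_funD; exact: measurable_funeM.
move=> z _; rewrite -!EFinM -EFinD lee_fin.
have := ker2_ge0 e z; set k := ker2 e z => k0.
rewrite -subr_ge0.
have -> : 2 * (k * f z.1 ^+ 2) + 2 * (k * f z.2 ^+ 2) -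
  k * (f z.1 - f z.2) ^+ 2 = k * (f z.1 + f z.2) ^+ 2 by ring.
by rewrite mulr_ge0// sqr_ge0.
Qed.

End L2Continuity.

(** * Functions of vanishing oscillation, indicators of open sets *)

Section VanishingOscillation.
Variable R : realType.
Local Notation T := (measurableTypeR R * measurableTypeR R)%type.
Local Notation mu := (@lebesgue2 R).
Implicit Types (e : R) (f g h : T -> R) (A O : set T).

(** Continuity of translations in mean square, averaged over the shift. This form passes to sums,
    multiples and mean square limits. *)
Definition vosc f := measurable_fun setT f /\
  forall eta : R, 0 < eta -> exists2 e0 : R, 0 < e0 &
    forall e, 0 < e <= e0 -> (osc e f <= (eta * mass e)%:E)%E.

Lemma mass_ge0 e : 0 <= mass e. Proof. exact: sqr_ge0. Qed.

Lemma voscD f g : vosc f -> vosc g -> vosc (fun x => f x + g x).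
Proof.
move=> [mf vf] [mg vg]; split; first exact: measurable_funD.
move=> eta eta0; have eta4 : 0 < eta / 4 by rewrite divr_gt0.
have [e1 e10 H1] := vf _ eta4; have [e2 e20 H2] := vg _ eta4.
exists (Num.min e1 e2); first by rewrite lt_min e10.
move=> e /andP[e0]; rewrite le_min => /andP[ee1 ee2].
apply: (le_trans (oscD e mf mg)).
have -> : ((eta * mass e)%:E = 2%:E * (eta / 4 * mass e)%:E + 2%:E * (eta / 4 * mass e)%:E)%E.
  by rewrite -!EFinM -EFinD; congr EFin; field.
apply: leeD; apply: lee_wpmul2l; rewrite ?lee_fin//.
  by apply: H1; rewrite e0.
by apply: H2; rewrite e0.
Qed.

Lemma voscZ (a : R) f : vosc f -> vosc (fun x => a * f x).
Proof.
move=> [mf vf]; split; first exact: measurable_funM.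
move=> eta eta0; have a1 : 0 < a ^+ 2 + 1 by rewrite ltr_wpDl ?sqr_ge0.
have [e0 e00 H] := vf _ (divr_gt0 eta0 a1); exists e0 => // e ee0.
rewrite oscZ//; apply: (@le_trans _ _ ((a ^+ 2)%:E * (eta / (a ^+ 2 + 1) * mass e)%:E)%E).
  by apply: lee_wpmul2l; [rewrite lee_fin sqr_ge0|exact: H].
rewrite -EFinM lee_fin mulrA ler_wpM2r ?mass_ge0// mulrCA ler_piMr//; first exact: ltW.
by rewrite ler_pdivrMr// mul1r lerDl.
Qed.

(** Closedness under mean square limits: [osc_le] controls the remainder uniformly in the scale. The
    budget is 2 (1/4) + 2 * 4 (1/16) = 1. *)
Lemma vosc_approx f : measurable_fun setT f ->
  (forall eta : R, 0 < eta -> exists2 g, vosc g &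
    (\int[mu]_x ((f x - g x) ^+ 2)%:E <= eta%:E)%E) -> vosc f.
Proof.
move=> mf H; split => // eta eta0.
have eta16 : 0 < eta / 16 by rewrite divr_gt0.
have [g [mg vg] fg] := H _ eta16.
have eta4 : 0 < eta / 4 by rewrite divr_gt0.
have [e0 e00 Hg] := vg _ eta4; exists e0 => // e /andP[e_gt0 ee0].
have mfg : measurable_fun setT (fun x => f x - g x) by exact: measurable_funB.
have -> : f = (fun x => g x + (f x - g x)) by apply/funext => x; rewrite addrC subrK.
apply: (le_trans (oscD e mg mfg)).
have -> : ((eta * mass e)%:E = 2%:E * (eta / 4 * mass e)%:E +
    2%:E * ((4 * mass e)%:E * (eta / 16)%:E))%E.
  by rewrite -!EFinM -EFinD; congr EFin; field.
apply: leeD; apply: lee_wpmul2l; rewrite ?lee_fin//.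
  by apply: Hg; rewrite e_gt0.
apply: (le_trans (osc_le e_gt0 mfg)).
by apply: lee_wpmul2l => //; rewrite lee_fin mulr_ge0// mass_ge0.
Qed.

(** The inner layer of [O], the only place in [O] from which a step shorter than [e] can leave it.
    Balls are those of the max norm, like the support of the product kernel. *)
Definition rim O e : set T := O `&` \bigcup_(y in ~` O) ball (y : R * R) e.

Lemma rim_sub O e e' : e <= e' -> rim O e `<=` rim O e'.
Proof.
by move=> ee' x [Ox [y Oy yx]]; split => //; exists y => //; exact: le_ball yx.
Qed.

Lemma open_rim O e : open (O : set (R * R)) -> open (rim O e : set (R * R)).
Proof.
move=> oO; apply: openI => //; apply: bigcup_open => y _; exact: ball_open.
Qed.

(** The rims decrease to the empty set because each point of an open set keeps a positive distance
    from the complement; finite measure gives continuity from above. *)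
Lemma rim_cvg O (eta : R) : open (O : set (R * R)) -> (mu O < +oo)%E -> 0 < eta ->
  exists2 e0 : R, 0 < e0 & (mu (rim O e0) <= eta%:E)%E.
Proof.
move=> oO Ofin eta0; pose F (n : nat) := rim O n.+1%:R^-1.
have mF n : measurable (F n) by apply: open_measurable_plane; exact: open_rim.
have capF : \bigcap_n F n = set0.
  apply/seteqP; split => // x xF; have [Ox _] := xF 0%N I.
  have /nbhs_ballP[r /= r0 xrO] := open_nbhs_nbhs (conj oO Ox).
  have [n _ /(_ n (leqnn n)) /= nr] := near_infty_natSinv_lt (PosNum r0).
  have [_ [y Oy yx]] := xF n I; apply: Oy; apply: xrO.
  by apply: le_ball (ltW nr) _ _; exact: ball_sym.
have F0fin : (mu (F 0%N) < +oo)%E.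
  apply: le_lt_trans Ofin; apply: le_measure; rewrite ?inE//.
    exact: open_measurable_plane.
  exact: subIsetl.
have := nonincreasing_cvg_mu F0fin mF.
rewrite capF measure0 => /(_ measurable0).
have ndF : {homo F : n m / (n <= m)%N >-> (m <= n)%O}.
  move=> n m nm; apply/subsetPset; apply: rim_sub.
  by rewrite lef_pV2 ?posrE// ler_nat.
move=> /(_ ndF) /fine_cvgP[[N _ finF]] /cvgrPdist_le /(_ _ eta0)[M _ MF].
exists (maxn N M).+1%:R^-1; first by rewrite invr_gt0.
have := MF (maxn N M) (leq_maxr _ _); rewrite /= sub0r normrN.
rewrite ger0_norm ?fine_ge0// -lee_fin fineK//.
exact: finF (leq_maxl _ _).
Qed.

(** The kernel couples only points closer than [e]. If exactly one of them is in [O], it lies in the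
    rim, so the squared difference is at most the sum of the rim's indicators at both points, and
    each of these integrates to [mass e] times the measure of the rim. *)
Lemma vosc_open O : open (O : set (R * R)) -> (mu O < +oo)%E -> vosc \1_O.
Proof.
move=> oO Ofin; have mO : measurable O by exact: open_measurable_plane.
split; first exact: measurable_indic.
move=> eta eta0; have eta2 : 0 < eta / 2 by rewrite divr_gt0.
have [e0 e00 He0] := rim_cvg oO Ofin eta2; exists e0 => // e /andP[e_gt0 ee0].
have mr : measurable (rim O e0) by apply: open_measurable_plane; exact: open_rim.
have mi : measurable_fun setT (\1_(rim O e0) : T -> R) by exact: measurable_indic.
have i0 x : 0 <= (\1_(rim O e0) x : R) by rewrite indicE.
have Ei : (\int[mu]_x (\1_(rim O e0) x)%:E = mu (rim O e0))%E.
  by rewrite integral_indic// setIT.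
have E1 := integral_ker2_fst e_gt0 mi i0; have E2 := integral_ker2_snd e_gt0 mi i0.
have m1 : measurable_fun [set: T * T] (fun z => (ker2 e z * \1_(rim O e0) z.1)%:E).
  apply/measurable_EFinP; apply: measurable_funM; first exact: measurable_ker2.
  exact: (measurableT_comp mi measurable_fst).
have m2 : measurable_fun [set: T * T] (fun z => (ker2 e z * \1_(rim O e0) z.2)%:E).
  apply/measurable_EFinP; apply: measurable_funM; first exact: measurable_ker2.
  exact: (measurableT_comp mi measurable_snd).
have p1 (z : T * T) : (0 <= (ker2 e z * \1_(rim O e0) z.1)%:E)%E by rewrite lee_fin mulr_ge0 ?ker2_ge0.
have p2 (z : T * T) : (0 <= (ker2 e z * \1_(rim O e0) z.2)%:E)%E by rewrite lee_fin mulr_ge0 ?ker2_ge0.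
apply: (@le_trans _ _ (\int[mu \x mu]_z ((ker2 e z * \1_(rim O e0) z.1)%:E +
   (ker2 e z * \1_(rim O e0) z.2)%:E))%E).
  apply: ge0_le_integral => //.
  - by move=> z _; exact: osc_integrand_ge0.
  - exact: (measurable_osc e (f := \1_O) (measurable_indic mO)).
  - exact: emeasurable_funD.
  move=> z _; rewrite -EFinD lee_fin -mulrDr.
  have [kz|kz] := eqVneq (ker2 e z) 0; first by rewrite kz !mul0r.
  rewrite ler_wpM2l ?ker2_ge0//.
  have zz (i : T -> R) : i = fst \/ i = snd -> `|i z.1 - i z.2| < e.
    move=> ii; rewrite ltNge; apply: contra kz => ez.
    rewrite /ker2 mulf_eq0; apply/orP.
    by case: ii ez => -> ez; [left|right]; rewrite kap_eq0.
  have z12 : ball (z.1 : R * R) e z.2.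
    by split; [exact: (zz _ (or_introl erefl))|exact: (zz _ (or_intror erefl))].
  rewrite !indicE.
  have [Oz1|Oz1] := boolP (z.1 \in O); have [Oz2|Oz2] := boolP (z.2 \in O);
    rewrite /= ?subrr ?expr0n/= ?addr_ge0// ?subr0 ?sub0r ?sqrrN ?expr1n.
  - rewrite (_ : z.1 \in rim O e0 = true) ?lerDl//.
    apply/mem_set; split; first exact: set_mem.
    exists z.2; first by move: Oz2; rewrite notin_setE.
    by apply: (le_ball ee0); exact: ball_sym.
  - rewrite (_ : z.2 \in rim O e0 = true) ?lerDr//.
    apply/mem_set; split; first exact: set_mem.
    exists z.1; first by move: Oz1; rewrite notin_setE.
    exact: (le_ball ee0).
rewrite ge0_integralD// E1 E2 Ei -ge0_muleDr ?measure_ge0//.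
have -> : (eta * mass e)%:E = ((mass e)%:E * ((eta / 2)%:E + (eta / 2)%:E))%E.
  by rewrite -EFinD -EFinM; congr EFin; field.
apply: lee_wpmul2l; first by rewrite lee_fin mass_ge0.
exact: leeD.
Qed.

End VanishingOscillation.

Import HBNNSimple.

(** * Vanishing oscillation of all square integrable functions *)

Section L2VanishingOscillation.
Variable R : realType.
Local Notation T := (measurableTypeR R * measurableTypeR R)%type.
Local Notation mu := (@lebesgue2 R).
Implicit Types (e M : R) (f g h : T -> R) (A O : set T).

Definition cube M : set T := ball (0 : R * R) M.

Lemma open_cube M : open (cube M : set (R * R)). Proof. exact: ball_open. Qed.

Lemma measurable_cube M : measurable (cube M).
Proof. by apply: open_measurable_plane; exact: open_cube. Qed.

Lemma cube_fin M : (mu (cube M) < +oo)%E.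
Proof.
have [M0|M0] := ltP 0 M; last first.
  rewrite (_ : cube M = set0) ?measure0//.
  by apply/seteqP; split => // x [/= H _]; have := le_lt_trans (normr_ge0 _) (lt_le_trans H M0); rewrite ltxx.
rewrite /cube ball_prodE /lebesgue2 product_measure1E; try exact: measurable_ball.
have b c : (@lebesgue_measure R (ball c M) < +oo)%E.
  by rewrite lebesgue_measure_ball ?ltry// ltW.
by apply: lte_mul_pinfty; [exact: measure_ge0|by rewrite ge0_fin_numE; [exact: b|exact: measure_ge0]|exact: b].
Qed.

Lemma vosc_ext f g : f =1 g -> vosc f -> vosc g.
Proof. by move=> /funext ->. Qed.

Lemma vosc0 : vosc (fun _ : T => 0 : R).
Proof.
split; first exact: measurable_cst.
move=> eta eta0; exists 1 => // e _.
rewrite /osc; under eq_integral do rewrite subrr expr0n/= mulr0.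
by rewrite integral0 lee_fin mulr_ge0 ?mass_ge0// ltW.
Qed.

Lemma vosc_sum (I : Type) (s : seq I) (F : I -> T -> R) :
  (forall i, vosc (F i)) -> vosc (fun x => \sum_(i <- s) F i x).
Proof.
move=> vF; elim: s => [|i s IH].
  by apply: vosc_ext vosc0 => x; rewrite big_nil.
by apply: vosc_ext (voscD (vF i) IH) => x; rewrite big_cons.
Qed.

(** Dynkin induction from open sets. Complements are differences within the cube; for a disjoint
    union the tails decrease to the empty set, so the finite unions approximate it in mean square.
    The cube keeps all measures finite. *)
Lemma vosc_indic_cube M A : measurable A -> vosc \1_(A `&` cube M).
Proof.
move=> mA; have := mA; rewrite plane_measurableE.
have fin (S : set T) : measurable S -> (mu (S `&` cube M) < +oo)%E.
  move=> mS; apply: le_lt_trans (cube_fin M); apply: le_measure; rewrite ?inE//.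
  - by apply: measurableI => //; exact: measurable_cube.
  - exact: measurable_cube.
move: A mA => A _; move: A.
apply: (@dynkin_induction _ T (open : set (set (R * R)))
  (fun A => vosc \1_(A `&` cube M))).
- exact: plane_measurableE.
- by move=> A B; exact: openI.
- rewrite setTI; apply: vosc_open; [exact: open_cube|exact: cube_fin].
- move=> A oA; apply: vosc_open; first by apply: openI => //; exact: open_cube.
  by apply: fin; exact: open_measurable_plane.
- move=> S mS vS.
  have vC : vosc \1_(cube M) by apply: vosc_open; [exact: open_cube|exact: cube_fin].
  apply: vosc_ext (voscD vC (voscZ (-1) vS)) => x.
  rewrite !indicE (in_setI _ S) (in_setI _ (~` S)) in_setC.
  by case: (x \in S); case: (x \in cube M); rewrite /= ?mulr1 ?mulr0 ?subrr ?addr0.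
- move=> F mF tF vF.
  pose S n := \bigcup_(k in `I_n) F k.
  have mS n : measurable (S n) by exact: bigcup_measurable.
  have vS n : vosc \1_(S n `&` cube M).
    elim: n => [|n IH].
      by apply: vosc_ext vosc0 => x; rewrite /S II0 bigcup_set0 set0I indic0.
    apply: vosc_ext (voscD IH (vF n)) => x.
    rewrite !indicE (in_setI _ (S n)) (in_setI _ (F n)) (in_setI _ (S n.+1)).
    rewrite /S IIS bigcup_setU bigcup_set1 in_setU -/(S n).
    case: (x \in cube M); rewrite ?andbF ?addr0// !andbT.
    have [xS|_] := boolP (x \in S n); have [xF|_] := boolP (x \in F n);
      rewrite /= ?addr0 ?add0r//.
    have [k /= kn Fk] := set_mem xS.
    have /trivIsetP /(_ k n I I) := tF; rewrite ltn_eqF// => /(_ isT) FF.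
    have : (F k `&` F n) x by split => //; exact: set_mem.
    by rewrite FF.
  have mU : measurable (\bigcup_k F k) by exact: bigcup_measurable.
  apply: vosc_approx.
    by apply: measurable_indic; apply: measurableI => //; exact: measurable_cube.
  move=> eta eta0.
  pose D n := (\bigcup_k F k `\` S n) `&` cube M.
  have mD n : measurable (D n).
    by apply: measurableI; [exact: measurableD|exact: measurable_cube].
  have capD : \bigcap_n D n = set0.
    apply/seteqP; split => // x xD; have [[[k _ Fk] _] _] := xD 0%N I.
    by have [[_ Sk] _] := xD k.+1 I; apply: Sk; exists k => /=.
  have D0 : (mu (D 0%N) < +oo)%E by apply: fin; exact: measurableD.
  have ndD : {homo D : n m / (n <= m)%N >-> (m <= n)%O}.
    move=> n m nm; apply/subsetPset => x [[Ux Sx] Cx]; split => //; split => //.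
    by apply: contra_not Sx => -[k /= kn Fk]; exists k => //=; exact: leq_trans nm.
  have := nonincreasing_cvg_mu D0 mD; rewrite capD measure0 => /(_ measurable0 ndD).
  move=> /fine_cvgP[[N _ finD]] /cvgrPdist_le /(_ _ eta0)[K _ KD].
  exists \1_(S (maxn N K) `&` cube M); first exact: vS.
  have -> : (\int[mu]_x ((\1_(\bigcup_k F k `&` cube M) x -
      \1_(S (maxn N K) `&` cube M) x : R) ^+ 2)%:E = mu (D (maxn N K)))%E.
    rewrite -[in RHS](setIT (D _)) -integral_indic//; apply: eq_integral => x _.
    congr EFin; rewrite !indicE /D (in_setI _ (\bigcup_k F k)) (in_setI _ (S _)).
    rewrite (in_setI _ (_ `\` _)) in_setD.
    have SU : x \in S (maxn N K) -> x \in \bigcup_k F k.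
      by move=> /set_mem[k _ Fk]; apply/mem_set; exists k.
    move: SU; case: (x \in S _); case: (x \in \bigcup_k F k); case: (x \in cube M);
      rewrite /= ?subrr ?subr0 ?expr1n ?expr0n//= => /(_ isT)//.
  have := KD (maxn N K) (leq_maxr _ _); rewrite /= sub0r normrN.
  rewrite ger0_norm ?fine_ge0// -lee_fin fineK//.
  exact: finD (leq_maxl _ _).
Qed.

Lemma vosc_nnsfun_cube M (g : {nnsfun T >-> R}) :
  vosc (fun x => g x * \1_(cube M) x).
Proof.
have vsum : vosc (fun x => \sum_(y <- finmap.enum_fset (fset_set (range g)))
    y * (\1_(g @^-1` [set y] `&` cube M) x : R)).
  by apply: vosc_sum => y; apply: voscZ; apply: vosc_indic_cube; exact: measurable_sfunP.
apply: vosc_ext vsum => x.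
 rewrite [in RHS]fimfunE fsbig_finite//= mulr_suml.
by apply: eq_bigr => y _; rewrite -mulrA indicI.
Qed.

(** Increasing simple functions, cut off to growing cubes where indicators are under control,
    converge to [f] in mean square: the squared error is dominated by f^2. *)
Lemma vosc_ge0 f : measurable_fun setT f -> (forall x, 0 <= f x) ->
  mu.-integrable setT (EFin \o (fun x => f x ^+ 2)) -> vosc f.
Proof.
move=> mf f0 if2; apply: vosc_approx => // eta eta0.
have mEf : measurable_fun setT (EFin \o f) by exact/measurable_EFinP.
pose g := nnsfun_approx measurableT mEf.
pose h n x := g n x * \1_(cube n%:R) x.
have gf x : g n x @[n --> \oo] --> f x.
  have f0E y : setT y -> (0 <= (EFin \o f) y)%E by rewrite lee_fin.
  exact: (fine_cvg (@cvg_nnsfun_approx _ _ _ _ measurableT _ mEf f0E x I)).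
have ndg x : {homo (fun n => g n x) : n m / (n <= m)%N >-> n <= m}.
  by move=> n m nm; exact/lefP/nd_nnsfun_approx.
have gle n x : g n x <= f x.
  have cg : cvgn (fun n => g n x) by apply/cvg_ex; exists (f x); exact: gf.
  by have := nondecreasing_cvgn_le (ndg x) cg n; rewrite (cvg_lim _ (gf x)).
have ge0 n x : 0 <= g n x by [].
have mh n : measurable_fun setT (h n).
  by apply: measurable_funM => //; apply: measurable_indic; exact: measurable_cube.
pose F n x := ((f x - h n x) ^+ 2)%:E.
have mF n : measurable_fun setT (F n).
  by apply/measurable_EFinP; apply: measurable_funX; exact: measurable_funB.
have cvg1 x : (\1_(cube n%:R) x : R) @[n --> \oo] --> (1 : R).
  apply: cvg_near_cst; near=> n.
  rewrite indicE mem_set//; split; rewrite /= /ball/= sub0r normrN.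
    by near: n; exact: nbhs_infty_gtr.
  by near: n; exact: nbhs_infty_gtr.
have cvgF x : setT x -> F n x @[n --> \oo] --> (0 : \bar R)%E.
  move=> _; apply: cvg_EFin; first by near=> n.
  have -> : fine \o (F ^~ x) = fun n => (f x - h n x) ^+ 2 by [].
  have : (f x - h n x) @[n --> \oo] --> f x - f x * 1.
    by apply: cvgB; [exact: cvg_cst|apply: cvgM; [exact: gf|exact: cvg1]].
  rewrite mulr1 subrr => c0; rewrite -(mulr0 0); exact: (cvgM c0 c0).
have leF n x : setT x -> (`|F n x| <= (f x ^+ 2)%:E)%E.
  move=> _; rewrite gee0_abs ?lee_fin ?sqr_ge0// -(ger0_norm (f0 x)).
  rewrite -[leLHS]real_normK ?num_real// lerXn2r ?nnegrE//.
  rewrite (ger0_norm (f0 x)) ger0_norm ?subr_ge0.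
    by rewrite gerBl mulr_ge0// indicE.
  rewrite /h indicE; case: (_ \in _); rewrite ?mulr1 ?mulr0//.
have := @dominated_cvg _ _ _ mu setT measurableT F (cst 0%E) _ mF cvgF _ if2 leF.
rewrite integral0 => /(_ (fun _ _ => erefl)).
move=> /fine_cvgP[[N _ finF]] /cvgrPdist_le /(_ _ eta0)[K _ KF].
exists (h (maxn N K)); first exact: vosc_nnsfun_cube.
have := KF (maxn N K) (leq_maxr _ _); rewrite /= sub0r normrN.
rewrite ger0_norm; last first.
  by apply: fine_ge0; apply: integral_ge0 => x _; rewrite lee_fin sqr_ge0.
by rewrite -lee_fin fineK//; exact: finF (leq_maxl _ _).
Unshelve. all: by end_near. Qed.

Lemma vosc_L2 f : measurable_fun setT f ->
  mu.-integrable setT (EFin \o (fun x => f x ^+ 2)) -> vosc f.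
Proof.
have pos g : measurable_fun setT g ->
    mu.-integrable setT (EFin \o (fun x => g x ^+ 2)) ->
    vosc (fun x => Num.max (g x) 0).
  move=> mg ig; have mgp : measurable_fun setT (fun x => Num.max (g x) 0).
    exact: measurable_maxr.
  apply: vosc_ge0 => //; first by move=> x; rewrite le_max lexx orbT.
  apply: (le_integrable measurableT _ _ ig).
    by apply/measurable_EFinP; exact: measurable_funX.
  move=> x _ /=; rewrite lee_fin !ger0_norm ?sqr_ge0//.
  by case: (leP (g x) 0) => // _; rewrite expr0n/= sqr_ge0.
move=> mf if2.
have mNf : measurable_fun setT (fun x => - f x) by exact: measurable_funN.
have iNf : mu.-integrable setT (EFin \o (fun x => (- f x) ^+ 2)).
  by apply: eq_integrable if2 => // x _ /=; rewrite sqrrN.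
apply: vosc_ext (voscD (pos _ mf if2) (voscZ (-1) (pos _ mNf iNf))) => x.
by case: (leP (f x) 0) => ?; case: (leP (- f x) 0) => ?; lra.
Qed.

End L2VanishingOscillation.

(** * Products of weak derivatives *)

Lemma integrableM_bounded d (T : measurableType d) (R : realType)
    (mu : {measure set T -> \bar R}) (D : set T) (f b : T -> R) :
  measurable D -> mu.-integrable D (EFin \o f) -> measurable_fun D b ->
  (exists C : R, forall x, D x -> `|b x| <= C) ->
  mu.-integrable D (EFin \o (fun x => f x * b x)).
Proof.
move=> mD f1 mb [C bC]; have /integrableP[/measurable_EFinP mf _] := f1.
apply: (le_integrable mD _ _ (integrableZl mD C f1)).
  by apply/measurable_EFinP; exact: measurable_funM.
move=> x Dx /=; rewrite lee_fin normrM mulrC normrM ler_wpM2r//.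
by rewrite (le_trans (bC x Dx))// ler_norm.
Qed.

Lemma amgm_weighted (R : realFieldType) (s x y : R) : 0 < s ->
  `|x * y| <= s * x ^+ 2 + (4 * s)^-1 * y ^+ 2.
Proof.
move=> s0.
have E a b : s * a ^+ 2 + (4 * s)^-1 * b ^+ 2 - a * b = s * (a - (2 * s)^-1 * b) ^+ 2.
  by field; rewrite gt_eqF.
have Q a b : a * b <= s * a ^+ 2 + (4 * s)^-1 * b ^+ 2.
  by rewrite -subr_ge0 E mulr_ge0 ?sqr_ge0// ltW.
rewrite ler_norml Q andbT lerNl -mulrN -[X in _ <= _ + _ * X]sqrrN; exact: Q.
Qed.

Section Pairing.
Variable R : realType.
Local Notation T := (measurableTypeR R * measurableTypeR R)%type.
Local Notation mu := (@lebesgue2 R).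
Local Notation mumu := (mu \x mu)%E.
Implicit Types (e : R) (f g h b : T -> R).

Definition L1 f := mu.-integrable setT (EFin \o f).

Definition L2 f := measurable_fun setT f /\ L1 (fun x => f x ^+ 2).

Lemma L1_measurable f : L1 f -> measurable_fun setT f.
Proof. by move=> /integrableP[/measurable_EFinP]. Qed.

Lemma L1D f g : L1 f -> L1 g -> L1 (fun x => f x + g x).
Proof. by move=> f1 g1; exact: (integrableD measurableT f1 g1). Qed.

Lemma L1M_bounded f b : L1 f -> measurable_fun setT b ->
  (exists C : R, forall x, `|b x| <= C) -> L1 (fun x => f x * b x).
Proof.
move=> f1 mb [C bC]; apply: integrableM_bounded => //.
by exists C => x _; exact: bC.
Qed.

Lemma L2M_L1 f g : L2 f -> L2 g -> L1 (fun x => f x * g x).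
Proof.
move=> [mf f2] [mg g2]; apply: (le_integrable measurableT _ _ (L1D f2 g2)).
  by apply/measurable_EFinP; exact: measurable_funM.
move=> x _ /=; rewrite lee_fin [leRHS]ger0_norm ?addr_ge0 ?sqr_ge0// ler_norml.
by apply/andP; split; have := sqr_ge0 (f x - g x); have := sqr_ge0 (f x + g x); nra.
Qed.

Lemma L2D f g : L2 f -> L2 g -> L2 (fun x => f x + g x).
Proof.
move=> Hf Hg; have [mf f2] := Hf; have [mg g2] := Hg.
split; first exact: measurable_funD.
have fg := L2M_L1 Hf Hg.
apply: eq_integrable (L1D (L1D f2 g2) (L1D fg fg)) => // x _ /=.
by congr EFin; ring.
Qed.

Lemma L2M_bounded f b : L2 f -> measurable_fun setT b ->
  (exists C : R, forall x, `|b x| <= C) -> L2 (fun x => f x * b x).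
Proof.
move=> [mf f2] mb [C bC]; split; first exact: measurable_funM.
have := L1M_bounded f2 (measurable_funX 2 mb).
have bb : exists C0 : R, forall x, `|b x ^+ 2| <= C0.
  exists (C ^+ 2) => x; rewrite normrX lerXn2r ?nnegrE//.
  exact: le_trans (normr_ge0 _) (bC x).
move=> /(_ bb); apply: eq_integrable => // x _ /=.
by congr EFin; rewrite exprMn.
Qed.

Section Kernels.
Variable K : T * T -> R.
Hypothesis mK : measurable_fun setT K.
Hypothesis bK : exists C : R, forall z, `|K z| <= C.
Variables f h : T -> R.
Hypotheses (f1 : L1 f) (h1 : L1 h).

Lemma integrable_kernel :
  mumu.-integrable setT (EFin \o (fun z => K z * (f z.1 * h z.2))).
Proof.
have mf := L1_measurable f1; have mh := L1_measurable h1.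
have mfh : measurable_fun [set: T * T] (fun z => f z.1 * h z.2).
  apply: measurable_funM; first exact: (measurableT_comp mf measurable_fst).
  exact: (measurableT_comp mh measurable_snd).
have fh1 : mumu.-integrable setT (EFin \o (fun z => f z.1 * h z.2)).
  apply/integrable12ltyP; first exact/measurable_EFinP.
  have /integrableP[_ fin_f] := f1; have /integrableP[_ fin_h] := h1.
  under eq_integral => x _.
    under eq_integral do rewrite /= normrM EFinM.
    rewrite ge0_integralZl//; last by apply/measurable_EFinP; exact: measurableT_comp.
    over.
  rewrite ge0_integralZr//.
  - apply: lte_mul_pinfty => //; first exact: integral_ge0.
    by rewrite ge0_fin_numE//; exact: integral_ge0.
  - by apply/measurable_EFinP; exact: measurableT_comp.
  - exact: integral_ge0.
have [C KC] := bK.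
have := integrableM_bounded measurableT fh1 mK (ex_intro _ C (fun z _ => KC z)).
by apply: eq_integrable => // z _ /=; rewrite mulrC.
Qed.

Let inner_x x : L1 (fun y => K (x, y) * h y).
Proof.
have [C KC] := bK.
have mKx : measurable_fun setT (fun y => K (x, y)).
  by apply: (measurableT_comp mK); exact: pair1_measurable.
have := L1M_bounded h1 mKx (ex_intro _ C (fun y => KC (x, y))).
by apply: eq_integrable => // y _ /=; rewrite mulrC.
Qed.

Let inner_y y : L1 (fun x => K (x, y) * f x).
Proof.
have [C KC] := bK.
have mKy : measurable_fun setT (fun x => K (x, y)).
  by apply: (measurableT_comp mK); exact: pair2_measurable.
have := L1M_bounded f1 mKy (ex_intro _ C (fun x => KC (x, y))).
by apply: eq_integrable => // x _ /=; rewrite mulrC.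
Qed.

Lemma Rintegral_kernel12 : \int[mumu]_z (K z * (f z.1 * h z.2)) =
  \int[mu]_x (f x * \int[mu]_y (K (x, y) * h y)).
Proof.
rewrite /Rintegral -(integral12_prod_meas1 integrable_kernel); congr fine.
apply: eq_integral => x _; rewrite /fubini_F.
transitivity (\int[mu]_y ((f x)%:E * (K (x, y) * h y)%:E))%E.
  by apply: eq_integral => y _; rewrite -EFinM; congr EFin => /=; ring.
rewrite integralZl//; last exact: inner_x.
by rewrite EFinM fineK//; apply: integrable_fin_num => //; exact: inner_x.
Qed.

Lemma Rintegral_kernel21 : \int[mumu]_z (K z * (f z.1 * h z.2)) =
  \int[mu]_y (h y * \int[mu]_x (K (x, y) * f x)).
Proof.
rewrite /Rintegral -(integral21_prod_meas1 integrable_kernel); congr fine.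
apply: eq_integral => y _; rewrite /fubini_G.
transitivity (\int[mu]_x ((h y)%:E * (K (x, y) * f x)%:E))%E.
  by apply: eq_integral => x _; rewrite -EFinM; congr EFin => /=; ring.
rewrite integralZl//; last exact: inner_y.
by rewrite EFinM fineK//; apply: integrable_fin_num => //; exact: inner_y.
Qed.

End Kernels.

Lemma ker2_bounded e : exists C : R, forall z, `|@ker2 R e z| <= C.
Proof. by exists 1 => z; rewrite ger0_norm ?ker2_ge0// ker2_le1. Qed.

Lemma ker2_diag e g : 0 < e -> L1 g ->
  mumu.-integrable setT (EFin \o (fun z => ker2 e z * g z.1)) /\
  \int[mumu]_z (ker2 e z * g z.1) = mass e * \int[mu]_x g x.
Proof.
move=> e0 g1; have mg := L1_measurable g1.
have mkg : measurable_fun [set: T * T] (fun z => ker2 e z * g z.1).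
  apply: measurable_funM; first exact: measurable_ker2.
  exact: (measurableT_comp mg measurable_fst).
have ikg : mumu.-integrable setT (EFin \o (fun z => ker2 e z * g z.1)).
  apply/integrableP; split; first exact/measurable_EFinP.
  have mng : measurable_fun setT (fun x => `|g x|) by exact: measurableT_comp.
  have := integral_ker2_fst e0 mng (fun x => normr_ge0 (g x)).
  under eq_integral do rewrite -{1}(ger0_norm (ker2_ge0 e _)) -normrM.
  move=> ->; apply: lte_mul_pinfty => //; first by rewrite lee_fin mass_ge0.
  by have /integrableP[_] := g1.
split => //.
rewrite /Rintegral -(integral12_prod_meas1 ikg) -RintegralZl//.
rewrite /Rintegral; congr fine; apply: eq_integral => x _; rewrite /fubini_F /=.
transitivity (\int[mu]_y ((g x)%:E * (ker2 e (x, y))%:E))%E.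
  by apply: eq_integral => y _; rewrite -EFinM mulrC.
have ik : mu.-integrable setT (fun y => (ker2 e (x, y))%:E).
  apply/integrableP; split.
    by apply/measurable_EFinP; apply: (measurableT_comp (measurable_ker2 e)); exact: pair1_measurable.
  under eq_integral do rewrite gee0_abs ?lee_fin ?ker2_ge0//.
  by rewrite integral_ker2// ltry.
by rewrite integralZl// integral_ker2// -EFinM mulrC.
Qed.

(** The deviation from the diagonal is the integral of k f(x) (h(y) - h(x)). A weighted
    arithmetic-geometric inequality splits it into a small multiple of f^2 and the oscillation of
    [h]. *)
Lemma pairing f h (eta : R) : L1 f -> L2 f -> L1 h -> L2 h -> 0 < eta ->
  exists2 e0 : R, 0 < e0 & forall e, 0 < e <= e0 ->
  `|\int[mumu]_z (ker2 e z * (f z.1 * h z.2)) - mass e * \int[mu]_x (f x * h x)|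
   <= eta * mass e.
Proof.
move=> f1 f2 h1 h2 eta0; have [mf if2] := f2; have [mh ih2] := h2.
set A := \int[mu]_x (f x ^+ 2).
have A0 : 0 <= A by apply: Rintegral_ge0 => x _; exact: sqr_ge0.
have A1 : 0 < 2 * (A + 1) by rewrite mulr_gt0// ltr_wpDl.
(* Makes s A at most eta / 2, the [+ 1] allowing A = 0. The oscillation is then required to be below
   2 s eta, since (4 s)^-1 (2 s eta) is the other eta / 2. *)
pose s := eta / (2 * (A + 1)).
have s0 : 0 < s by rewrite divr_gt0.
have [_ vh] := vosc_L2 mh ih2.
have eta' : 0 < 2 * s * eta by rewrite mulr_gt0// mulr_gt0.
have [e0 e00 He] := vh _ eta'; exists e0 => // e /andP[e_gt0 ee0].
have [i1 E1] := ker2_diag e_gt0 (L2M_L1 f2 h2).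
have i2 := integrable_kernel (@measurable_ker2 R e) (ker2_bounded e) f1 h1.
rewrite -E1 -RintegralB//.
pose J (z : T * T) := ker2 e z * (f z.1 * h z.2) - ker2 e z * (f z.1 * h z.1).
have iJ : mumu.-integrable setT (EFin \o J).
  exact: (integrableB measurableT i2 i1).
rewrite -lee_fin EFin_normr_Rintegral//.
apply: (le_trans (le_abse_integral _ measurableT _)); first by have /integrableP[] := iJ.
have [i3 E3] := ker2_diag e_gt0 if2.
pose G (z : T * T) := s * (ker2 e z * f z.1 ^+ 2).
pose H (z : T * T) := (4 * s)^-1 * (ker2 e z * (h z.1 - h z.2) ^+ 2).
have G0 z : 0 <= G z.
  by apply: mulr_ge0; [exact: ltW|apply: mulr_ge0; [exact: ker2_ge0|exact: sqr_ge0]].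
have s4 : 0 < 4 * s by rewrite mulr_gt0.
have H0 z : 0 <= H z.
  apply: mulr_ge0; first by rewrite invr_ge0 ltW.
  by apply: mulr_ge0; [exact: ker2_ge0|exact: sqr_ge0].
have mG : measurable_fun setT (EFin \o G).
  by have /integrableP[] := integrableZl measurableT s i3.
have mH : measurable_fun setT (EFin \o H).
  have := measurable_osc e mh => /measurable_EFinP mo.
  by apply/measurable_EFinP; apply: measurable_funM.
apply: (@le_trans _ _ (\int[mumu]_z ((G z)%:E + (H z)%:E))%E).
  apply: ge0_le_integral => //.
  - by apply: measurableT_comp => //; have /integrableP[] := iJ.
  - exact: emeasurable_funD.
  move=> z _ /=; rewrite -EFinD lee_fin /J /G /H -mulrBr normrM.
  rewrite (ger0_norm (ker2_ge0 e z)) (mulrCA s) (mulrCA (4 * s)^-1) -mulrDr.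
  rewrite ler_wpM2l ?ker2_ge0// -mulrBr -[X in _ <= _ + _ * X]sqrrN opprB.
  exact: amgm_weighted.
rewrite ge0_integralD//; [|by move=> z _; rewrite lee_fin..].
have -> : (eta * mass e)%:E = ((eta / 2 * mass e)%:E + (eta / 2 * mass e)%:E)%E.
  by rewrite -EFinD; congr EFin; field.
apply: leeD.
  rewrite (integralZl measurableT i3) -[X in (_ * X <= _)%E]fineK; last first.
    exact: integrable_fin_num i3.
  rewrite -EFinM lee_fin -/(Rintegral _ _ _) [X in s * X]E3 -/A.
  rewrite mulrCA [leRHS]mulrC ler_wpM2l ?mass_ge0// /s.
  have -> : eta / 2 = eta / (2 * (A + 1)) * (A + 1) by field; rewrite gt_eqF// ltr_wpDl.
  by rewrite ler_pM2l// lerDl.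
rewrite /H; under eq_integral do rewrite EFinM.
rewrite ge0_integralZl//; last 3 first.
- exact: measurable_osc.
- by move=> z _; exact: osc_integrand_ge0.
- by rewrite lee_fin invr_ge0 ltW.
apply: (@le_trans _ _ ((4 * s)^-1%:E * (2 * s * eta * mass e)%:E)%E).
  by apply: lee_wpmul2l; [rewrite lee_fin invr_ge0 ltW|apply: He; rewrite e_gt0].
rewrite -EFinM lee_fin; have -> // : (4 * s)^-1 * (2 * s * eta * mass e) = eta / 2 * mass e.
by field; rewrite gt_eqF.
Qed.

End Pairing.

Lemma sum3_norm_le (R : realFieldType) (a b c x y z m eta : R) : 0 < m ->
  `|a - m * x| <= eta * m -> `|b - m * y| <= eta * m -> `|c - m * z| <= eta * m ->
  a + b + c = 0 -> `|x + y + z| <= 3 * eta.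
Proof.
move=> m0 ha hb hc abc; rewrite -(ler_pM2r m0) -{1}(gtr0_norm m0) -normrM.
move: ha hb hc; rewrite !ler_norml => /andP[? ?] /andP[? ?] /andP[? ?].
by apply/andP; split; lra.
Qed.

(** * Transfer of derivatives through the kernel *)

Section AbstractProductRule.
Variable R : realType.
Local Notation T := (measurableTypeR R * measurableTypeR R)%type.
Local Notation mu := (@lebesgue2 R).
Local Notation mumu := (mu \x mu)%E.
Implicit Types (e : R) (f g h b : T -> R).

Lemma L1_kernel_snd (K : T * T -> R) f h : measurable_fun setT K ->
  (exists C : R, forall z, `|K z| <= C) -> L1 f -> L1 h ->
  L1 (fun y => h y * \int[mu]_x (K (x, y) * f x)).
Proof.
move=> mK [C KC] f1 h1.
have mK' : measurable_fun setT (fun z : T * T => K (z.2, z.1)).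
  by apply: (measurableT_comp mK); exact: (measurable_fun_pair measurable_snd measurable_fst).
have bK' : exists C : R, forall z, `|(fun z : T * T => K (z.2, z.1)) z| <= C.
  by exists C => z; exact: KC.
apply: eq_integrable (integrable_fubini_F (integrable_kernel mK' bK' h1 f1)) => // y _.
rewrite /fubini_F /=.
have mKy : measurable_fun setT (fun x => K (x, y)).
  by apply: (measurableT_comp mK); exact: pair2_measurable.
have iK : L1 (fun x => K (x, y) * f x).
  have := L1M_bounded f1 mKy (ex_intro _ C (fun x => KC (x, y))).
  by apply: eq_integrable => // x _ /=; rewrite mulrC.
transitivity (\int[mu]_x ((h y)%:E * (K (x, y) * f x)%:E))%E.
  by apply: eq_integral => x _; rewrite -EFinM; congr EFin => /=; ring.
by rewrite integralZl// EFinM fineK//; apply: integrable_fin_num.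
Qed.

Definition dker1 e (z : T * T) : R := dkap e (z.1.1 - z.2.1) * kap e (z.1.2 - z.2.2).
Definition dker2 e (z : T * T) : R := kap e (z.1.1 - z.2.1) * dkap e (z.1.2 - z.2.2).

Lemma kap_norm e t : `|@kap R e t| <= 1.
Proof. by rewrite ger0_norm ?kap_ge0// kap_le1. Qed.

Lemma dker1_bounded e : 0 < e -> exists C : R, forall z, `|dker1 e z| <= C.
Proof.
move=> /dkap_bound[C HC]; exists C => z; rewrite normrM -[C]mulr1.
by apply: ler_pM => //; exact: kap_norm.
Qed.

Lemma dker2_bounded e : 0 < e -> exists C : R, forall z, `|dker2 e z| <= C.
Proof.
move=> /dkap_bound[C HC]; exists C => z; rewrite normrM -[C]mul1r.
by apply: ler_pM => //; exact: kap_norm.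
Qed.

Let measurable_diff (k : R -> R) (p : T -> measurableTypeR R) : continuous k ->
  measurable_fun setT p -> measurable_fun [set: T * T] (fun z => k (p z.1 - p z.2)).
Proof.
move=> /continuous_measurable_fun mk mp; apply: (measurableT_comp mk).
by apply: measurable_funB; apply: (measurableT_comp mp); [exact: measurable_fst|exact: measurable_snd].
Qed.

Lemma measurable_dker1 e : measurable_fun setT (dker1 e).
Proof.
apply: measurable_funM.
  exact: (measurable_diff (@continuous_dkap R e) measurable_fst).
exact: (measurable_diff (@continuous_kap R e) measurable_snd).
Qed.

Lemma measurable_dker2 e : measurable_fun setT (dker2 e).
Proof.
apply: measurable_funM.
  exact: (measurable_diff (@continuous_kap R e) measurable_fst).
exact: (measurable_diff (@continuous_dkap R e) measurable_snd).
Qed.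

(* [dker1] and [dker2] are the derivatives of [ker2] in its first argument, and
   the opposites of those in its second one: when the first identity is paired
   with [h0], the terms carrying derivatives of the kernel, singular as [e]
   vanishes, turn into terms in [h1] and [h2] without derivative. *)
Lemma doubling (D F1 F2 h0 h1 h2 : T -> R) (e0 : R) :
  L1 D -> L2 D -> L1 F1 -> L2 F1 -> L1 F2 -> L2 F2 ->
  L1 h0 -> L2 h0 -> L1 h1 -> L2 h1 -> L1 h2 -> L2 h2 -> 0 < e0 ->
  (forall e, 0 < e <= e0 -> forall y, h0 y != 0 ->
    \int[mu]_x (ker2 e (x, y) * D x) =
    - (\int[mu]_x (dker1 e (x, y) * F1 x) + \int[mu]_x (dker2 e (x, y) * F2 x))) ->
  (forall e, 0 < e -> forall x,
    \int[mu]_y (ker2 e (x, y) * h1 y) = \int[mu]_y (dker1 e (x, y) * h0 y)) ->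
  (forall e, 0 < e -> forall x,
    \int[mu]_y (ker2 e (x, y) * h2 y) = \int[mu]_y (dker2 e (x, y) * h0 y)) ->
  \int[mu]_x (D x * h0 x) + \int[mu]_x (F1 x * h1 x) + \int[mu]_x (F2 x * h2 x) = 0.
Proof.
move=> D1 D2 F11 F12 F21 F22 h01 h02 h11 h12 h21 h22 e00 HD H1 H2.
set Z := (X in X = 0).
have Zle (eta : R) : 0 < eta -> `|Z| <= 3 * eta.
  move=> eta0.
  have [ea ea0 Ha] := pairing D1 D2 h01 h02 eta0.
  have [eb eb0 Hb] := pairing F11 F12 h11 h12 eta0.
  have [ec ec0 Hc] := pairing F21 F22 h21 h22 eta0.
  pose e := Num.min (Num.min ea eb) (Num.min ec e0).
  have e_gt0 : 0 < e by rewrite !lt_min ea0 eb0 ec0.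
  have {}Ha := Ha e; have {}Hb := Hb e; have {}Hc := Hc e.
  have {}Ha := Ha ltac:(by rewrite e_gt0/= !ge_min lexx).
  have {}Hb := Hb ltac:(by rewrite e_gt0/= !ge_min lexx ?orbT).
  have {}Hc := Hc ltac:(by rewrite e_gt0/= !ge_min lexx ?orbT).
  have ee0 : 0 < e <= e0 by rewrite e_gt0/= !ge_min lexx ?orbT.
  have bk := @ker2_bounded R e; have mk := @measurable_ker2 R e.
  have b1 := dker1_bounded e_gt0; have m1 := measurable_dker1 e.
  have b2 := dker2_bounded e_gt0; have m2 := measurable_dker2 e.
  have S0 : \int[mumu]_z (ker2 e z * (D z.1 * h0 z.2)) +
      \int[mumu]_z (ker2 e z * (F1 z.1 * h1 z.2)) +
      \int[mumu]_z (ker2 e z * (F2 z.1 * h2 z.2)) = 0.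
    (* The last two terms are integrated in y first, where [H1] and [H2] replace [h1], [h2] by
       derivatives of the kernel against [h0]. With the order swapped back, all three terms carry
       the factor [h0 y], and [HD] cancels them at each [y]. *)
    rewrite (Rintegral_kernel21 mk bk D1 h01) (Rintegral_kernel12 mk bk F11 h11).
    rewrite (Rintegral_kernel12 mk bk F21 h21).
    under [X in _ + X + _]eq_Rintegral do rewrite (H1 _ e_gt0).
    under [X in _ + _ + X]eq_Rintegral do rewrite (H2 _ e_gt0).
    rewrite -(Rintegral_kernel12 m1 b1 F11 h01) -(Rintegral_kernel12 m2 b2 F21 h01).
    rewrite (Rintegral_kernel21 m1 b1 F11 h01) (Rintegral_kernel21 m2 b2 F21 h01).
    rewrite -addrA -RintegralD//; [|exact: L1_kernel_snd..].
    rewrite -RintegralD//; last 2 first.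
    - exact: L1_kernel_snd.
    - by apply: L1D; exact: L1_kernel_snd.
    under eq_Rintegral => y _.
      rewrite (_ : _ + _ = 0); first over.
      have [->|h0y] := eqVneq (h0 y) 0; first by rewrite !mul0r !addr0.
      by rewrite (HD _ ee0)//; ring.
    by rewrite Rintegral_cst//= mul0r.
  exact: sum3_norm_le (mass_gt0 e_gt0) Ha Hb Hc S0.
apply/eqP/negPn/negP => Z0.
have := Zle (`|Z| / 6); rewrite divr_gt0 ?normr_gt0// => /(_ isT).
have : 0 < `|Z| by rewrite normr_gt0.
by move: `|Z|; clear; move=> t; lra.
Qed.

End AbstractProductRule.

(** * Test functions, and kernels as test functions *)

Section TestFunctions.
Variable R : realType.
Implicit Types (e : R) (f phi psi : R * R -> R) (K O : set (R * R)).

Lemma grad_near f g (x : R * R) : (\near x, f x = g x) -> grad f x = grad g x.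
Proof. by move=> fg; rewrite /grad (near_eq_derive _ fg) (near_eq_derive _ fg). Qed.

Lemma grad_cst (a : R) (x : R * R) : grad (cst a) x = 0.
Proof. by rewrite (is_gradE (is_grad_cst a)). Qed.

Lemma grad_open_eq0 O f x : open O -> O x -> (forall y, O y -> f y = 0) ->
  grad f x = 0.
Proof.
move=> oO Ox f0; rewrite -(grad_cst 0 x); apply: grad_near.
by apply: filterS (open_nbhs_nbhs (conj oO Ox)) => y /f0.
Qed.

Lemma grad_outside K f x : compact K -> (forall y, ~ K y -> f y = 0) -> ~ K x ->
  grad f x = 0.
Proof.
move=> cK f0 Kx; apply: (@grad_open_eq0 (~` K)) => //.
apply: closed_openC; apply: compact_closed cK; exact: norm_hausdorff.
Qed.

Lemma compact_support_bounded K f : compact K -> continuous f ->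
  (forall y, ~ K y -> f y = 0) -> exists C : R, forall x, `|f x| <= C.
Proof.
move=> cK cf f0.
have [M [_ HM]] := compact_bounded (continuous_compact (continuous_subspaceT cf) cK).
exists (`|M| + 1) => x; have [Kx|Kx] := pselect (K x).
  by apply: (HM (`|M| + 1)); [rewrite ltr_pwDr// ler_norm|exists x].
by rewrite f0// normr0 addr_ge0.
Qed.

Lemma test_C1 O phi : test_function O phi -> C1 phi.
Proof. by move=> []. Qed.

Lemma continuous_grad1 phi : C1 phi -> continuous (fun x => (grad phi x).1).
Proof.
move=> [_ cg] x; apply: (@continuous_comp _ _ _ (grad phi) fst); first exact: cg.
exact: cvg_fst.
Qed.

Lemma continuous_grad2 phi : C1 phi -> continuous (fun x => (grad phi x).2).
Proof.
move=> [_ cg] x; apply: (@continuous_comp _ _ _ (grad phi) snd); first exact: cg.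
exact: cvg_snd.
Qed.

Lemma test_bounded O phi : test_function O phi ->
  [/\ exists C : R, forall x, `|phi x| <= C,
      exists C : R, forall x, `|(grad phi x).1| <= C &
      exists C : R, forall x, `|(grad phi x).2| <= C].
Proof.
move=> tphi; have Cphi := test_C1 tphi; have [_ _ [K [cK KO phi0]]] := tphi.
split; apply: (compact_support_bounded cK).
- exact: C1_continuous.
- exact: phi0.
- exact: continuous_grad1.
- by move=> y Ky; rewrite (grad_outside cK phi0 Ky).
- exact: continuous_grad2.
- by move=> y Ky; rewrite (grad_outside cK phi0 Ky).
Qed.

Lemma test_function_of_C1 O K phi : C1 phi -> compact K -> K `<=` O ->
  (forall x, ~ K x -> phi x = 0) -> test_function O phi.
Proof. by move=> [dphi cphi] cK KO phi0; split => //; exists K. Qed.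

Lemma test_functionM O f phi : C1 f -> test_function O phi ->
  test_function O (f \* phi).
Proof.
move=> Cf tphi; have [_ _ [K [cK KO phi0]]] := tphi.
apply: (test_function_of_C1 (C1M Cf (test_C1 tphi)) cK KO) => x Kx /=.
by rewrite phi0// mulr0.
Qed.

Definition box (p : R * R) e : set (R * R) :=
  `[p.1 - e, p.1 + e]%classic `*` `[p.2 - e, p.2 + e]%classic.

Lemma boxP (p x : R * R) e : box p e x <-> `|x.1 - p.1| <= e /\ `|x.2 - p.2| <= e.
Proof.
rewrite /box /= !in_itv/= !ler_norml; split => -[/andP[? ?] /andP[? ?]];
  by split; apply/andP; split; lra.
Qed.

Lemma compact_box (p : R * R) e : compact (box p e).
Proof. by apply: compact_setX; exact: segment_compact. Qed.

Lemma box_sub_ball (p : R * R) e e' : e < e' -> box p e `<=` ball p e'.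
Proof.
move=> ee' x /boxP[x1 x2]; split; rewrite /= /ball/= distrC.
  exact: le_lt_trans ee'.
exact: le_lt_trans ee'.
Qed.

Lemma is_grad_ker2 e (y : R * R) :
  is_grad (fun x => ker2 e (x, y)) (fun x => (dker1 e (x, y), dker2 e (x, y))).
Proof.
have g1 := is_grad_comp (is_derive_kap e) (is_grad_dot ((1, 0) : R * R) y).
have g2 := is_grad_comp (is_derive_kap e) (is_grad_dot ((0, 1) : R * R) y).
have := is_gradM g1 g2; congr is_grad; apply/funext => x.
  by rewrite /= /ker2 /dot /= !mulr1 !mulr0 addr0 add0r.
have d1 : dot (x - y) (1, 0) = x.1 - y.1 by rewrite /dot mulr1 mulr0 addr0.
have d2 : dot (x - y) (0, 1) = x.2 - y.2 by rewrite /dot mulr1 mulr0 add0r.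
rewrite /= d1 d2 /dker1 /dker2/=; set a := kap e _; set b := dkap e _.
set c := kap e _; set d := dkap e _.
transitivity (a * (b * 0) + c * (d * 1), a * (b * 1) + c * (d * 0)); first by [].
by rewrite !mulr0 !mulr1 addr0 add0r mulrC.
Qed.

Lemma C1_ker2 e (y : R * R) : C1 (fun x => ker2 e (x, y)).
Proof.
apply: (C1_grad (is_grad_ker2 e y)) => x.
have c (k : R -> R) (p : R * R -> R) : continuous k -> continuous p ->
    continuous (fun x => k (p x - p y)).
  move=> ck cp z; apply: (@continuous_comp _ _ _ (fun x => p x - p y) k); last exact: ck.
  by apply: cvgB; [exact: cp|exact: cvg_cst].
have cf : continuous (fst : R * R -> R) by move=> z; exact: cvg_fst.
have cs : continuous (snd : R * R -> R) by move=> z; exact: cvg_snd.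
have A : continuous (fun x => dker1 e (x, y)).
  by move=> z; apply: cvgM; [exact: c (@continuous_dkap R e) cf z|exact: c (@continuous_kap R e) cs z].
have B : continuous (fun x => dker2 e (x, y)).
  by move=> z; apply: cvgM; [exact: c (@continuous_kap R e) cf z|exact: c (@continuous_dkap R e) cs z].
exact: (cvg_pair (A x) (B x)).
Qed.

Lemma ker2_eq0 e (x y : R * R) : 0 < e -> ~ box y e x -> ker2 e (x, y) = 0.
Proof.
move=> e0 bx; apply/eqP; rewrite mulf_eq0 /=.
have [x1|x1] := leP e `|x.1 - y.1|; first by rewrite kap_eq0// eqxx.
have [x2|x2] := leP e `|x.2 - y.2|; first by rewrite (kap_eq0 _ x2)// eqxx orbT.
by exfalso; apply: bx; apply/boxP; split; exact: ltW.
Qed.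

Lemma test_ker2 O e (y : R * R) : 0 < e -> box y e `<=` O ->
  test_function O (fun x => ker2 e (x, y)).
Proof.
move=> e0 bO; apply: (test_function_of_C1 (C1_ker2 e y) (@compact_box y e) bO) => x bx.
exact: ker2_eq0.
Qed.

(** One radius for the whole of [K]: kernels of this size centred anywhere in the support of a test
    function are again test functions. *)
Lemma compact_inner_radius K O : compact K -> open O -> K `<=` O ->
  exists2 e0 : R, 0 < e0 & forall e, 0 < e <= e0 -> forall y, K y -> box y e `<=` O.
Proof.
move=> /compact_near_coveringP cK oO KO.
have : \forall e \near (0 : R)^'+, K `<=` (fun y => 0 < e -> box y e `<=` O).
  apply: cK => x Kx.
  have /nbhs_ballP[d /= d0 xdO] := open_nbhs_nbhs (conj oO (KO _ Kx)).
  exists (ball x (d / 2), [set e : R | e < d / 2]) => /=.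
    split; first by apply: nbhsx_ballx; rewrite divr_gt0.
    by apply: nbhs_right_lt; rewrite divr_gt0.
  move=> [y e] /= [xy ed] e0 z yz; apply: xdO; rewrite [d]splitr.
  exact: ball_triangle xy (box_sub_ball ed yz).
move=> [e1 /= e10 He1]; exists (e1 / 2); first by rewrite divr_gt0.
move=> e /andP[e0 ee1] y Ky; apply: He1 => //=.
rewrite sub0r normrN gtr0_norm//; apply: le_lt_trans ee1 _.
by rewrite ltr_pdivrMr// mulr_natr mulr2n ltrDr.
Qed.

End TestFunctions.

(** * Product rule for weak derivatives inside the domain *)

Section ProductRule.
Variable R : realType.
Local Notation T := (measurableTypeR R * measurableTypeR R)%type.
Local Notation mu := (@lebesgue2 R).
Local Notation mumu := (mu \x mu)%E.
Variable Omega : set (R * R).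
Hypotheses (oO : open Omega) (bO : bounded_set Omega).
Implicit Types (e : R) (f g h b : R * R -> R).

Lemma measurable_domain : measurable (Omega : set T).
Proof. exact: open_measurable_plane. Qed.

Lemma domain_sub_cube : exists M : R, Omega `<=` cube M.
Proof.
have [M [_ HM]] := bO; exists (`|M| + 2) => x Ox.
have xM : `|x| <= `|M| + 1 by apply: HM => //; rewrite ltr_pwDr// ler_norm.
have [x1 x2] : `|x.1| <= `|M| + 1 /\ `|x.2| <= `|M| + 1.
  by move: xM; rewrite prod_normE/= ge_max => /andP.
split; rewrite /= /ball/= sub0r normrN; [apply: le_lt_trans x1 _|apply: le_lt_trans x2 _];
  by rewrite ltrD2l ltr1n.
Qed.

Lemma domain_fin : (mu Omega < +oo)%E.
Proof.
have [M OM] := domain_sub_cube; apply: le_lt_trans (cube_fin M).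
by apply: le_measure; rewrite ?inE//; [exact: measurable_domain|exact: measurable_cube].
Qed.

Lemma square_integrableE f : square_integrable Omega f <->
  measurable_fun (Omega : set T) f /\ mu.-integrable Omega (EFin \o (fun x => f x ^+ 2)).
Proof. by []. Qed.

Lemma zextE f x : (f \_ Omega) x = if x \in Omega then f x else 0.
Proof. by []. Qed.

Lemma zextM f b : (fun x => f x * b x) \_ Omega = fun x => (f \_ Omega) x * b x.
Proof. by apply/funext => x; rewrite !zextE; case: ifP => // _; rewrite mul0r. Qed.

Lemma zextMM f b : (fun x => f x * b x) \_ Omega = fun x => (f \_ Omega) x * (b \_ Omega) x.
Proof. by apply/funext => x; rewrite !zextE; case: ifP => // _; rewrite mul0r. Qed.

Lemma zextD f b : (fun x => f x + b x) \_ Omega = fun x => (f \_ Omega) x + (b \_ Omega) x.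
Proof. by apply/funext => x; rewrite !zextE; case: ifP => // _; rewrite addr0. Qed.

(** Extension by zero moves the integrals to the whole plane, where the kernel lemmas are stated. *)
Lemma integrable_zext f : mu.-integrable Omega (EFin \o f) -> L1 (f \_ Omega).
Proof.
move=> /(integrable_mkcond _ measurable_domain).
by rewrite restrict_EFin.
Qed.

Lemma square_integrable_L2 f : square_integrable Omega f -> L2 (f \_ Omega).
Proof.
move=> /square_integrableE[mf if2]; split.
  by apply/(measurable_restrict _ measurable_domain measurableT); rewrite setTI.
have := integrable_zext if2; congr (L1 _); apply/funext => x.
by rewrite !zextE; case: ifP => // _; rewrite expr0n.
Qed.

Lemma square_integrable_integrable f : square_integrable Omega f ->
  mu.-integrable Omega (EFin \o f).
Proof.
move=> /square_integrableE[mf if2].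
have i1 := integrable_fin_cst 1 measurable_domain domain_fin.
apply: (le_integrable measurable_domain _ _ (integrableD measurable_domain i1 if2)).
  exact/measurable_EFinP.
move=> x _; change (`|f x|%:E <= `|(1 + f x ^+ 2)%R|%:E)%E.
rewrite lee_fin [leRHS]ger0_norm; last by rewrite addr_ge0// sqr_ge0.
rewrite ler_norml; have := sqr_ge0 (f x - 1); have := sqr_ge0 (f x + 1) => ? ?.
by apply/andP; split; nra.
Qed.

Lemma square_integrable_L1 f : square_integrable Omega f -> L1 (f \_ Omega).
Proof. by move=> /square_integrable_integrable/integrable_zext. Qed.

Lemma square_integrableM f g : square_integrable Omega f -> square_integrable Omega g ->
  mu.-integrable Omega (EFin \o (fun x => f x * g x)).
Proof.
move=> /square_integrable_L2 f2 /square_integrable_L2 g2.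
apply/(integrable_mkcond _ measurable_domain); rewrite restrict_EFin zextMM.
exact: L2M_L1.
Qed.

Lemma Rintegral_zext f : \int[mu]_(x in Omega) f x = \int[mu]_x (f \_ Omega) x.
Proof. exact: Rintegral_mkcond. Qed.

Lemma test_mul (f : T -> R) phi : test_function Omega phi -> L1 f ->
  [/\ L1 (fun x => f x * phi x), L1 (fun x => f x * (grad phi x).1) &
      L1 (fun x => f x * (grad phi x).2)].
Proof.
move=> tphi f1; have [b0 b1 b2] := test_bounded tphi; have Cphi := test_C1 tphi.
split.
- exact: (L1M_bounded f1 (continuous_measurable_plane (C1_continuous Cphi)) b0).
- exact: (L1M_bounded f1 (continuous_measurable_plane (continuous_grad1 Cphi)) b1).
- exact: (L1M_bounded f1 (continuous_measurable_plane (continuous_grad2 Cphi)) b2).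
Qed.

Section Test.
Variable psi : R * R -> R.
Hypothesis tpsi : test_function Omega psi.

Let Cpsi : C1 psi. Proof. exact: test_C1 tpsi. Qed.

Let mpsi : measurable_fun [set: T] psi.
Proof. by apply: continuous_measurable_plane; exact: C1_continuous. Qed.

Let mpsi1 : measurable_fun [set: T] (fun x => (grad psi x).1).
Proof. by apply: continuous_measurable_plane; exact: continuous_grad1. Qed.

Let mpsi2 : measurable_fun [set: T] (fun x => (grad psi x).2).
Proof. by apply: continuous_measurable_plane; exact: continuous_grad2. Qed.

(** The support of [psi] is enough for compactness, so this holds for every [x], even outside the
    domain, and at every scale. Hence the second factor needs no smallness of [e], unlike the
    first. *)
Let sec_test e (x : R * R) : test_function Omega (fun y => ker2 e (x, y) * psi y).
Proof.
have -> : (fun y => ker2 e (x, y) * psi y) = (fun y => ker2 e (y, x)) \* psi.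
  by apply/funext => y; rewrite ker2C.
by apply: test_functionM => //; exact: C1_ker2.
Qed.

Let grad_sec e (x y : R * R) : grad (fun y => ker2 e (x, y) * psi y) y =
  ker2 e (x, y) *: grad psi y - psi y *: (dker1 e (x, y), dker2 e (x, y)).
Proof.
have -> : (fun y => ker2 e (x, y) * psi y) = (fun y => ker2 e (y, x)) \* psi.
  by apply/funext => z; rewrite ker2C.
rewrite gradM//; last exact: C1_ker2.
rewrite (is_gradE (is_grad_ker2 e x)) ker2C -scalerN; congr (_ + _ *: _).
rewrite /dker1 /dker2 /=.
transitivity (- (dkap e (x.1 - y.1) * kap e (x.2 - y.2)), - (kap e (x.1 - y.1) * dkap e (x.2 - y.2))); last by [].
rewrite -(opprB x.1) -(opprB x.2) !kapN !dkapN.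
by rewrite mulNr mulrN.
Qed.

(** [doubling] with [F1 := f], [h1 := f psi] and zero elsewhere: the kernel times [psi] is a test
    function, so the pairings vanish at every scale, and so does their limit. *)
Lemma Rintegral_sqr_test_eq0 (f : R * R -> R) : square_integrable Omega f ->
  (forall phi, test_function Omega phi -> \int[mu]_(x in Omega) (f x * phi x) = 0) ->
  \int[mu]_(x in Omega) (f x ^+ 2 * psi x) = 0.
Proof.
move=> sf f0; have f1 := square_integrable_L1 sf; have f2 := square_integrable_L2 sf.
have [bpsi _ _] := test_bounded tpsi.
have h1 := L1M_bounded f1 mpsi bpsi; have h2 := L2M_bounded f2 mpsi bpsi.
have L10 : L1 (fun _ : T => 0 : R) by exact: integrable0.
have L20 : L2 (fun _ : T => 0 : R).
  split; first exact: measurable_cst.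
  by apply: eq_integrable L10 => // x _ /=; rewrite expr0n.
have E e x : \int[mu]_y (ker2 e (x, y) * ((f \_ Omega) y * psi y)) = 0.
  rewrite -(f0 _ (sec_test e x)) Rintegral_zext; apply: eq_Rintegral => y _.
  by rewrite zextM; ring.
have z k x : \int[mu]_y (k (x, y) * 0 : R) = 0.
  by under eq_Rintegral do rewrite mulr0; rewrite Rintegral_cst//= mul0r.
have := @doubling R (fun=> 0) (f \_ Omega) (fun=> 0) (fun=> 0)
  (fun y => (f \_ Omega) y * psi y) (fun=> 0) 1 L10 L20 f1 f2 L10 L20 L10 L20 h1 h2 L10 L20
  ltr01.
have H0 (e : R) : 0 < e <= 1 -> forall y : T, (0 : R) != 0 -> 
    \int[mu]_x (ker2 e (x, y) * 0) =
  - (\int[mu]_x (dker1 e (x, y) * (f \_ Omega) x) + \int[mu]_x (dker2 e (x, y) * 0)).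
  by move=> _ y; rewrite eqxx.
move=> /(_ H0).
have H1 (e : R) : 0 < e -> forall x : T, 
   \int[mu]_y (ker2 e (x, y) * ((f \_ Omega) y * psi y)) = \int[mu]_y (dker1 e (x, y) * 0).
  by move=> _ x; rewrite E z.
have H2 (e : R) : 0 < e -> forall x : T, 
   \int[mu]_y (ker2 e (x, y) * 0) = \int[mu]_y (dker2 e (x, y) * 0 : R).
  by move=> _ x; rewrite !z.
move=> /(_ H1 H2).
have z' : \int[mu]_x ((0 : R) * 0) = 0.
  by under eq_Rintegral do rewrite mulr0; rewrite Rintegral_cst//= mul0r.
rewrite z' add0r addr0 => <-.
rewrite Rintegral_zext; apply: eq_Rintegral => y _; rewrite zextM !zextE.
by case: ifP => _; rewrite ?mul0r// expr2 mulrA.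
Qed.

(** [doubling] with [h0 := u psi] and its weak partial derivatives [h1], [h2]. Where [h0] is nonzero
    the point lies in the support of [psi], so that for small [e] the kernel centred there may be
    tested against (F1, F2). *)
Lemma product_rule (F1 F2 d u g1 g2 : R * R -> R) :
  square_integrable Omega F1 -> square_integrable Omega F2 ->
  square_integrable Omega d -> square_integrable Omega u ->
  square_integrable Omega g1 -> square_integrable Omega g2 ->
  (forall phi, test_function Omega phi ->
    \int[mu]_(x in Omega) (F1 x * (grad phi x).1 + F2 x * (grad phi x).2) =
    - \int[mu]_(x in Omega) (d x * phi x)) ->
  (forall phi, test_function Omega phi ->
    \int[mu]_(x in Omega) (u x * (grad phi x).1) =
    - \int[mu]_(x in Omega) (g1 x * phi x)) ->
  (forall phi, test_function Omega phi ->
    \int[mu]_(x in Omega) (u x * (grad phi x).2) =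
    - \int[mu]_(x in Omega) (g2 x * phi x)) ->
  \int[mu]_(x in Omega) ((d x * u x + F1 x * g1 x + F2 x * g2 x) * psi x +
    u x * F1 x * (grad psi x).1 + u x * F2 x * (grad psi x).2) = 0.
Proof.
move=> sF1 sF2 sd su sg1 sg2 HF Hu1 Hu2.
have [bpsi b1 b2] := test_bounded tpsi.
have F11 := square_integrable_L1 sF1; have F12 := square_integrable_L2 sF1.
have F21 := square_integrable_L1 sF2; have F22 := square_integrable_L2 sF2.
have d1 := square_integrable_L1 sd; have d2 := square_integrable_L2 sd.
have u1 := square_integrable_L1 su; have u2 := square_integrable_L2 su.
have g11 := square_integrable_L1 sg1; have g12 := square_integrable_L2 sg1.
have g21 := square_integrable_L1 sg2; have g22 := square_integrable_L2 sg2.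
pose U := u \_ Omega.
pose h0 x := U x * psi x.
pose h1 x := U x * (grad psi x).1 + (g1 \_ Omega) x * psi x.
pose h2 x := U x * (grad psi x).2 + (g2 \_ Omega) x * psi x.
have h01 : L1 h0 := L1M_bounded u1 mpsi bpsi.
have h02 : L2 h0 := L2M_bounded u2 mpsi bpsi.
have h11 : L1 h1 := L1D (L1M_bounded u1 mpsi1 b1) (L1M_bounded g11 mpsi bpsi).
have h12 : L2 h1 := L2D (L2M_bounded u2 mpsi1 b1) (L2M_bounded g12 mpsi bpsi).
have h21 : L1 h2 := L1D (L1M_bounded u1 mpsi2 b2) (L1M_bounded g21 mpsi bpsi).
have h22 : L2 h2 := L2D (L2M_bounded u2 mpsi2 b2) (L2M_bounded g22 mpsi bpsi).
have [_ _ [K [cK KO psi0]]] := tpsi.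
have [e0 e00 He0] := compact_inner_radius cK oO KO.
have msec (k : T * T -> R) x : measurable_fun setT k -> measurable_fun setT (fun y => k (x, y)).
  by move=> mk; apply: (measurableT_comp mk); exact: pair1_measurable.
have msec' (k : T * T -> R) y : measurable_fun setT k -> measurable_fun setT (fun x => k (x, y)).
  by move=> mk; apply: (measurableT_comp mk); exact: pair2_measurable.
have bsec (k : T * T -> R) x : (exists C : R, forall z, `|k z| <= C) ->
    exists C : R, forall y, `|k (x, y)| <= C.
  by move=> [C kC]; exists C => y; exact: kC.
have bsec' (k : T * T -> R) y : (exists C : R, forall z, `|k z| <= C) ->
    exists C : R, forall x, `|k (x, y)| <= C.
  by move=> [C kC]; exists C => x; exact: kC.
have L1k (k : T -> R) f : measurable_fun setT k -> (exists C : R, forall z, `|k z| <= C) ->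
    L1 f -> L1 (fun x => k x * f x).
  move=> mk bk Lf; have := L1M_bounded Lf mk bk.
  by apply: eq_integrable => // x _ /=; rewrite mulrC.
have HD e : 0 < e <= e0 -> forall y, h0 y != 0 ->
    \int[mu]_x (ker2 e (x, y) * (d \_ Omega) x) =
    - (\int[mu]_x (dker1 e (x, y) * (F1 \_ Omega) x) +
       \int[mu]_x (dker2 e (x, y) * (F2 \_ Omega) x)).
  move=> ee0 y h0y; have e_gt0 : 0 < e by case/andP: ee0.
  have Ky : K y.
    by apply: contrapT => /psi0 py; move: h0y; rewrite /h0 py mulr0 eqxx.
  have := HF _ (test_ker2 e_gt0 (He0 _ ee0 _ Ky)).
  rewrite (is_gradE (is_grad_ker2 e y)) !Rintegral_zext /= => H.
  rewrite -[LHS]opprK; congr (- _).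
  rewrite -RintegralD//; last 2 first.
  - exact: (L1k _ _ (msec' _ y (measurable_dker1 e)) (bsec' _ y (dker1_bounded e_gt0)) F11).
  - exact: (L1k _ _ (msec' _ y (measurable_dker2 e)) (bsec' _ y (dker2_bounded e_gt0)) F21).
  transitivity (- \int[mu]_x ((fun x => d x * ker2 e (x, y)) \_ Omega) x).
    by congr (- _); apply: eq_Rintegral => x _; rewrite zextM mulrC.
  rewrite -H; apply: eq_Rintegral => x _; rewrite zextD !zextM.
  by rewrite mulrC [_ * dker2 _ _]mulrC.
(* One argument for both coordinates: [j] will be [fst] or [snd], and [dk] the matching derivative
   of the kernel. *)
have Hsec (j : R * R -> R) (g : R * R -> R) (dk : R -> T * T -> R) : L1 (g \_ Omega) ->
    (forall phi, test_function Omega phi -> L1 (fun y => U y * j (grad phi y))) ->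
    (forall e x y, j (grad (fun y => ker2 e (x, y) * psi y) y) =
       ker2 e (x, y) * j (grad psi y) - psi y * dk e (x, y)) ->
    (forall phi, test_function Omega phi ->
      \int[mu]_(x in Omega) (u x * j (grad phi x)) = - \int[mu]_(x in Omega) (g x * phi x)) ->
    (forall e, measurable_fun setT (dk e)) ->
    (forall e, 0 < e -> exists C : R, forall z, `|dk e z| <= C) ->
    L1 (fun y => U y * j (grad psi y) + (g \_ Omega) y * psi y) ->
    forall e, 0 < e -> forall x,
    \int[mu]_y (ker2 e (x, y) * (U y * j (grad psi y) + (g \_ Omega) y * psi y)) =
    \int[mu]_y (dk e (x, y) * h0 y).
  move=> Lg LUj jE Hu mdk bdk Lh e e_gt0 x.
  apply/eqP; rewrite -subr_eq0 -RintegralB//; last 2 first.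
  - exact: (L1k _ _ (msec _ x (measurable_ker2 e)) (bsec _ x (ker2_bounded e)) Lh).
  - exact: (L1k _ _ (msec _ x (mdk e)) (bsec _ x (bdk e e_gt0)) h01).
  have ts := sec_test e x.
  have := Hu _ ts; rewrite !Rintegral_zext !zextM => /eqP.
  have [Lgs _ _] := test_mul ts Lg.
  rewrite -addr_eq0 -RintegralD//; last exact: LUj.
  by congr (_ == 0); apply: eq_Rintegral => y _; rewrite jE /h0 -/(U y); ring.
have LU1 phi (tphi : test_function Omega phi) := let: And3 _ H _ := test_mul tphi u1 in H.
have LU2 phi (tphi : test_function Omega phi) := let: And3 _ _ H := test_mul tphi u1 in H.
have grad1E e x y : (grad (fun y => ker2 e (x, y) * psi y) y).1 =
    ker2 e (x, y) * (grad psi y).1 - psi y * dker1 e (x, y) by rewrite grad_sec.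
have grad2E e x y : (grad (fun y => ker2 e (x, y) * psi y) y).2 =
    ker2 e (x, y) * (grad psi y).2 - psi y * dker2 e (x, y) by rewrite grad_sec.
have H1 := Hsec fst g1 (@dker1 R) g11 LU1 grad1E Hu1 (@measurable_dker1 R) (@dker1_bounded R) h11.
have H2 := Hsec snd g2 (@dker2 R) g21 LU2 grad2E Hu2 (@measurable_dker2 R) (@dker2_bounded R) h21.
have := doubling d1 d2 F11 F12 F21 F22 h01 h02 h11 h12 h21 h22 e00 HD H1 H2.
rewrite -RintegralD//; last 2 first.
- exact: L2M_L1.
- exact: L2M_L1.
rewrite -RintegralD//; last 2 first.
- by apply: L1D; exact: L2M_L1.
- exact: L2M_L1.
move=> <-; rewrite Rintegral_zext; apply: eq_Rintegral => x _.
rewrite /h0 /h1 /h2 /U !zextE; case: ifP => _; last by rewrite !mul0r !addr0.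
ring.
Qed.

End Test.
End ProductRule.

(** * The fundamental lemma of the calculus of variations *)

Section DuBoisReymond.
Variable R : realType.
Local Notation T := (measurableTypeR R * measurableTypeR R)%type.
Local Notation mu := (@lebesgue2 R).
Variable Omega : set (R * R).
Hypotheses (oO : open Omega) (bO : bounded_set Omega).

Lemma kap_gt0 (e t : R) : 0 < e -> `|t| < e -> 0 < kap e t.
Proof.
move=> e0 te; have te1 : `|t / e| < 1 by rewrite normrM normfV (gtr0_norm e0) ltr_pdivrMr// mul1r.
have te2 : (t / e) ^+ 2 < 1 by rewrite -real_normK ?num_real// exprn_ilt1.
rewrite /kap sqpos_ge0; last by rewrite subr_ge0 ltW.
by rewrite exprn_gt0// subr_gt0.
Qed.

Lemma ker2_gt0 (e : R) (x y : R * R) : 0 < e -> ball y e x -> 0 < ker2 e (x, y).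
Proof.
move=> e0 [x1 x2]; apply: mulr_gt0; apply: kap_gt0 => //=.
  by move: x1; rewrite /ball/= distrC.
by move: x2; rewrite /ball/= distrC.
Qed.

(** Testing f^2 with a kernel that is positive on a ball shows that [f] vanishes almost everywhere
    there; countably many rational balls exhaust the domain. *)
Lemma du_bois_reymond (f : R * R -> R) : square_integrable Omega f ->
  (forall phi, test_function Omega phi -> \int[mu]_(x in Omega) (f x * phi x) = 0) ->
  {ae mu, forall x, Omega x -> f x = 0}.
Proof.
move=> sf f0; have [mf if2] := (square_integrableE Omega f).1 sf.
have mO := measurable_domain oO.
pose B (q : rat * rat * rat) : set T :=
  let c : R * R := (ratr q.1.1, ratr q.1.2) in let r : R := ratr q.2 in
  [set x | [/\ 0 < r, ball c (r + r) `<=` Omega, ball c r x & f x != 0]].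
have negB q : mu.-negligible (B q).
  have [r0|r0] := ltP 0 (ratr q.2 : R); last first.
    rewrite (_ : B q = set0); first exact: negligible_set0.
    by apply/seteqP; split => // x [/lt_le_trans /(_ r0)]; rewrite ltxx.
  set c : R * R := (ratr q.1.1, ratr q.1.2); set r : R := ratr q.2.
  have [cO|cO] := pselect (ball c (r + r) `<=` Omega); last first.
    rewrite (_ : B q = set0); first exact: negligible_set0.
    by apply/seteqP; split => // x [_ /cO].
  have tpsi : test_function Omega (fun x => ker2 r (x, c)).
    apply: test_ker2 => //; apply: subset_trans cO; apply: box_sub_ball.
    by rewrite ltrDl.
  have [bpsi _ _] := test_bounded tpsi.
  have mpsi : measurable_fun (Omega : set T) (fun x => ker2 r (x, c)).
    apply: measurable_funTS; apply: continuous_measurable_plane.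
    exact: C1_continuous (test_C1 tpsi).
  have ig : mu.-integrable Omega (EFin \o (fun x => f x ^+ 2 * ker2 r (x, c))).
    apply: integrableM_bounded => //; have [C HC] := bpsi.
    by exists C => x _; exact: HC.
  have int0 : (\int[mu]_(x in Omega) (f x ^+ 2 * ker2 r (x, c))%:E = 0)%E.
    rewrite -[LHS]fineK; last by apply: integrable_fin_num ig.
    by congr EFin; exact: Rintegral_sqr_test_eq0 oO bO _ tpsi _ sf f0.
  have /(ae_eq_integral_abs mu mO) : measurable_fun (Omega : set T)
      (EFin \o (fun x => f x ^+ 2 * ker2 r (x, c))) by have /integrableP[] := ig.
  move=> [+ _].
  have -> : (\int[mu]_(x in Omega) `|(EFin \o (fun x => (f x ^+ 2 * ker2 r (x, c))%R)) x| =
      \int[mu]_(x in Omega) (f x ^+ 2 * ker2 r (x, c))%:E)%E.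
    by apply: eq_integral => x _ /=; rewrite ger0_norm// mulr_ge0 ?sqr_ge0 ?ker2_ge0.
  move=> /(_ int0); apply: negligibleS => x [_ _ xr fx] /= H.
  have Ox : Omega x by apply: cO; apply: le_ball xr; rewrite lerDl ltW.
  have := H Ox => -[] /eqP; rewrite mulf_eq0 sqrf_eq0 (negbTE fx)/=.
  by rewrite gt_eqF// ker2_gt0.
pose F n := if unpickle n is Some q then B q else set0.
have negF : mu.-negligible (\bigcup_n F n).
  apply: negligible_bigcup => n; rewrite /F; case: unpickle => [q|]; first exact: negB.
  exact: negligible_set0.
apply: negligibleS negF => x /= /not_implyP[Ox /eqP fx].
have [q [r0 qO qx]] := rat_box oO Ox; exists (pickle q); first exact: I.
by rewrite /F pickleK; split.
Qed.

End DuBoisReymond.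

(** * Domains with Lipschitz boundary *)

Section Frames.
Variable R : realType.
Implicit Types (e p x y : R * R).

Lemma dotBl x y e : dot (x - y) e = dot x e - dot y e.
Proof. by rewrite dotDl dotNl. Qed.

Lemma is_unit_coord e : is_unit e -> `|e.1| <= 1 /\ `|e.2| <= 1.
Proof.
rewrite /is_unit /dot => eu; rewrite !ler_norml.
by split; apply/andP; split; nra.
Qed.

Lemma is_unit_rot90 e : is_unit e -> is_unit (rot90 e).
Proof. by rewrite /is_unit /dot /rot90 /= mulrNN addrC. Qed.

Lemma dot_rot90 e : dot (rot90 e) e = 0.
Proof. by rewrite /dot /rot90 /= mulNr mulrC addNr. Qed.

Lemma prod_norm_ge x : `|x.1| <= `|x| /\ `|x.2| <= `|x|.
Proof. by rewrite prod_normE/= !le_max !lexx orbT. Qed.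

Lemma dot_norm_le e x : is_unit e -> `|dot x e| <= 2 * `|x|.
Proof.
move=> /is_unit_coord[e1 e2]; have [x1 x2] := prod_norm_ge x.
rewrite /dot mulr_natl mulr2n; apply: le_trans (ler_normD _ _) _.
by apply: lerD; rewrite normrM -[leRHS]mulr1 ler_pM.
Qed.

Lemma frame_decomp e x : is_unit e -> x = dot x (rot90 e) *: rot90 e + dot x e *: e.
Proof.
rewrite /is_unit /dot /rot90 => eu; rewrite [LHS]surjective_pairing.
transitivity ((x.1 * - e.2 + x.2 * e.1) * - e.2 + (x.1 * e.1 + x.2 * e.2) * e.1,
  (x.1 * - e.2 + x.2 * e.1) * e.1 + (x.1 * e.1 + x.2 * e.2) * e.2); last by [].
congr pair.
- transitivity (x.1 * (e.1 * e.1 + e.2 * e.2)); last by ring.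
  by rewrite eu mulr1.
- transitivity (x.2 * (e.1 * e.1 + e.2 * e.2)); last by ring.
  by rewrite eu mulr1.
Qed.

Lemma frame_norm_le e x : is_unit e -> `|x| <= `|dot x (rot90 e)| + `|dot x e|.
Proof.
move=> eu; rewrite {1}(frame_decomp x eu).
have ul y : is_unit y -> `|y| <= 1.
  by move=> /is_unit_coord[y1 y2]; rewrite prod_normE/= ge_max y1.
apply: le_trans (ler_normD _ _) _; apply: lerD; rewrite normrZ ler_piMr//; apply: ul => //.
exact: is_unit_rot90.
Qed.

Lemma continuous_dot e p : continuous (fun x => dot (x - p) e).
Proof. exact: C1_continuous (C1_dot e p). Qed.

Lemma is_derive_near (f : R -> R) (s d eps : R) : is_derive s 1 f d -> 0 < eps ->
  \forall t \near s, `|f t - f s - d * (t - s)| <= eps * `|t - s|.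
Proof.
move=> [df dE] eps0.
have lim : (fun h => h^-1 *: (f (h *: (1 : R) + s) - f s)) @ 0^' --> (d : R^o).
  by rewrite -dE; exact: df.
move/cvgrPdist_le : lim => /(_ eps eps0) [del /= del0 Hdel].
exists del => //= t /= ts; have [->|ts0] := eqVneq t s.
  by rewrite !subrr mulr0 subrr !normr0 mulr0.
have t0 : t - s != 0 by rewrite subr_eq0.
have := Hdel (t - s); rewrite /= sub0r normrN distrC => /(_ ts t0).
rewrite /GRing.scale/= mulr1 subrK => H.
have -> : f t - f s - d * (t - s) = - ((d - (t - s)^-1 * (f t - f s)) * (t - s)).
  by field; exact: t0.
by rewrite (distrC s) normrN normrM ler_wpM2r.
Qed.

Lemma lipschitz_derive_le (f : R -> R) (L s d : R) :
  (forall x y : R, `|f x - f y| <= L * `|x - y|) -> is_derive s 1 f d -> `|d| <= L.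
Proof.
move=> fL dfs; apply/ler_addgt0Pr => /= eps eps0.
have [del /= del0 Hdel] := is_derive_near dfs eps0.
have d2 : 0 < del / 2 by rewrite divr_gt0.
have := Hdel (s + del / 2); rewrite /= opprD addNKr normrN gtr0_norm//.
rewrite ltr_pdivrMr// mulr_natr mulr2n ltrDr => /(_ del0).
have ss : s + del / 2 - s = del / 2 by rewrite addrAC subrr add0r.
rewrite ss (gtr0_norm d2) => H.
have := fL (s + del / 2) s; rewrite ss (gtr0_norm d2) => H'.
rewrite -(ler_pM2r d2) -[X in `|d| * X](gtr0_norm d2) -normrM.
move: H H'; set g := f _ - f s; move: d2; set u := del / 2; rewrite !ler_norml.
by move=> u0 /andP[? ?] /andP[? ?]; apply/andP; split; lra.
Qed.

Section Graph.
Variables (Omega : set (R * R)) (p e : R * R) (r h : R) (gam : R -> R).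
Hypotheses (oO : open Omega) (eu : is_unit e) (r0 : 0 < r) (h0 : 0 < h).
Local Notation w := (rot90 e).
Hypothesis cyl : forall x, `|dot (x - p) w| < r -> `|dot (x - p) e| < h ->
  (Omega x <-> gam (dot (x - p) w) < dot (x - p) e).

(** The point with coordinates (s, t) in the orthonormal frame centred at [p]. *)
Definition graph_pt (s t : R) : R * R := p + (s *: w + t *: e).

Lemma graph_pt1 s t : dot (graph_pt s t - p) w = s.
Proof.
rewrite /graph_pt addrAC subrr add0r dotDl !dotZl (dotC e) dot_rot90 mulr0 addr0.
by have := is_unit_rot90 eu; rewrite /is_unit => ->; rewrite mulr1.
Qed.

Lemma graph_pt2 s t : dot (graph_pt s t - p) e = t.
Proof.
rewrite /graph_pt addrAC subrr add0r dotDl !dotZl dot_rot90 mulr0 add0r.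
by move: eu; rewrite /is_unit => ->; rewrite mulr1.
Qed.

Lemma graph_norm_le s t x : `|x - graph_pt s t| <= `|dot (x - p) w - s| + `|dot (x - p) e - t|.
Proof.
apply: le_trans (frame_norm_le _ eu) _.
have -> : x - graph_pt s t = (x - p) - (graph_pt s t - p) by rewrite opprB addrA subrK.
by rewrite (dotBl (x - p)) (dotBl (x - p) _ e) graph_pt1 graph_pt2.
Qed.

Variable s : R.
Hypotheses (sr : `|s| < r) (sh : `|gam s| < h).
Local Notation q := (graph_pt s (gam s)).

Lemma near_cyl : \forall x \near q, `|dot (x - p) w| < r /\ `|dot (x - p) e| < h.
Proof.
apply: filterI.
  have c : continuous (fun x => `|dot (x - p) w|).
    by move=> x; apply: cvg_norm; exact: continuous_dot.
  by apply: (cvgr_lt _ (c q)); rewrite graph_pt1.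
have c : continuous (fun x => `|dot (x - p) e|).
  by move=> x; apply: cvg_norm; exact: continuous_dot.
by apply: (cvgr_lt _ (c q)); rewrite graph_pt2.
Qed.

Lemma graph_boundary : boundary Omega q.
Proof.
split.
  move=> B /nbhs_ballP[eps /= eps0 qB].
  pose t := Num.min (eps / 2) ((h - `|gam s|) / 2).
  have t0 : 0 < t by rewrite lt_min !divr_gt0// subr_gt0.
  have hl (z : R) : 0 < z -> z / 2 < z.
    by move=> z0; rewrite ltr_pdivrMr// mulr_natr mulr2n ltrDr.
  exists (graph_pt s (gam s + t)); split.
    apply/cyl; rewrite ?graph_pt1 ?graph_pt2//; last by rewrite ltrDl.
    apply: le_lt_trans (ler_normD _ _) _; rewrite (gtr0_norm t0) -ltrBrDl.
    by rewrite gt_min (hl (h - _)) ?orbT// subr_gt0.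
  apply: qB; rewrite -ball_normE /= distrC.
  apply: le_lt_trans (graph_norm_le _ _ _) _.
  rewrite graph_pt1 graph_pt2 subrr normr0 add0r addrAC subrr add0r gtr0_norm//.
  by rewrite gt_min hl.
move=> /interior_subset/cyl; rewrite graph_pt1 graph_pt2 => /(_ sr sh).
by rewrite ltxx.
Qed.

(** A point x on one side of the tangent line by more than eps |x - q| is on the same side of the
    graph, since the first-order error of [gam] is smaller; normalising divides by D >= 1, which
    only helps. *)
Lemma graph_outer_normal d : is_derive s 1 gam d ->
  outer_normal Omega q ((Num.sqrt (1 + d ^+ 2))^-1 *: (d *: w - e)).
Proof.
move=> dg; set D := Num.sqrt _.
have D2 : D ^+ 2 = 1 + d ^+ 2 by rewrite sqr_sqrtr// addr_ge0// sqr_ge0.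
have D1 : 1 <= D.
  by rewrite -[leLHS]sqrtr1 ler_wsqrtr// lerDl sqr_ge0.
have D0 : 0 < D by exact: lt_le_trans D1.
have ww : dot w w = 1 by exact: is_unit_rot90.
have ee : dot e e = 1 := eu.
have we := dot_rot90 e; have ew : dot e w = 0 by rewrite dotC.
split; first exact: graph_boundary.
  rewrite /is_unit !(dotZl, dotZr, dotDl, dotDr, dotNl, dotNr) ww ee we ew.
  rewrite !(mulr0, mulr1, oppr0, addr0, add0r, opprK).
  rewrite mulrA -invfM -expr2 D2 mulrC -expr2 [_ + 1]addrC divff//.
  by rewrite gt_eqF// ltr_pwDl// sqr_ge0.
(* Half of [eps], because a frame coordinate of [x - q] is at most twice its max norm. *)
move=> eps eps0; have eps2 : 0 < eps / 2 by rewrite divr_gt0.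
have cw : (fun x => dot (x - p) w) x @[x --> q] --> s.
  by have := @continuous_dot w p q; rewrite /continuous_at graph_pt1.
have near_d : \forall x \near q, `|gam (dot (x - p) w) - gam s - d * (dot (x - p) w - s)|
    <= eps / 2 * `|dot (x - p) w - s| := cw _ (is_derive_near dg eps2).
move: near_d near_cyl; apply: filterS2 => x /= Hd [xr xh].
set a := dot (x - p) w in Hd xr *; set b := dot (x - p) e in xh *.
have xq : x - q = (x - p) - (q - p) by rewrite opprB addrA subrK.
have qw : dot (x - q) w = a - s by rewrite xq (dotBl (x - p)) graph_pt1.
have qe : dot (x - q) e = b - gam s by rewrite xq (dotBl (x - p)) graph_pt2.
rewrite dotZr dotDr dotNr dotZr qw qe.
have as2 : `|a - s| <= 2 * `|x - q| by rewrite -qw dot_norm_le//; exact: is_unit_rot90.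
have Om : Omega x <-> gam a < b := cyl xr xh.
have n0 : 0 <= `|x - q| by [].
have h1 : eps / 2 * `|a - s| <= eps * `|x - q|.
  by rewrite -mulrA ler_pM2l// mulrC ler_pdivrMr// mulrC.
have h2 : eps * `|x - q| <= D * (eps * `|x - q|).
  by rewrite ler_peMl// mulr_ge0// ltW.
move: Hd; rewrite ler_norml => /andP[Hd1 Hd2].
split.
  rewrite ltr_pdivrMl// mulrN => H; apply/Om; lra.
rewrite ltr_pdivlMl// => H /Om; lra.
Qed.

End Graph.
End Frames.

Section Antiderivative.
Variable R : realType.
Implicit Types (f : R -> R) (c x : R).

(** Subtracting [f c] leaves a function that is zero to the left of [c], so its integral from
    [c - 1] is zero there as well and is differentiable on the whole line; the linear term restores
    [f c]. *)
Lemma antiderivative f c : continuous f -> (forall t : R, t <= c -> f t = f c) ->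
  exists F : R -> R, forall x : R, is_derive x 1 F (f x).
Proof.
move=> cf fc; pose g t := f t - f c.
have cg : continuous g by move=> x; apply: cvgB; [exact: cf|exact: cvg_cst].
have g0 t : t <= c -> g t = 0 by move=> tc; rewrite /g fc// subrr.
pose G x := \int[@lebesgue_measure R]_(t in `[c - 1, x]) g t.
have dG x : is_derive x 1 G (g x).
  have [xc|cx] := ltP x c; last first.
    have c1x : c - 1 < x by rewrite ltrBlDr ltr_pwDr.
    have ig : (@lebesgue_measure R).-integrable `[c - 1, x + 1] (EFin \o g).
      apply: continuous_compact_integrable; first exact: segment_compact.
      exact: continuous_subspaceT.
    have x1 : x < x + 1 by rewrite ltrDl.
    have [dG GE] := continuous_FTC1_closed x1 ig c1x (cg x).
    by split; [exact: dG|exact: (eq_trans (esym (derive1E _ _)) GE)].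
  rewrite g0 ?ltW//.
  have D0 : is_derive x 1 (cst (0 : R)) 0 by exact: is_derive_cst.
  apply: near_eq_is_derive D0; near=> y.
  rewrite /G /Rintegral integral0_eq// => t /=; rewrite in_itv/= => /andP[_ ty].
  rewrite g0// (le_trans ty)// ltW//; near: y; exact: lt_nbhsl.
exists (fun x => G x + f c * x) => x.
apply: (is_derive1_ext (is_deriveD (dG x) (is_deriveZ (f c) (is_derive_id x (1 : R))))) => //.
by rewrite /g /GRing.scale /= mulr1 subrK.
Unshelve. all: by end_near. Qed.

End Antiderivative.

(** * Cutoff functions near a Lipschitz graph *)

Section Cutoff.
Variable R : realType.
Variables (Omega : set (R * R)) (v : R * R -> R * R) (p e : R * R) (r h : R) (gam : R -> R).
Variables (L Lv s1 : R).
Hypotheses (oO : open Omega) (eu : is_unit e) (r0 : 0 < r) (h0 : 0 < h).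
Local Notation w := (rot90 e).
Local Notation ca x := (dot (x - p) w).
Local Notation cb x := (dot (x - p) e).
Hypothesis cyl : forall x, `|ca x| < r -> `|cb x| < h ->
  (Omega x <-> gam (ca x) < cb x).
Hypotheses (L0 : 0 < L) (gamL : forall s t : R, `|gam s - gam t| <= L * `|s - t|).
Hypotheses (Lv0 : 0 < Lv)
  (vL : forall x y, closure Omega x -> closure Omega y -> `|v x - v y| <= Lv * `|x - y|)
  (vtan : tangential Omega v).
Hypothesis gam0 : gam 0 = 0.
Hypotheses (s10 : 0 < s1) (s1r : 2 * s1 < r) (s1h : 2 * L * s1 < h) (s1h' : s1 < h).

(* Constant to the left of [- r], so as to have a primitive on the whole line. *)
Definition egam t := gam (Num.max t (- r)).

Lemma egamE t : - r <= t -> egam t = gam t.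
Proof. by move=> rt; rewrite /egam max_l. Qed.

Lemma egamL s t : `|egam s - egam t| <= L * `|s - t|.
Proof.
apply: le_trans (gamL _ _) _; rewrite ler_pM2l//.
case: (leP s (- r)) => ?; case: (leP t (- r)) => ?; rewrite ?subrr ?normr0//.
- by rewrite !ler_norml; case: (ger0P (s - t)) => ?; apply/andP; split; lra.
- by rewrite !ler_norml; case: (ger0P (s - t)) => ?; apply/andP; split; lra.
Qed.

Lemma continuous_egam : continuous egam.
Proof.
move=> x; apply/cvgrPdist_le => eps eps0; near=> t.
apply: le_trans (egamL _ _) _; rewrite mulrC -ler_pdivlMr//.
by near: t; apply: cvgr_dist_le => //; rewrite divr_gt0.
Unshelve. all: by end_near. Qed.

Lemma primitive_ex : exists F : R -> R, forall x : R, is_derive x 1 F (egam x).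
Proof.
apply: (@antiderivative _ _ (- r)); first exact: continuous_egam.
by move=> t tr; rewrite /egam max_r// maxxx.
Qed.

Variable F : R -> R.
Hypothesis dF : forall x : R, is_derive x 1 F (egam x).

Variable k : R.
Hypotheses (k0 : 0 < k) (k1 : (2 * (L + 1) * s1)^-1 <= k).

(* [steklov] averages the graph function from [a] to [a + del], which makes it
   C^1; [del] is such that [2 * (L + 1) * del = k^-1]. *)
Definition del := (2 * k * (L + 1))^-1.
Definition steklov a := (F (a + del) - F a) / del.
Definition dsteklov a := (egam (a + del) - egam a) / del.

Let L1 : 0 < L + 1. Proof. by rewrite addr_gt0. Qed.

Lemma del_gt0 : 0 < del.
Proof. by rewrite invr_gt0 mulr_gt0// mulr_gt0. Qed.

Lemma del_s1 : del <= s1.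
Proof.
have p1 : 0 < 2 * (L + 1) * s1 by rewrite mulr_gt0// mulr_gt0.
have p2 : 0 < 2 * k * (L + 1) by rewrite mulr_gt0// mulr_gt0.
rewrite /del -[_^-1]mul1r ler_pdivrMr//.
by move: k1; rewrite -[_^-1]mul1r ler_pdivrMr//; lra.
Qed.

Lemma del_k : 2 * (L + 1) * del = k^-1.
Proof. by rewrite /del; field; rewrite !gt_eqF. Qed.

Lemma is_derive_steklov (a : R) : is_derive a 1 steklov (dsteklov a).
Proof.
have D1 : is_derive a 1 (fun t : R => t + del) 1.
  by apply: (is_derive1_ext (is_deriveD (is_derive_id a (1 : R)) (is_derive_cst del a (1 : R)))) => //;
    rewrite addr0.
have D2 := @is_derive1_comp _ F (fun t => t + del) _ _ _ (dF (a + del)) D1.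
apply: (is_derive1_ext (is_deriveZ del^-1 (is_deriveB D2 (dF a)))).
  by move=> t; rewrite /steklov mulrC.
by rewrite /dsteklov mulr1 [RHS]mulrC.
Qed.

Lemma continuous_dsteklov : continuous dsteklov.
Proof.
move=> a; apply: cvgM; last exact: cvg_cst.
apply: cvgB; last exact: continuous_egam.
apply: (@continuous_comp _ _ _ (fun t => t + del) egam); last exact: continuous_egam.
by apply: cvgD; [exact: cvg_id|exact: cvg_cst].
Qed.

Lemma steklov_near a : `|steklov a - egam a| <= L * del.
Proof.
have ad : a < a + del by rewrite ltrDl del_gt0.
have cF : {within `[a, a + del], continuous F}.
  apply: continuous_subspaceT => x.
  by apply/differentiable_continuous/derivable1_diffP; have [] := dF x.
have [c cI FE] := MVT ad (fun x _ => dF x) cF.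
have -> : steklov a = egam c.
  by rewrite /steklov FE addrAC subrr add0r mulfK// gt_eqF// del_gt0.
apply: le_trans (egamL _ _) _; rewrite ler_pM2l//.
move: cI; rewrite in_itv/= => /andP[ac cd]; rewrite ger0_norm ?subr_ge0; last exact: ltW.
by rewrite lerBlDl ltW.
Qed.

(** The step takes place at heights between 1 / k and 2 / k over the averaged graph. As this one is
    within 1 / (2 k) of the true graph, the shift by 1 keeps the support of the cutoff off the
    boundary. *)
Definition arg (x : R * R) : R := k * (cb x - steklov (ca x)) - 1.
Definition cutoff (x : R * R) : R := step (arg x).

Lemma is_grad_cutoff :
  is_grad cutoff (fun x => (dstep (arg x) * k) *: (e - dsteklov (ca x) *: w)).
Proof.
have g1 := is_grad_comp is_derive_steklov (is_grad_dot w p).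
have g2 := is_gradD (is_grad_dot e p) (is_gradN g1).
have g3 := is_gradD (is_gradM (is_grad_cst k) g2) (is_grad_cst (- 1)).
have := is_grad_comp (@is_derive_step R) g3; congr is_grad.
apply/funext => x /=; rewrite -scalerA; congr (_ *: _).
by rewrite scaler0 !addr0.
Qed.

Lemma C1_cutoff : C1 cutoff.
Proof.
apply: (C1_grad is_grad_cutoff).
have ccomp (f : R -> R) : continuous f -> continuous (fun x : R * R => f (ca x)).
  move=> cf x; exact: (continuous_comp (@continuous_dot _ w p x) (cf _)).
have csteklov : continuous steklov.
  by move=> a; apply/differentiable_continuous/derivable1_diffP; have [] := is_derive_steklov a.
have carg : continuous arg.
  move=> y; apply: cvgB; last exact: cvg_cst.
  apply: cvgM; first exact: cvg_cst.
  by apply: cvgB; [exact: continuous_dot|exact: (ccomp _ csteklov y)].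
have c1 : continuous (fun x : R * R => dstep (arg x) * k).
  move=> x; apply: cvgM; last exact: cvg_cst.
  exact: (continuous_comp (carg x) (@continuous_dstep R _)).
have c2 : continuous (fun x : R * R => e - dsteklov (ca x) *: w).
  move=> x; apply: cvgB; first exact: cvg_cst.
  by apply: cvgZ; [exact: (ccomp _ continuous_dsteklov x)|exact: cvg_cst].
by move=> x; apply: cvgZ; [exact: c1|exact: c2].
Qed.

Lemma cutoff_eq0 x : cb x - egam (ca x) <= (2 * k)^-1 -> cutoff x = 0.
Proof.
move=> H; apply: step_le0; rewrite /arg subr_le0 mulrC -ler_pdivlMr// div1r.
have := steklov_near (ca x); rewrite ler_norml => /andP[H1 _].
have Ld : L * del <= (2 * k)^-1.
  have -> : (2 * k)^-1 = (L + 1) * del by rewrite invfM -del_k; field.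
  apply: ler_wpM2r; first exact/ltW/del_gt0.
  by rewrite lerDl.
have : (2 * k)^-1 + (2 * k)^-1 = k^-1 by field; rewrite gt_eqF.
by move: H H1 Ld; set u := (2 * k)^-1; lra.
Qed.

Lemma cutoff_eq1 x : 3 <= k * (cb x - egam (ca x)) ->
  cutoff x = 1 /\ grad cutoff x = 0.
Proof.
move=> H; have arg1 : 1 <= arg x.
  rewrite /arg; have := steklov_near (ca x); rewrite ler_norml => /andP[_ H2].
  have Ld : k * (L * del) <= 1.
    rewrite mulrC -ler_pdivlMr// div1r -del_k; apply: ler_wpM2r; first exact/ltW/del_gt0.
    by apply: (@le_trans _ _ (L + 1)); [rewrite lerDl|rewrite ler_peMl ?ler1n// ltW].
  have := ler_wpM2l (ltW k0) H2; lra.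
split; first exact: step_ge1.
by rewrite (is_gradE is_grad_cutoff) dstep_ge1// mul0r scale0r.
Qed.

Lemma cutoff_itv x : 0 <= cutoff x <= 1. Proof. exact: step_itv. Qed.

(* The gradient of the cutoff is of order [k], but its support lies within
   [3 / k] of the boundary points where the graph is differentiable, at which
   [v] is tangential; as [v] is Lipschitz the two orders compensate. *)
Lemma cutoff_vel_le x : Omega x -> `|ca x| <= s1 -> `|cb x| <= s1 ->
  `|dot (v x) (grad cutoff x)| <= 12 * (1 + L) * Lv.
Proof.
move=> Ox ax bx.
rewrite (is_gradE is_grad_cutoff).
have C0 : 0 <= 12 * (1 + L) * Lv by rewrite mulr_ge0 ?ltW// mulr_gt0// addr_gt0.
have [argx0|argx0] := leP (arg x) 0; first by rewrite dstep_le0// mul0r scale0r dotC /dot !mul0r addr0 normr0.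
have [argx1|argx1] := leP 1 (arg x); first by rewrite dstep_ge1// mul0r scale0r dotC /dot !mul0r addr0 normr0.
set a := ca x in ax *; set b := cb x in bx *.
have d0 := del_gt0; have ds := del_s1.
have kV : 0 < k^-1 by rewrite invr_gt0.
have bst : 0 <= b - steklov a <= 2 * k^-1.
  rewrite ler_pdivlMr// (mulrC _ k) -(pmulr_rge0 _ k0).
  by move: argx0 argx1; rewrite /arg -/a -/b => ? ?; apply/andP; split; lra.
have bga : `|b - egam a| <= 2 * k^-1 + L * del.
  have := steklov_near a; rewrite !ler_norml => /andP[? ?]; case/andP: bst => ? ?.
  by apply/andP; split; lra.
(* [3 / k] bounds the distance from [x] to the boundary points [q] below, [Lv] converts it into a
   difference of velocities, and 2 (1 + L) bounds the combination of two frame components with a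
   slope of size at most [L]. *)
pose M := 2 * (1 + L) * Lv * (3 * k^-1).
have [ps1 ps1r pL] : [/\ 0 < s1, 2 * s1 < r & 0 < L] by split.
have ra : - r <= a by move: ax; rewrite ler_norml => /andP[? _]; lra.
have gE t : a <= t -> egam t = gam t by move=> at_; rewrite egamE//; lra.
(* This quantity is the integral over [[a, a + del]] of v.e - gam' v.w with [v] frozen at [x].
   Wherever gam' exists, tangency makes the same combination vanish at [v q], so [v x] may be
   replaced by [v x - v q]. *)
have key : `|dot (v x) e * (a + del - a) + - dot (v x) w * (gam (a + del) - gam a)|
    <= M * (a + del - a).
  apply: (lipschitz_increment_le L0 gamL); first by rewrite ltrDl.
    move=> s d /andP[as_ sd] dgs.
    have sn : `|s| <= 2 * s1 by move: ax; rewrite !ler_norml => /andP[? ?]; apply/andP; split; lra.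
    have sr : `|s| < r by exact: le_lt_trans s1r.
    have gs : `|gam s| < h.
      have := gamL s 0; rewrite gam0 !subr0 => H; apply: le_lt_trans H _.
      by apply: le_lt_trans s1h; rewrite -mulrA mulrCA ler_pM2l.
    pose q := graph_pt p e s (gam s).
    have nq := graph_outer_normal eu cyl sr gs dgs.
    have dL := lipschitz_derive_le gamL dgs.
    have := vtan nq; rewrite dotZr => /eqP; rewrite mulf_eq0 invr_eq0 sqrtr_eq0 leNgt.
    rewrite ltr_pwDl ?sqr_ge0//= dotDr dotNr dotZr subr_eq0 => /eqP vq.
    have cq : closure Omega q by have [[]] := nq.
    have cx : closure Omega x by exact: subset_closure.
    have vxq := vL cx cq.
    have -> : dot (v x) e + - dot (v x) w * d =
        dot (v x - v q) e - d * dot (v x - v q) w.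
      by rewrite !dotBl -vq; ring.
    have e1 := dot_norm_le (v x - v q) eu.
    have e2 := dot_norm_le (v x - v q) (is_unit_rot90 eu).
    (* The height contributes 2 / k + 2 L del and the abscissa del; now 2 (L + 1) del = 1 / k. *)
    have xq : `|x - q| <= 3 * k^-1.
      apply: le_trans (graph_norm_le p eu s (gam s) x) _; rewrite -/a -/b.
      have h1 : `|a - s| <= del by rewrite ler_norml; apply/andP; split; lra.
      have h2 : `|gam a - gam s| <= L * del.
        by apply: le_trans (gamL _ _) _; rewrite ler_pM2l.
      have h3 : `|b - gam s| <= 2 * k^-1 + L * del + L * del.
        have -> : b - gam s = (b - egam a) + (gam a - gam s) by rewrite gE//; ring.
        by apply: le_trans (ler_normD _ _) _; exact: lerD.
      by have := del_k; lra.
    apply: le_trans (ler_normB _ _) _; rewrite normrM.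
    apply: (@le_trans _ _ (2 * `|v x - v q| + L * (2 * `|v x - v q|))).
      by apply: lerD => //; exact: ler_pM.
    have -> : 2 * `|v x - v q| + L * (2 * `|v x - v q|) = 2 * (1 + L) * `|v x - v q| by ring.
    have -> : M = 2 * (1 + L) * (Lv * (3 * k^-1)) by rewrite /M mulrA.
    rewrite ler_pM2l; last by rewrite mulr_gt0// addr_gt0.
    by apply: le_trans vxq _; rewrite ler_pM2l.
  by rewrite /M !mulr_ge0// ltW// addr_gt0.
have ss : a + del - a = del by rewrite addrAC subrr add0r.
rewrite ss in key.
rewrite dotZr dotDr dotNr dotZr normrM.
have -> : dot (v x) e - dsteklov a * dot (v x) w =
    del^-1 * (dot (v x) e * del + - dot (v x) w * (gam (a + del) - gam a)).
  by rewrite /dsteklov !gE ?lexx ?lerDl ?ltW//; field; rewrite gt_eqF.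
have d1 : 0 < del^-1 by rewrite (invr_gt0 del).
rewrite [X in _ * X <= _]normrM (gtr0_norm d1).
have : del^-1 * `|dot (v x) e * del + - dot (v x) w * (gam (a + del) - gam a)| <= M.
  by rewrite ler_pdivrMl// (mulrC del).
set X := del^-1 * _ => XM.
have X0 : 0 <= X by rewrite mulr_ge0// ltW.
rewrite normrM (gtr0_norm k0).
have /andP[ds0 ds2] := dstep_itv (arg x).
rewrite (ger0_norm ds0).
(* The 2 is the greatest slope of [step]; the product with [M] no longer depends on [k]. *)
apply: (@le_trans _ _ (2 * k * M)).
  apply: ler_pM => //; first by rewrite mulr_ge0// ltW.
  by rewrite ler_pM2r.
rewrite /M le_eqVlt; apply/orP; left; apply/eqP; field; rewrite gt_eqF//.
Qed.

End Cutoff.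

Section Bump.
Variable R : realType.

Lemma bump_ex (p : R * R) (d : R) : 0 < d -> exists b : R * R -> R,
  [/\ C1 b, forall x, ball p (d / 2) x -> b x = 1 & forall x, ~ box p d x -> b x = 0].
Proof.
move=> d0; pose hat a (x : R * R) := step (2 + dot (x - p) a).
have chat a : C1 (hat a).
  exact: (C1_comp (@is_derive_step R) (@continuous_dstep R) (C1D (C1_cst 2) (C1_dot a p))).
(* For |t| < d / 2 both 2 + c t and 2 - c t exceed 1, the plateau of [step]; for |t| > d one of them
   is negative. *)
pose c := 2 / d; have c0 : 0 < c by rewrite divr_gt0.
have cd : d / 2 * c = 1 by rewrite /c mulrA divfK// divff// gt_eqF.
have hat1 (t : R) : `|t| < d / 2 -> 1 <= 2 + t * c /\ 1 <= 2 + t * - c.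
  rewrite -(ltr_pM2r c0) cd -[X in _ * X](gtr0_norm c0) -normrM ltr_norml.
  by move=> /andP[? ?]; rewrite mulrN; split; lra.
have hat0 (t : R) : ~ (`|t| <= d) -> step (2 + t * c) * step (2 + t * - c) = 0.
  move/negP; rewrite -ltNge => dt.
  have : 2 < `|t| * c by rewrite /c mulrA ltr_pdivlMr// mulrC ltr_pM2r.
  rewrite -[X in _ * X](gtr0_norm c0) -normrM mulrN.
  case: (ger0P (t * c)) => _ tc; first by rewrite [X in _ * X]step_le0 ?mulr0//; lra.
  by rewrite step_le0 ?mul0r//; lra.
exists ((hat (c, 0) \* hat (- c, 0)) \* (hat (0, c) \* hat (0, - c))); split.
- by apply: C1M; apply: C1M.
- move=> x; rewrite -ball_normE /= distrC prod_normE/= gt_max => /andP[/hat1[x1 x2] /hat1[x3 x4]].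
  by rewrite /hat /dot /= !mulr0 !addr0 !add0r !step_ge1// !mulr1.
- move=> x bx; rewrite /= /hat /dot /= !mulr0 !addr0 !add0r.
  have [x1|/hat0 ->] := pselect (`|x.1 - p.1| <= d); last by rewrite mul0r.
  rewrite (hat0 (x.2 - p.2)) ?mulr0// => x2.
  by apply: bx; apply/boxP.
Qed.

End Bump.

(** * Vanishing of the flux through the boundary *)

Section Boundary.
Variable R : realType.
Local Notation T := (measurableTypeR R * measurableTypeR R)%type.
Local Notation mu := (@lebesgue2 R).
Variables (Omega : set (R * R)) (v : R * R -> R * R) (Lv : R) (m rho : R * R -> R).
Hypotheses (oO : open Omega) (bO : bounded_set Omega) (lbO : lipschitz_boundary Omega).
Hypotheses (Lv0 : 0 < Lv)
  (vL : forall x y, closure Omega x -> closure Omega y -> `|v x - v y| <= Lv * `|x - y|)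
  (vtan : tangential Omega v).
Hypotheses (m1 : mu.-integrable Omega (EFin \o m))
  (rho1 : mu.-integrable Omega (EFin \o rho)).
Implicit Types (theta psi : R * R -> R).

Lemma compact_closure_domain : compact (closure Omega).
Proof.
have [M OM] := domain_sub_cube bO.
have cM : cube (R := R) M `<=` box (0 : R * R) M.
  move=> x [x1 x2]; apply/boxP.
  by move: x1 x2; rewrite /ball /= !sub0r !normrN !subr0 => /ltW ? /ltW ?.
have cb : closed (box (0 : R * R) M).
  by apply: compact_closed; [exact: norm_hausdorff|exact: compact_box].
apply: (subclosed_compact (@closed_closure _ Omega) (@compact_box _ (0 : R * R) M)).
rewrite [X in _ `<=` X](closure_id _).1//.
by apply: closureS; exact: subset_trans OM cM.
Qed.

Lemma continuous_domain_bounded (f : R * R -> R) : continuous f ->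
  exists2 C : R, 0 <= C & forall x, Omega x -> `|f x| <= C.
Proof.
move=> cf; have cK := continuous_compact (continuous_subspaceT cf) compact_closure_domain.
have [C C0 HC] := pinfty_ex_gt0 (compact_bounded cK).
exists C; first exact: ltW.
by move=> x Ox; apply: HC; exists x => //; exact: subset_closure.
Qed.

Lemma velocity_bounded : exists2 C : R, 0 <= C & forall x, Omega x -> `|v x| <= C.
Proof.
have [[x0 Ox0]|nO] := pselect (Omega !=set0); last first.
  by exists 0 => // x Ox; exfalso; apply: nO; exists x.
have [C C0 HC] := continuous_domain_bounded (C1_continuous (C1_dot (1, 0) x0)).
have [D D0 HD] := continuous_domain_bounded (C1_continuous (C1_dot (0, 1) x0)).
exists (`|v x0| + Lv * (C + D)); first by rewrite addr_ge0// mulr_ge0 ?addr_ge0// ltW.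
move=> x Ox; rewrite -[v x](subrK (v x0)) addrC.
apply: le_trans (ler_normD _ _) _; rewrite lerD2l.
apply: le_trans (vL (subset_closure Ox) (subset_closure Ox0)) _.
rewrite ler_pM2l//; rewrite prod_normE/= ge_max.
have := HC x Ox; have := HD x Ox; rewrite /dot /= !mulr0 !mulr1 addr0 add0r => HD' HC'.
by apply/andP; split; [apply: le_trans HC' _; rewrite lerDl|apply: le_trans HD' _; rewrite lerDr].
Qed.

Lemma continuous_velocity : {in Omega, continuous v}.
Proof.
move=> x; rewrite inE => Ox; apply/cvgrPdist_le => eps eps0.
have e1 : 0 < eps / Lv by rewrite divr_gt0.
apply: filterS2 (open_nbhs_nbhs (conj oO Ox)) (nbhsx_ballx x _ e1) => y Oy.
rewrite -ball_normE /= => /ltW xy.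
apply: le_trans (vL (subset_closure Ox) (subset_closure Oy)) _.
by rewrite mulrC -ler_pdivlMr.
Qed.

Definition advect theta x := dot (v x) (grad theta x).

Lemma measurable_advect theta : C1 theta ->
  measurable_fun (Omega : set T) (advect theta : T -> R).
Proof.
move=> ct; have mO := measurable_domain oO.
have mv1 : measurable_fun (Omega : set T) (fun x : T => (v x).1).
  apply: (continuous_in_measurable_plane oO) => x xO.
  by apply: (@continuous_comp _ _ _ v fst); [exact: continuous_velocity|exact: cvg_fst].
have mv2 : measurable_fun (Omega : set T) (fun x : T => (v x).2).
  apply: (continuous_in_measurable_plane oO) => x xO.
  by apply: (@continuous_comp _ _ _ v snd); [exact: continuous_velocity|exact: cvg_snd].
have mg1 : measurable_fun (Omega : set T) (fun x : T => (grad theta x).1).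
  by apply: measurable_funTS; exact: (continuous_measurable_plane (continuous_grad1 ct)).
have mg2 : measurable_fun (Omega : set T) (fun x : T => (grad theta x).2).
  by apply: measurable_funTS; exact: (continuous_measurable_plane (continuous_grad2 ct)).
exact: (measurable_funD (measurable_funM mv1 mg1) (measurable_funM mv2 mg2)).
Qed.

Lemma advect_bounded theta : C1 theta ->
  exists2 C : R, 0 <= C & forall x, Omega x -> `|advect theta x| <= C.
Proof.
move=> ct; have [V V0 HV] := velocity_bounded.
have [C C0 HC] := continuous_domain_bounded (continuous_grad1 ct).
have [D D0 HD] := continuous_domain_bounded (continuous_grad2 ct).
exists (V * C + V * D); first by rewrite addr_ge0// mulr_ge0.
move=> x Ox; apply: le_trans (ler_normD _ _) _; rewrite !normrM.
have [v1 v2] := prod_norm_ge (v x).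
by apply: lerD; apply: ler_pM => //; [apply: le_trans (HV _ Ox)|exact: HC|apply: le_trans (HV _ Ox)|exact: HD].
Qed.

(** Zero integral against all test functions means div (rho v) = m weakly inside the domain; the
    same for theta = 1 says that the total flux of rho v through the boundary is zero. *)
Definition weak_transport theta x := m x * theta x + rho x * advect theta x.

Lemma integrable_weak_transport theta : C1 theta ->
  mu.-integrable Omega (EFin \o weak_transport theta).
Proof.
move=> ct; have mO := measurable_domain oO.
have [C _ HC] := continuous_domain_bounded (C1_continuous ct).
have [D _ HD] := advect_bounded ct.
have mt : measurable_fun (Omega : set T) (theta : T -> R).
  by apply: measurable_funTS; exact: (continuous_measurable_plane (C1_continuous ct)).
have i1 := integrableM_bounded mO m1 mt (ex_intro _ C HC).
have i2 := integrableM_bounded mO rho1 (measurable_advect ct) (ex_intro _ D HD).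
exact: (integrableD mO i1 i2).
Qed.

Hypothesis weak0 : forall psi, test_function Omega psi ->
  \int[mu]_(x in Omega) weak_transport psi x = 0.

(** Besides the values, only the derivative along [v] has to stay bounded, not the gradient: the
    gradients of the cutoffs grow without bound. *)
Lemma weak_transport_limit theta (psi : nat -> R * R -> R) (C : R) :
  C1 theta -> (forall n, test_function Omega (psi n)) ->
  (forall x, Omega x -> \forall n \near \oo,
     psi n x = theta x /\ grad (psi n) x = grad theta x) ->
  (forall n x, Omega x -> `|psi n x| <= C /\ `|advect (psi n) x| <= C) ->
  \int[mu]_(x in Omega) weak_transport theta x = 0.
Proof.
move=> ct tpsi cpsi bpsi; have mO := measurable_domain oO.
have cn n := test_C1 (tpsi n).
have inull n : (\int[mu]_(x in Omega) (weak_transport (psi n) x)%:E = 0)%E.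
  have := integrable_fin_num mO (integrable_weak_transport (cn n)).
  move=> /fineK <-; congr EFin; exact: weak0.
pose g x := (`|m x| + `|rho x|) * C.
have ig : mu.-integrable Omega (EFin \o g).
  have im := integrable_norm m1.
  have ir := integrable_norm rho1.
  apply: (integrableM_bounded mO (integrableD mO im ir)); first exact: measurable_cst.
  by exists `|C|.
have lim : (fun n => \int[mu]_(x in Omega) (weak_transport (psi n) x)%:E)%E @ \oo -->
    (\int[mu]_(x in Omega) (weak_transport theta x)%:E)%E.
  apply: (dominated_cvg mO _ _ _ ig) => //.
  - by move=> n; have /integrableP[] := integrable_weak_transport (cn n).
  - move=> x Ox; apply: cvg_near_cst; near=> n.
    have [e1 e2] : psi n x = theta x /\ grad (psi n) x = grad theta x by near: n; exact: cpsi.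
    by rewrite /weak_transport /advect e1 e2.
  - move=> n x Ox; rewrite /= lee_fin /g; have [b1 b2] := bpsi n x Ox.
    apply: le_trans (ler_normD _ _) _; rewrite !normrM mulrDl.
    by apply: lerD; exact: ler_wpM2l.
have lim0 : (fun n => \int[mu]_(x in Omega) (weak_transport (psi n) x)%:E)%E @ \oo --> (0 : \bar R)%E.
  by under eq_fun do rewrite inull; exact: cvg_cst.
by rewrite /Rintegral (cvg_unique _ lim lim0).
Unshelve. all: by end_near. Qed.

Lemma weak_transport_boundary p : boundary Omega p ->
  exists2 d : R, 0 < d & forall theta, C1 theta ->
    (forall x, ~ box p d x -> theta x = 0) ->
    \int[mu]_(x in Omega) weak_transport theta x = 0.
Proof.
move=> bp; have [e [r [h [gam [eu r0 h0 lg cyl]]]]] := lbO bp.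
have [L L0 gamL'] := pinfty_ex_gt0 lg.
have gamL s t : `|gam s - gam t| <= L * `|s - t| by exact: (gamL' (s, t)).
have wu := is_unit_rot90 eu.
have dotp a : dot (p - p) a = 0 by rewrite subrr /dot !mul0r addr0.
have Op : ~ Omega p by move=> Op; case: bp => _; apply; exact: open_nbhs_nbhs.
have in_cyl x (eta : R) : `|x - p| <= eta ->
    `|dot (x - p) (rot90 e)| <= 2 * eta /\ `|dot (x - p) e| <= 2 * eta.
  move=> xp; have le2 : 2 * `|x - p| <= 2 * eta by rewrite ler_pM2l.
  by split; apply: le_trans le2; exact: dot_norm_le.
have gam0 : gam 0 = 0.
  apply/eqP; rewrite eq_le; apply/andP; split; last first.
    rewrite leNgt; apply/negP => g0; apply: Op; apply/cyl; rewrite !dotp ?normr0//.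
  rewrite leNgt; apply/negP => g0.
  (* Points of the domain within [eta] of [p] have frame coordinates at most 2 eta, but there the
     graph is at height at least gam 0 - 2 L eta, which exceeds 2 eta as gam 0 >= 3 (L + 1) eta. *)
  pose eta := Num.min (Num.min r h) (gam 0 / (L + 1)) / 3.
  have eta0 : 0 < eta by rewrite divr_gt0// !lt_min r0 h0 divr_gt0// addr_gt0.
  have etaM : eta * 3 <= Num.min (Num.min r h) (gam 0 / (L + 1)) by rewrite divfK.
  move: etaM; rewrite !le_min ler_pdivlMr ?addr_gt0// => /andP[/andP[er eh] eg].
  have [x [Ox]] := bp.1 _ (nbhsx_ballx p _ eta0); rewrite -ball_normE /= distrC => /ltW xp.
  have [ca cb] := in_cyl _ _ xp.
  have : gam (dot (x - p) (rot90 e)) < dot (x - p) e by apply/cyl => //; lra.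
  have := gamL 0 (dot (x - p) (rot90 e)); rewrite sub0r normrN => gd.
  have Lc : L * `|dot (x - p) (rot90 e)| <= L * (2 * eta) by rewrite ler_pM2l.
  have Le : 0 < L * eta by exact: mulr_gt0.
  move: gd cb; rewrite !ler_norml => /andP[? ?] /andP[? ?]; lra.
pose M := Num.min r h; have M0 : 0 < M by rewrite lt_min r0.
have [Mr Mh] : M <= r /\ M <= h by split; rewrite ge_min lexx ?orbT.
have L1 : 0 < L + 1 by rewrite addr_gt0.
(* So small that the graph over [[- 2 s1, 2 s1]] stays in the cylinder. Abscissas up to 2 s1 occur
   because the average looks ahead by [del], which is at most [s1]. *)
pose s1 := M / (4 * (L + 1)).
have s10 : 0 < s1 by rewrite divr_gt0// mulr_gt0.
have s1M : s1 * 4 + 4 * (s1 * L) = M.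
  by transitivity (s1 * (4 * (L + 1))); [ring|rewrite divfK// gt_eqF// mulr_gt0].
have sL0 : 0 < s1 * L by exact: mulr_gt0.
have s1r : 2 * s1 < r by lra.
have s1h : 2 * L * s1 < h by lra.
have s1h' : s1 < h by lra.
exists (s1 / 2); first by rewrite divr_gt0.
move=> theta ct theta0.
have [F dF] := primitive_ex r L0 gamL.
pose k0 := (2 * (L + 1) * s1)^-1.
have k00 : 0 < k0 by rewrite invr_gt0 mulr_gt0// mulr_gt0.
(* The offset [k0] guarantees [del <= s1] for every [n], including 0. *)
pose k (n : nat) := n%:R + k0.
have kn0 n : 0 < k n by rewrite ltr_wpDl.
have kk0 n : k0 <= k n by rewrite lerDr.
pose chi n := cutoff p e L F (k n).
have cchi n : C1 (chi n) by exact: (C1_cutoff p e L0 gamL dF).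
have box_cyl x : box p (s1 / 2) x ->
    `|dot (x - p) (rot90 e)| <= s1 /\ `|dot (x - p) e| <= s1.
  move=> /boxP[x1 x2]; have -> : s1 = 2 * (s1 / 2) by field.
  by apply: in_cyl; rewrite prod_normE/= ge_max x1.
have box_r x : box p (s1 / 2) x -> - r <= dot (x - p) (rot90 e).
  by move=> /box_cyl[]; rewrite ler_norml => /andP[? _] _; lra.
have box_O x : box p (s1 / 2) x ->
    (Omega x <-> egam r gam (dot (x - p) (rot90 e)) < dot (x - p) e).
  move=> bx; have [ca cb] := box_cyl _ bx; rewrite egamE; last exact: box_r.
  by apply: cyl; lra.
have cgap : continuous (fun x : R * R => dot (x - p) e - egam r gam (dot (x - p) (rot90 e))).
  move=> x; apply: cvgB; first exact: continuous_dot.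
  exact: (continuous_comp (@continuous_dot _ (rot90 e) p x) (@continuous_egam _ _ _ _ L0 gamL _)).
have tpsi n : test_function Omega (theta \* chi n).
  (* The points of the box at height at least 1 / (2 k) over the graph: compact, inside the domain,
     and off this set either [theta] or the cutoff is zero. *)
  pose K := box p (s1 / 2) `&`
    (fun x : R * R => dot (x - p) e - egam r gam (dot (x - p) (rot90 e))) @^-1` [set t : R | (2 * k n)^-1 <= t].
  have cK : compact K.
    apply: compact_closedI; first exact: compact_box.
    by apply: preimage_closed => [x _|]; [exact: cgap|exact: closed_ge].
  apply: (test_function_of_C1 (C1M ct (cchi n)) cK).
    move=> x [bx /= gx]; apply/(box_O _ bx); rewrite -subr_gt0; apply: lt_le_trans gx.
    by rewrite invr_gt0 mulr_gt0.
  move=> x Kx /=; have [bx|bx] := pselect (box p (s1 / 2) x); last by rewrite theta0// mul0r.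
  rewrite /chi (cutoff_eq0 L0 gamL dF (kn0 n)) ?mulr0//.
  by rewrite leNgt; apply/negP => H; apply: Kx; split => //=; exact: ltW.
have cbox := @compact_box _ p (s1 / 2).
have gout n x : ~ box p (s1 / 2) x -> grad (theta \* chi n) x = 0.
  by apply: grad_outside => // y by_; rewrite /= theta0// mul0r.
have [C C0 HC] := continuous_domain_bounded (C1_continuous ct).
have [D D0 HD] := advect_bounded ct.
pose B := C + D + C * (12 * (1 + L) * Lv).
have c0 : 0 <= C * (12 * (1 + L) * Lv) by rewrite mulr_ge0// mulr_ge0 ?(ltW Lv0)// mulr_ge0// addr_ge0// ltW.
apply: (@weak_transport_limit _ (fun n => theta \* chi n) B ct tpsi).
- move=> x Ox; have [bx|bx] := pselect (box p (s1 / 2) x); last first.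
    near=> n; split; first by rewrite /= theta0// mul0r.
    by rewrite gout// (grad_outside cbox theta0).
  have gx := (box_O x bx).1 Ox; near=> n.
  have [|c1 g1] := @cutoff_eq1 _ p e r gam L L0 gamL F dF (k n) (kn0 n) x.
    rewrite -ler_pdivrMr ?subr_gt0//; apply: (@le_trans _ _ n%:R); last by rewrite lerDl ltW.
    by near: n; exact: nbhs_infty_ger.
  split; first by rewrite /= /chi c1 mulr1.
  by rewrite gradM//= /chi c1 g1 scaler0 add0r scale1r.
move=> n x Ox; have [bx|bx] := pselect (box p (s1 / 2) x); last first.
  rewrite /advect gout// /= theta0// mul0r dotC /dot !mul0r addr0 normr0.
  by split; rewrite /B !addr_ge0.
have [ca cb] := box_cyl _ bx.
have /andP[c0' c1'] := cutoff_itv p e L F (k n) x.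
split.
  rewrite /= normrM; apply: (@le_trans _ _ (C * 1)); last by rewrite mulr1 /B -addrA lerDl addr_ge0.
  by apply: ler_pM => //; [exact: HC|rewrite ger0_norm].
rewrite /advect gradM//= dotDr !dotZr; apply: le_trans (ler_normD _ _) _.
rewrite !normrM /B addrC; apply: lerD; last first.
  by apply: ler_pM => //; [exact: HC|exact: (cutoff_vel_le eu cyl L0 gamL Lv0 vL vtan gam0 s10 s1r s1h dF (kn0 n) (kk0 n) Ox ca cb)].
rewrite (ger0_norm c0'); apply: (@le_trans _ _ (1 * D)); last by rewrite mul1r lerDr.
by apply: ler_pM => //; exact: HD.
Unshelve. all: by end_near. Qed.

Lemma weak_transport_near p : closure Omega p ->
  exists2 d : R, 0 < d & forall theta, C1 theta ->
    (forall x, ~ box p d x -> theta x = 0) ->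
    \int[mu]_(x in Omega) weak_transport theta x = 0.
Proof.
move=> cp; have [Op|nOp] := pselect (interior Omega p); last exact: weak_transport_boundary.
have /nbhs_ballP[d /= d0 dO] := Op.
have d2 : d / 2 < d by rewrite ltr_pdivrMr// mulr_natr mulr2n ltrDr.
exists (d / 2); first by rewrite divr_gt0.
move=> theta ct theta0; apply: weak0.
apply: (test_function_of_C1 ct (@compact_box _ p (d / 2))) => //.
exact: subset_trans (box_sub_ball d2) dO.
Qed.

Lemma weak_transportD theta psi : C1 theta -> C1 psi ->
  \int[mu]_(x in Omega) weak_transport (theta \+ psi) x =
  \int[mu]_(x in Omega) weak_transport theta x +
  \int[mu]_(x in Omega) weak_transport psi x.
Proof.
move=> ct cp; have mO := measurable_domain oO.
rewrite -(RintegralD mO (integrable_weak_transport ct) (integrable_weak_transport cp)).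
congr Rintegral; apply/funext => x; rewrite /weak_transport /advect.
have -> : grad (theta \+ psi) = grad theta \+ grad psi.
  by apply: is_gradE; apply: is_gradD; apply: differentiable_is_grad; [case: ct|case: cp].
by rewrite /= dotDr; ring.
Qed.

Lemma weak_transport_domain_eq0 theta : (forall x, Omega x -> theta x = 0) ->
  \int[mu]_(x in Omega) weak_transport theta x = 0.
Proof.
move=> t0; rewrite /Rintegral integral0_eq// => x Ox.
by rewrite /weak_transport /advect (grad_open_eq0 oO Ox t0) t0// dotC /dot !mul0r addr0 !mulr0 addr0.
Qed.

(** Instead of a partition of unity, bumps are split off one at a time along a finite cover: theta =
    theta b + theta (1 - b), where the first part is supported in one box and the second vanishes on
    one more ball. *)
Lemma Rintegral_mass_eq0 : \int[mu]_(x in Omega) m x = 0.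
Proof.
have local p : exists d : R, closure Omega p -> 0 < d /\
    forall theta, C1 theta -> (forall x, ~ box p d x -> theta x = 0) ->
    \int[mu]_(x in Omega) weak_transport theta x = 0.
  have [cp|cp] := pselect (closure Omega p); last by exists 0.
  by have [d d0 Hd] := weak_transport_near cp; exists d.
have [d Hd] := choice local.
have H (s : seq (R * R)) theta : (forall p, p \in s -> closure Omega p) -> C1 theta ->
    (forall x, Omega x -> (forall p, p \in s -> ~ ball p (d p / 2) x) -> theta x = 0) ->
    \int[mu]_(x in Omega) weak_transport theta x = 0.
  elim: s theta => [|p s IH] theta sO ct theta0.
    by apply: weak_transport_domain_eq0 => x Ox; exact: theta0.
  have [d0 Hp] := Hd p (sO p (mem_head _ _)).
  have [b [cb b1 b0]] := bump_ex p d0.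
  have c1 := C1M ct cb; have c2 := C1M ct (C1D (C1_cst (1 : R)) (C1N cb)).
  have -> : theta = (theta \* b) \+ (theta \* (cst 1 \+ (\- b))).
    by apply/funext => x /=; ring.
  rewrite weak_transportD// Hp ?add0r//; last by move=> x bx; rewrite /= b0// mulr0.
  apply: IH => //; first by move=> q qs; apply: sO; rewrite inE qs orbT.
  move=> x Ox qx /=; have [px|px] := pselect (ball p (d p / 2) x); first by rewrite b1// subrr mulr0.
  rewrite theta0 ?mul0r// => q; rewrite inE => /predU1P[->//|]; exact: qx.
have cK : cover_compact (closure Omega).
  pose P := HB.pack_for ptopologicalType (R * R)%type (Pointed.on (R * R)%type) (Topological.on (R * R)%type).
  by have <- := compact_cover P; exact: compact_closure_domain.
have [||D DO OD] := cK _ (closure Omega) (fun p => ball p (d p / 2)).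
- by move=> p _; exact: ball_open.
- by move=> p cp; exists p => //; apply: ballxx; rewrite divr_gt0//; have [] := Hd p cp.
transitivity (\int[mu]_(x in Omega) weak_transport (cst 1) x).
  by congr Rintegral; apply/funext => x; rewrite /weak_transport /advect grad_cst mulr1 dotC /dot !mul0r addr0 mulr0 addr0.
apply: (H (finmap.enum_fset D)); first by move=> p pD; have := DO p pD; rewrite inE.
  exact: C1_cst.
move=> x Ox nb; exfalso; have [p /= pD xp] := OD x (subset_closure Ox).
exact: nb pD xp.
Qed.

End Boundary.

(** * The convection operator *)

Section SquareIntegrable.
Variable R : realType.
Local Notation T := (measurableTypeR R * measurableTypeR R)%type.
Local Notation mu := (@lebesgue2 R).
Variable Omega : set (R * R).
Hypotheses (oO : open Omega) (bO : bounded_set Omega).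
Implicit Types f g b : R * R -> R.

Let mO := measurable_domain oO.

Lemma ae_sub (P Q : R * R -> Prop) : (forall x, P x -> Q x) ->
  {ae mu, forall x, P x} -> {ae mu, forall x, Q x}.
Proof. by move=> PQ; apply: negligibleS => x /=; exact: contra_not (PQ x). Qed.

Lemma ae_and (P Q : R * R -> Prop) :
  {ae mu, forall x, P x} -> {ae mu, forall x, Q x} -> {ae mu, forall x, P x /\ Q x}.
Proof.
move=> aeP aeQ; apply: negligibleS (negligibleU aeP aeQ) => x /= nPQ.
have [Px|Px] := pselect (P x); last by left.
by right => /= Qx; exact: nPQ.
Qed.

Lemma square_integrable_mul_bounded f b : square_integrable Omega f ->
  measurable_fun (Omega : set T) (b : T -> R) ->
  (exists C : R, forall x, Omega x -> `|b x| <= C) ->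
  square_integrable Omega (fun x => f x * b x).
Proof.
move=> /square_integrableE[mf f2] mb [C HC]; apply/square_integrableE; split.
  exact: measurable_funM.
have b2 : exists D : R, forall x, Omega x -> `|b x ^+ 2| <= D.
  by exists (C ^+ 2) => x Ox; rewrite normrX lerXn2r// ?nnegrE// ?HC//; exact: le_trans (HC x Ox).
have := integrableM_bounded mO f2 (measurable_funX 2 mb) b2.
by apply: eq_integrable => // x _ /=; rewrite exprMn.
Qed.

Lemma square_integrableD f g : square_integrable Omega f -> square_integrable Omega g ->
  square_integrable Omega (fun x => f x + g x).
Proof.
move=> sf sg; have /square_integrableE[mf f2] := sf; have /square_integrableE[mg g2] := sg.
apply/square_integrableE; split; first exact: measurable_funD.
have fg := square_integrableM oO sf sg.
have := integrableD mO (integrableD mO f2 g2) (integrableD mO fg fg).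
apply: eq_integrable => // x _ /=; congr EFin; ring.
Qed.

Lemma square_integrableZ (a : R) f : square_integrable Omega f ->
  square_integrable Omega (fun x => f x * a).
Proof.
move=> sf; apply: square_integrable_mul_bounded => //; by exists `|a|.
Qed.

Lemma eq_square_integrable f g : (forall x, Omega x -> f x = g x) ->
  square_integrable Omega f -> square_integrable Omega g.
Proof.
move=> fg /square_integrableE[mf f2]; apply/square_integrableE; split.
  by apply: eq_measurable_fun mf => x; rewrite inE; exact: fg.
by apply: eq_integrable f2 => // x; rewrite inE => Ox /=; rewrite fg.
Qed.

Lemma Rintegral_sqr_eq0 f : square_integrable Omega f ->
  \int[mu]_(x in Omega) (f x * f x) = 0 -> {ae mu, forall x, Omega x -> f x = 0}.
Proof.
move=> sf f0; have ig := square_integrableM oO sf sf.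
have int0 : (\int[mu]_(x in Omega) (f x * f x)%:E = 0)%E.
  by rewrite -[LHS]fineK; [congr EFin|exact: integrable_fin_num ig].
have /(ae_eq_integral_abs mu mO) : measurable_fun (Omega : set T)
    (EFin \o (fun x => f x * f x)) by have /integrableP[] := ig.
move=> [+ _].
have -> : (\int[mu]_(x in Omega) `|(EFin \o (fun x => (f x * f x)%R)) x| =
    \int[mu]_(x in Omega) (f x * f x)%:E)%E.
  by apply: eq_integral => x _ /=; rewrite ger0_norm// -expr2 sqr_ge0.
move=> /(_ int0); apply: ae_sub => x fx Ox.
by have /eqP := fx Ox; rewrite eqe mulf_eq0 orbb => /eqP.
Qed.

Lemma Rintegral_mul_ae_eq f g b : square_integrable Omega f -> square_integrable Omega g ->
  square_integrable Omega b -> {ae mu, forall x, Omega x -> f x = g x} ->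
  \int[mu]_(x in Omega) (f x * b x) = \int[mu]_(x in Omega) (g x * b x).
Proof.
move=> sf sg sb fg; congr fine.
have /integrableP[m1 _] := square_integrableM oO sf sb.
have /integrableP[m2 _] := square_integrableM oO sg sb.
apply: ae_eq_integral; [exact: mO|exact: m1|exact: m2|].
have fgb : {ae mu, forall x, Omega x -> (f x * b x)%:E = (g x * b x)%:E}.
  by apply: ae_sub fg => x fgx Ox; rewrite fgx.
exact: fgb.
Qed.

Lemma Rintegral_test_ae_eq f g : square_integrable Omega f -> square_integrable Omega g ->
  (forall phi, test_function Omega phi ->
    \int[mu]_(x in Omega) (f x * phi x) = \int[mu]_(x in Omega) (g x * phi x)) ->
  {ae mu, forall x, Omega x -> f x = g x}.
Proof.
move=> sf sg fg; have sgN := square_integrableZ (-1) sg.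
have sD := square_integrableD sf sgN.
suff : {ae mu, forall x, Omega x -> f x + g x * -1 = 0}.
  by apply: ae_sub => x fgx Ox; apply/eqP; rewrite -subr_eq0 -[X in _ - X]mulr1 -mulrN fgx.
apply: (du_bois_reymond oO bO sD) => phi tphi.
have mphi : measurable_fun (Omega : set T) (phi : T -> R).
  by apply: measurable_funTS; exact: continuous_measurable_plane (C1_continuous (test_C1 tphi)).
have [[C HC] _ _] := test_bounded tphi.
have bphi : exists C : R, forall x, Omega x -> `|phi x| <= C by exists C => x _; exact: HC.
have i1 := integrableM_bounded mO (square_integrable_integrable oO bO sf) mphi bphi.
have i2 := integrableM_bounded mO (square_integrable_integrable oO bO sg) mphi bphi.
transitivity (\int[mu]_(x in Omega) (f x * phi x - g x * phi x)).
  by apply: eq_Rintegral => x _; ring.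
by rewrite (RintegralB mO i1 i2) fg// subrr.
Qed.

End SquareIntegrable.

(** * Green's formula and the convection form *)

Section Convection.
Variable R : realType.
Local Notation T := (measurableTypeR R * measurableTypeR R)%type.
Local Notation mu := (@lebesgue2 R).
Variables (Omega : set (R * R)) (v : R * R -> R * R).
Hypotheses (hO : bounded_lipschitz_domain Omega) (hv : lipschitz_field Omega v).
Implicit Types (w u c d : R * R -> R) (g : R * R -> R * R).

Let oO : open Omega. Proof. by case: hO. Qed.
Let bO : bounded_set Omega. Proof. by case: hO. Qed.
Let lbO : lipschitz_boundary Omega. Proof. by case: hO. Qed.
Let mO := measurable_domain oO.

Lemma lipschitz_fieldE : exists2 L : R, 0 < L &
  forall x y, closure Omega x -> closure Omega y -> `|v x - v y| <= L * `|x - y|.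
Proof.
have [L L0 HL] := pinfty_ex_gt0 hv; exists L => // x y cx cy.
by apply: (HL (x, y)); split.
Qed.

Lemma velocity_coordinates :
  [/\ measurable_fun (Omega : set T) (fun x : T => (v x).1),
      measurable_fun (Omega : set T) (fun x : T => (v x).2),
      exists C : R, forall x, Omega x -> `|(v x).1| <= C &
      exists C : R, forall x, Omega x -> `|(v x).2| <= C].
Proof.
have [L L0 vL] := lipschitz_fieldE.
have [C C0 HC] := velocity_bounded bO L0 vL.
have cv := continuous_velocity oO L0 vL.
split.
- apply: (continuous_in_measurable_plane oO) => x xO.
  by apply: (@continuous_comp _ _ _ v fst); [exact: cv|exact: cvg_fst].
- apply: (continuous_in_measurable_plane oO) => x xO.
  by apply: (@continuous_comp _ _ _ v snd); [exact: cv|exact: cvg_snd].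
- by exists C => x Ox; apply: le_trans (HC x Ox); have [] := prod_norm_ge (v x).
- by exists C => x Ox; apply: le_trans (HC x Ox); have [] := prod_norm_ge (v x).
Qed.

Lemma square_integrable_velocity w : square_integrable Omega w ->
  square_integrable Omega (fun x => w x * (v x).1) /\
  square_integrable Omega (fun x => w x * (v x).2).
Proof.
by move=> sw; have [m1 m2 b1 b2] := velocity_coordinates; split;
  exact: square_integrable_mul_bounded.
Qed.

Lemma square_integrable_advection g : square_integrable Omega (fun x => (g x).1) ->
  square_integrable Omega (fun x => (g x).2) ->
  square_integrable Omega (fun x => dot (v x) (g x)).
Proof.
move=> s1 s2; have [s1' _] := square_integrable_velocity s1.
have [_ s2'] := square_integrable_velocity s2.
apply: (eq_square_integrable oO _ (square_integrableD oO s1' s2')) => x _.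
by rewrite /dot mulrC (mulrC (g x).2).
Qed.

Lemma convection_square_integrable w c : convection Omega v w c ->
  square_integrable Omega c.
Proof.
move=> [d [g [[sd _] [s1 s2 _] cE]]].
have sg := square_integrable_advection s1 s2.
apply: (eq_square_integrable oO _
  (square_integrableD oO (square_integrableZ oO 2^-1 sd) (square_integrableZ oO 2^-1 sg))) => x Ox.
by rewrite cE//; ring.
Qed.

Hypothesis vtan : tangential Omega v.

(** The flux statement with m = d u + w v.g and rho = u w; the product rule for the field w v and
    the function u supplies its interior hypothesis. *)
Lemma green w u d g : square_integrable Omega w -> square_integrable Omega u ->
  weak_div Omega (fun x => w x *: v x) d -> weak_grad Omega u g ->
  \int[mu]_(x in Omega) (d x * u x) = - \int[mu]_(x in Omega) (w x * dot (v x) (g x)).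
Proof.
move=> sw su [sd wd] [s1 s2 wg].
have [f1 f2] := square_integrable_velocity sw.
have [L L0 vL] := lipschitz_fieldE.
have sg := square_integrable_advection s1 s2.
have idu := square_integrableM oO sd su.
have iwg := square_integrableM oO sw sg.
have irho := square_integrableM oO su sw.
have im := integrableD mO idu iwg.
apply/eqP; rewrite -addr_eq0 -(RintegralD mO idu iwg); apply/eqP.
apply: (Rintegral_mass_eq0 oO bO lbO L0 vL vtan im irho) => psi tpsi.
rewrite -[RHS](product_rule oO bO tpsi f1 f2 sd su s1 s2 wd (fun phi t => (wg phi t).1) (fun phi t => (wg phi t).2)).
by apply: eq_Rintegral => x _; rewrite /weak_transport /advect /dot; ring.
Qed.

(** Green's formula is used twice: the divergence half for one function is opposite to the gradient
    half for the other. *)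
Lemma convection_skew w u c c' : square_integrable Omega w -> square_integrable Omega u ->
  convection Omega v w c -> convection Omega v u c' ->
  \int[mu]_(x in Omega) (c x * u x) = - \int[mu]_(x in Omega) (c' x * w x).
Proof.
move=> sw su [d [g [wd wg cE]]] [d' [g' [wd' wg' cE']]].
have half f z e h : square_integrable Omega e -> square_integrable Omega z ->
    square_integrable Omega (fun x => dot (v x) (h x)) ->
    (forall x, Omega x -> f x = 2^-1 * e x + 2^-1 * dot (v x) (h x)) ->
    \int[mu]_(x in Omega) (f x * z x) =
    2^-1 * (\int[mu]_(x in Omega) (e x * z x) + \int[mu]_(x in Omega) (z x * dot (v x) (h x))).
  move=> se sz sh fE.
  have i1 := square_integrableM oO se sz; have i2 := square_integrableM oO sz sh.
  rewrite -(RintegralD mO i1 i2) -(RintegralZl _ mO (integrableD mO i1 i2)).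
  by apply: eq_Rintegral => x; rewrite inE => Ox; rewrite fE//; ring.
have [[sd _] [sd' _]] := (wd, wd').
have sg : square_integrable Omega (fun x => dot (v x) (g x)).
  by have [s1 s2 _] := wg; exact: square_integrable_advection.
have sg' : square_integrable Omega (fun x => dot (v x) (g' x)).
  by have [s1 s2 _] := wg'; exact: square_integrable_advection.
rewrite (half _ _ _ _ sd su sg cE) (half _ _ _ _ sd' sw sg' cE').
by rewrite (green sw su wd wg') (green su sw wd' wg); ring.
Qed.

(** The two representatives may come from different weak derivatives of the same function, so the
    equality is only almost everywhere and rests on the fundamental lemma. *)
Lemma convection_opp w c c' : convection Omega v w c ->
  convection Omega (fun x => - v x) w c' ->
  {ae mu, forall x, Omega x -> c' x = - c x}.
Proof.
move=> [d [g [[sd wd] [s1 s2 wg] cE]]] [d' [g' [[sd' wd'] [s1' s2' wg'] cE']]].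
have aed : {ae mu, forall x, Omega x -> d' x * -1 = d x}.
  apply: (Rintegral_test_ae_eq oO bO (square_integrableZ oO _ sd') sd) => phi tphi.
  have [_ _ [K [cK KO phi0]]] := tphi.
  (* Testing with the opposite function absorbs the sign of the reversed velocity inside the
     integrand. *)
  have tN : test_function Omega (\- phi).
    by apply: (test_function_of_C1 (C1N (test_C1 tphi)) cK KO) => x Kx /=; rewrite phi0// oppr0.
  have gN : grad (\- phi) = \- grad phi.
    by apply: is_gradE; apply: is_gradN; apply: differentiable_is_grad; case: (test_C1 tphi).
  have wdN := wd' _ tN; rewrite gN in wdN.
  apply: oppr_inj; transitivity (- \int[mu]_(x in Omega) (d' x * (\- phi) x)).
    by congr (- _); apply: eq_Rintegral => x _ /=; ring.
  rewrite -[RHS](wd _ tphi) -[LHS]wdN; apply: eq_Rintegral => x _.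
  by rewrite /dot /=; ring.
have ae1 : {ae mu, forall x, Omega x -> (g' x).1 = (g x).1}.
  apply: (Rintegral_test_ae_eq oO bO s1' s1) => phi tphi.
  by apply: oppr_inj; rewrite -(wg' _ tphi).1; exact: (wg _ tphi).1.
have ae2 : {ae mu, forall x, Omega x -> (g' x).2 = (g x).2}.
  apply: (Rintegral_test_ae_eq oO bO s2' s2) => phi tphi.
  by apply: oppr_inj; rewrite -(wg' _ tphi).2; exact: (wg _ tphi).2.
apply: ae_sub (ae_and aed (ae_and ae1 ae2)) => x [H [H1 H2]] Ox.
by rewrite cE// cE'// -(H Ox) /dot /= H1// H2//; ring.
Qed.

End Convection.

(** * The scheme *)

Section InnerProduct.
Variables (R : realType) (V : vectType R) (b : V -> V -> R).
Hypotheses (bC : forall u w, b u w = b w u)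
  (bL : forall (a : R) u u' w, b (a *: u + u') w = a * b u w + b u' w)
  (b_gt0 : forall w, w != 0 -> 0 < b w w).
Implicit Types (u w y z : V) (A E Q : 'End(V)).

Lemma formDl u u' w : b (u + u') w = b u w + b u' w.
Proof. by rewrite -[u]scale1r bL mul1r scale1r. Qed.

Lemma form0l w : b 0 w = 0.
Proof. by apply: (@addrI _ (b 0 w)); rewrite -formDl !addr0. Qed.

Lemma formZl a u w : b (a *: u) w = a * b u w.
Proof. by rewrite -[a *: u]addr0 bL form0l addr0. Qed.

Lemma formNl u w : b (- u) w = - b u w.
Proof. by rewrite -scaleN1r formZl mulN1r. Qed.

Lemma formBl u u' w : b (u - u') w = b u w - b u' w.
Proof. by rewrite formDl formNl. Qed.

Lemma formDr u u' w : b w (u + u') = b w u + b w u'.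
Proof. by rewrite bC formDl !(bC w). Qed.

Lemma formZr a u w : b w (a *: u) = a * b w u.
Proof. by rewrite bC formZl (bC w). Qed.

Lemma formNr u w : b w (- u) = - b w u.
Proof. by rewrite bC formNl (bC w). Qed.

Lemma form_ge0 w : 0 <= b w w.
Proof. by have [->|/b_gt0/ltW//] := eqVneq w 0; rewrite form0l. Qed.

Lemma form_inj u u' : (forall w, b u w = b u' w) -> u = u'.
Proof.
move=> H; apply/eqP; rewrite -subr_eq0; apply/negPn/negP => /b_gt0.
by rewrite formBl H subrr ltxx.
Qed.

Lemma form_cauchy_schwarz u w : b u w <= Num.sqrt (b u u) * Num.sqrt (b w w).
Proof.
have [->|w0] := eqVneq w 0; first by rewrite bC !form0l sqrtr0 mulr0.
have c0 := b_gt0 w0.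
rewrite -sqrtrM ?form_ge0//; apply: le_trans (ler_norm _) _.
rewrite -sqrtr_sqr ler_wsqrtr//.
have := form_ge0 (b w w *: u - b u w *: w).
rewrite formBl !formZl !formDr !formNr !formZr (bC w u) => H.
have : 0 <= b w w * (b u u * b w w - b u w ^+ 2).
  by apply: le_trans H _; rewrite le_eqVlt; apply/orP; left; apply/eqP; ring.
by rewrite pmulr_rge0// subr_ge0.
Qed.

Section Step.
Variables (E A : 'End(V)) (tau : R).
Hypotheses (tau0 : 0 < tau) (E_sym : forall w u, b (E w) u = b w (E u))
  (E_gt0 : forall w, w != 0 -> 0 < b (E w) w)
  (A_skew : forall w u, b (A w) u = - b (A u) w).

Lemma skew_diag w : b (A w) w = 0.
Proof. by have := A_skew w w; lra. Qed.

Definition step_lhs y z := E (tau^-1 *: (z - y)) + A (2^-1 *: (z + y)).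

(** The operator applied to the new value once the old one has been moved to the right-hand side. *)
Definition step_op : 'End(V) := tau^-1 *: E + 2^-1 *: A.

Lemma step_lhsE y z : step_lhs y z = step_op z - (tau^-1 *: E y - 2^-1 *: A y).
Proof.
rewrite /step_lhs /step_op add_lfunE !scale_lfunE !linearZ/= linearB linearD/=.
by rewrite !scalerN opprD opprK [A (z + y)]linearD scalerDr addrACA.
Qed.

(** Paired with the vector itself, the skew part drops out and E / tau is positive. *)
Lemma step_op_inj : injective step_op.
Proof.
move=> z z' zz'; apply/eqP; rewrite -subr_eq0; apply/negPn/negP => D0.
have : b (step_op (z - z')) (z - z') = 0 by rewrite linearB/= zz' subrr form0l.
rewrite /step_op add_lfunE !scale_lfunE formDl !formZl skew_diag mulr0 addr0 => /eqP.
by rewrite mulf_eq0 invr_eq0 !gt_eqF// E_gt0.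
Qed.

Lemma step_uniquely_solvable y : exists! z, step_lhs y z = 0.
Proof.
have ker0 : lker step_op == 0%VS by apply/lker0P; exact: step_op_inj.
exists (step_op^-1%VF (tau^-1 *: E y - 2^-1 *: A y)); split.
  by rewrite step_lhsE lker0_lfunVK// subrr.
by move=> z /eqP; rewrite step_lhsE subr_eq0 => /eqP <-; rewrite lker0_lfunK.
Qed.

(** Tested with z + y, the skew term vanishes, and by symmetry of [E] the cross terms of (E (z - y),
    z + y) cancel. *)
Lemma step_conservation y z : step_lhs y z = 0 -> b (E z) z = b (E y) y.
Proof.
move=> yz; have : b (step_lhs y z) (z + y) = 0 by rewrite yz form0l.
rewrite /step_lhs formDl !linearZ/= !formZl skew_diag mulr0 addr0 => /eqP.
rewrite mulf_eq0 invr_eq0 gt_eqF//= linearB formBl !formDr (E_sym z y) (bC z) => /eqP.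
by move=> H; apply/eqP; rewrite -subr_eq0 -[X in _ == X]H; apply/eqP; ring.
Qed.

End Step.

End InnerProduct.

(** * The inner product and operator norm on the finite element space *)

Section FiniteElements.
Variables (R : realType) (Omega : set (R * R)) (V : vectType R) (rep : V -> R * R -> R).
Hypotheses (oO : open Omega) (bO : bounded_set Omega) (hV : H1_subspace Omega rep).
Local Notation ip := (ip Omega rep).
Local Notation nrm := (nrm Omega rep).
Local Notation opnorm := (opnorm Omega rep).
Implicit Types (u w : V) (Q : 'End(V)).

Let mO := measurable_domain oO.

Lemma rep_square_integrable w : square_integrable Omega (rep w).
Proof. by case: hV => _ /(_ w)[]. Qed.

Lemma ipC u w : ip u w = ip w u.
Proof. by apply: eq_Rintegral => x _; rewrite mulrC. Qed.

Lemma ipL a u u' w : ip (a *: u + u') w = a * ip u w + ip u' w.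
Proof.
have [lrep _ _] := hV.
have i1 := square_integrableM oO (rep_square_integrable u) (rep_square_integrable w).
have i2 := square_integrableM oO (rep_square_integrable u') (rep_square_integrable w).
have iZ := integrableZl mO a i1.
transitivity (\int[@lebesgue2 R]_(x in Omega) (a * (rep u x * rep w x) + rep u' x * rep w x)).
  apply: eq_Rintegral => x _; rewrite lrep.
  by transitivity ((a * rep u x + rep u' x) * rep w x) => //; ring.
by rewrite (RintegralD mO iZ i2) (RintegralZl a mO i1).
Qed.

(** Definiteness is the last clause of [H1_subspace]: a representative that is zero almost
    everywhere belongs to the zero element. *)
Lemma ip_gt0 w : w != 0 -> 0 < ip w w.
Proof.
move=> w0; have ge0 : 0 <= ip w w by apply: Rintegral_ge0 => x _; rewrite -expr2 sqr_ge0.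
rewrite lt_def ge0 andbT; apply: contra_neq w0 => ip0.
have [_ _] := hV; apply; exact: (Rintegral_sqr_eq0 oO (rep_square_integrable w) ip0).
Qed.

Lemma nrmZ a w : nrm (a *: w) = `|a| * nrm w.
Proof.
rewrite /nrm (formZl ipL) (formZr ipC ipL) mulrA -expr2 sqrtrM ?sqr_ge0//.
by rewrite sqrtr_sqr.
Qed.

Lemma nrm_gt0 w : w != 0 -> 0 < nrm w.
Proof. by move=> w0; rewrite sqrtr_gt0 ip_gt0. Qed.

Lemma opnorm_ge Q w : has_sup [set nrm (Q w) | w in [set w | nrm w <= 1]] ->
  nrm (Q w) <= opnorm Q * nrm w.
Proof.
move=> hs; have [->|w0] := eqVneq w 0.
  have nrm0 : nrm 0 = 0 by rewrite -(scale0r (0 : V)) nrmZ normr0 mul0r.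
  by rewrite linear0 nrm0 mulr0.
have n0 := nrm_gt0 w0; rewrite -ler_pdivrMr//.
have -> : nrm (Q w) / nrm w = nrm (Q ((nrm w)^-1 *: w)).
  by rewrite linearZ/= nrmZ gtr0_norm ?invr_gt0// mulrC.
apply: ub_le_sup; first by case: hs.
by exists ((nrm w)^-1 *: w) => //=; rewrite nrmZ gtr0_norm ?invr_gt0// mulVf// gt_eqF.
Qed.

(* The hypothesis on [tau] also rules out the junk values of [opnorm Q]: an
   unbounded set has supremum [0] and then the right-hand side is [x / 0 = 0]. *)
Lemma small_step Q (tau : R) : 0 < tau ->
  (Q != 0 -> tau < 2 * Num.sqrt 3 / Num.sqrt (opnorm Q)) ->
  forall w, w != 0 -> 12^-1 * tau ^+ 2 * ip (Q w) w < ip w w.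
Proof.
move=> tau0 tauQ w w0; have [->|Q0] := eqVneq Q 0.
  by rewrite zero_lfunE (form0l ipL) mulr0 ip_gt0.
move: (tauQ Q0) => {Q0} {}tauQ; set op := opnorm Q in tauQ.
have s0 : 0 < Num.sqrt op.
  rewrite lt_def sqrtr_ge0 andbT; apply/eqP => s0; move: tauQ.
  by rewrite s0 invr0 mulr0 ltNge ltW.
have op0 : 0 < op by rewrite -sqrtr_gt0.
have hs : has_sup [set nrm (Q w) | w in [set w | nrm w <= 1]].
  by apply: contrapT => /sup_out op_eq0; move: op0; rewrite /op /Defs.opnorm op_eq0 ltxx.
(* The square of 2 sqrt 3 is 12, which matches the coefficient 1 / 12 of [Eop]. *)
have top : tau ^+ 2 * op < 12.
  have : tau * Num.sqrt op < 2 * Num.sqrt 3 by rewrite -ltr_pdivlMr.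
  rewrite -(ltr_pXn2r (n := 2))// ?nnegrE ?mulr_ge0 ?sqrtr_ge0 ?(ltW tau0)//.
  by rewrite !exprMn !sqr_sqrtr ?(ltW op0)//; lra.
have ipop : ip (Q w) w <= op * ip w w.
  apply: le_trans (form_cauchy_schwarz ipC ipL ip_gt0 _ _) _.
  have nw : ip w w = nrm w * nrm w by rewrite -expr2 sqr_sqrtr// ltW// ip_gt0.
  rewrite [X in _ <= op * X]nw.
  by rewrite mulrA ler_wpM2r ?sqrtr_ge0//; exact: opnorm_ge.
have ip0 := ip_gt0 w0; have t2 : 0 < tau ^+ 2 by rewrite exprn_gt0.
have h1 : tau ^+ 2 * ip (Q w) w <= tau ^+ 2 * op * ip w w by rewrite -mulrA ler_pM2l.
have h2 : tau ^+ 2 * op * ip w w < 12 * ip w w by rewrite ltr_pM2r.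
by rewrite -mulrA mulrC ltr_pdivrMr// mulrC [ltRHS]mulrC; apply: le_lt_trans h2; rewrite mulrC.
Qed.

End FiniteElements.

Theorem theorem9 (R : realType) (Omega : set (R * R)) (v : R * R -> R * R)
    (V : vectType R) (rep : V -> R * R -> R) (A Q : 'End(V)) (tau : R)
    (hOmega : bounded_lipschitz_domain Omega)
    (hv : lipschitz_field Omega v)
    (hvnu : tangential Omega v)
    (hV : H1_subspace Omega rep)
    (hAQ : discrete_operators Omega rep v A Q)
    (htau : 0 < tau)
    (htauQ : Q != 0 ->
      tau < 2 * Num.sqrt 3 / Num.sqrt (opnorm Omega rep Q)) :
  [/\ uniquely_solvable tau A Q,
      time_reversible Omega rep v tau A Q,
      stable Omega rep tau A Q &
      forall (N : nat) (u0 : V) (y : nat -> V),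
        LW_solution tau A Q N u0 y ->
        forall n, (n < N)%N ->
          nrmE Omega rep (Eop tau Q) (y n.+1) =
          nrmE Omega rep (Eop tau Q) (y n)].

Proof.
have [_ oO _ bO _] := hOmega.
have ip_C := @ipC R Omega V rep; have ip_L := ipL oO hV; have ip_pos := ip_gt0 oO hV.
have srep := rep_square_integrable hV.
have [cA [cAE opE]] := hAQ.
have scA w := convection_square_integrable hOmega hv (cAE w).
have A_skew w u : ip Omega rep (A w) u = - ip Omega rep (A u) w.
  rewrite (opE w u).1 (opE u w).1.
  exact: (convection_skew hOmega hv hvnu (srep w) (srep u) (cAE w) (cAE u)).
have Q_sym w u : ip Omega rep (Q w) u = ip Omega rep w (Q u).
  rewrite (ip_C w) (opE w u).2 (opE u w).2.
  by apply: eq_Rintegral => x _; rewrite mulrC.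
have EE w : Eop tau Q w = w - (12^-1 * tau ^+ 2) *: Q w.
  by rewrite /Eop add_lfunE opp_lfunE scale_lfunE id_lfunE.
have E_sym w u : ip Omega rep (Eop tau Q w) u = ip Omega rep w (Eop tau Q u).
  by rewrite !EE (formBl ip_L) (formZl ip_L) (formDr ip_C ip_L) (formNr ip_C ip_L)
    (formZr ip_C ip_L) Q_sym.
have E_pos w : w != 0 -> 0 < ip Omega rep (Eop tau Q w) w.
  move=> w0; rewrite EE (formBl ip_L) (formZl ip_L) subr_gt0.
  exact: (small_step oO hV htau htauQ).
have conserved N u0 y : LW_solution tau A Q N u0 y -> forall n, (n < N)%N ->
    nrmE Omega rep (Eop tau Q) (y n.+1) = nrmE Omega rep (Eop tau Q) (y n).
  move=> [_ sol] n nN; congr Num.sqrt.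
  exact: (step_conservation ip_C ip_L htau E_sym A_skew (sol n nN)).
split => //.
- exact: (step_uniquely_solvable ip_L htau E_pos A_skew).
- move=> A' Q' [cA' [cAE' opE']] y z yz.
  have hvN : lipschitz_field Omega (fun x => - v x).
    have [M [Mr HM]] := hv; exists M; split=> // L /HM vL x /vL.
    by rewrite /= -opprD normrN.
  have scA' w := convection_square_integrable hOmega hvN (cAE' w).
  (* The representatives agree up to sign only almost everywhere; the operators are compared through
     the integrals that define them. *)
  have aeN w : {ae @lebesgue2 R, forall x, Omega x -> cA' w x = cA w x * -1}.
    apply: ae_sub (convection_opp hOmega (cAE w) (cAE' w)) => x H Ox.
    by rewrite H// mulrN1.
  have scAN w := square_integrableZ oO (-1) (scA w).
  have A'E w : A' w = - A w.
    apply: (form_inj ip_L ip_pos) => u; rewrite (formNl ip_L) (opE' w u).1 (opE w u).1.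
    rewrite (Rintegral_mul_ae_eq oO (scA' w) (scAN w) (srep u) (aeN w)).
    transitivity (-1 * \int[@lebesgue2 R]_(x in Omega) (cA w x * rep u x)); last exact: mulN1r.
    rewrite -(RintegralZl _ (measurable_domain oO) (square_integrableM oO (scA w) (srep u))).
    by apply: eq_Rintegral => x _; ring.
  (* The representatives occur in both factors, so the sign appears twice; the factors are replaced
     one after the other. *)
  have Q'E : Q' = Q.
    apply/lfunP => w; apply: (form_inj ip_L ip_pos) => u; rewrite (opE' w u).2 (opE w u).2.
    rewrite (Rintegral_mul_ae_eq oO (scA' w) (scAN w) (scA' u) (aeN w)).
    transitivity (\int[@lebesgue2 R]_(x in Omega) (cA' u x * (cA w x * -1))).
      by apply: eq_Rintegral => x _; rewrite mulrC.
    rewrite (Rintegral_mul_ae_eq oO (scA' u) (scAN u) (scAN w) (aeN u)).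
    by apply: eq_Rintegral => x _; ring.
  have A'_skew w u : ip Omega rep (A' w) u = - ip Omega rep (A' u) w.
    by rewrite !A'E !(formNl ip_L) A_skew.
  (* With the roles of y and z exchanged and [A] negated, the left-hand side is the opposite of the
     original one. *)
  have zy : LW_step tau A' Q' z y.
    rewrite /LW_step Q'E A'E -[y - z]opprB scalerN linearN/= -opprD [y + z]addrC.
    by rewrite (yz : _ = 0) oppr0.
  split=> // z' zz'; rewrite Q'E in zy zz'.
  have [y' [_ y'_unique]] := step_uniquely_solvable ip_L htau E_pos A'_skew z.
  by rewrite -(y'_unique _ zz') -(y'_unique _ zy).
- split; first by split.
  by move=> N u0 y sol n nN; rewrite (conserved N u0 y sol n nN).
Qed.
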